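(* Let $f(u)=\dfrac{u}{\sigma(u)^{1/H}}$ and assume that $f$ is continuous and $\lim_{u\to0^+}f(u)=0$. For $u>0$ let $$I(u)=h(u)+p\,u+G\bigl(f(u)\bigr),\qquad G(v)=E\bigl(C(Z_v)\bigr)\ \ (v>0),$$ which is the value, for every $x\ge0$, of the long-run average cost functional $h(u)+\limsup_{T\to\infty}\frac1T E\bigl(\int_0^T C(X_x^u(t))\,dt+p\,L_x^u(T)\bigr)$. Then: (i) $\lim_{u\to0^+}I(u)=\lim_{u\to+\infty}I(u)=+\infty$, and $I$ is a finite continuous function on $(0,\infty)$. Furthermore, there is a constant $u^*>0$ such that $I(u^* )=\min_{u>0}I(u)$. (ii) Suppose that $f$ is a concave increasing function. If $p>0$ and $h$ and $C$ are convex functions, then $u^*$ is unique. If $p=0$, $h$ is a strictly convex function and $C$ is a convex function, then $u^*$ is unique.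
   Context: Let $H\in[\tfrac12,1)$ and let $W_H=(W_H(t))_{t\ge 0}$ be a fractional Brownian motion with Hurst parameter $H$: a continuous zero-mean Gaussian process with $W_H(0)=0$ and $\mathrm{Cov}(W_H(s),W_H(t))=\frac12\bigl[t^{2H}+s^{2H}-|t-s|^{2H}\bigr]$ for $s,t\ge 0$. Let $\sigma:[0,\infty)\to(0,\infty)$ be a deterministic continuous function. For $x\ge 0$ and $u\ge 0$ define, for $t\ge 0$, $$L_x^u(t)=-\min\Bigl\{0,\min_{s\in[0,t]}\bigl(x-us+\sigma(u)W_H(s)\bigr)\Bigr\},\qquad X_x^u(t)=x-ut+\sigma(u)W_H(t)+L_x^u(t).$$ For $v>0$ put $Z_v=\max_{s\ge 0}\{W_H(s)-vs\}$ (almost surely finite). Standing assumptions: $p\ge 0$ is a constant; $h:[0,\infty)\to[0,\infty)$ is continuous, non-decreasing, with $\lim_{u\to\infty}h(u)=+\infty$; $C:[0,\infty)\to[0,\infty)$ is continuous, non-decreasing, and satisfies $C(y)\le K(1+y^\gamma)$ for all $y\ge0$, for some constants $K>0$, $\gamma>0$.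
   Formalization: The limit of I at 0+ and the existence of u* are stated under the added assumption C(y)→+∞ as y→+∞; without it they fail, e.g. C=0, h(u)=u, p=0, σ=1 gives I(u)=u. All other claims are stated without this assumption. *)

(* Defs.v *)
From HB Require Import structures.
From mathcomp Require Import all_boot all_order all_algebra.
From mathcomp Require Import all_classical all_reals all_analysis.

Set Implicit Arguments.
Unset Strict Implicit.
Unset Printing Implicit Defensive.

Import Order.TTheory GRing.Theory Num.Theory.
Import numFieldNormedType.Exports.

Local Open Scope classical_set_scope.
Local Open Scope ring_scope.
Local Open Scope convex_scope.

(* The Dirac case is separate because the library's [normal_prob m 0] is the
   uniform law on [0, 1]. The sign of [s] is immaterial. *)
Definition gaussian d (T : measurableType d) (R : realType)
    (P : probability T R) (X : T -> R) : Prop :=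
  exists m s : R, forall A : set R, measurable A ->
    P (X @^-1` A) = if s == 0 then \d_m A else normal_prob m s A.

Definition gaussian_process d (T : measurableType d) (R : realType)
    (P : probability T R) (W : R -> {RV P >-> R}) : Prop :=
  forall (n : nat) (t a : 'I_n -> R), (forall i, 0 <= t i) ->
    gaussian P (fun w => \sum_(i < n) a i * W (t i) w).

(* The time set is [0, +oo[: values at negative times are unconstrained and
   never used. *)
Record fractional_brownian_motion d (T : measurableType d) (R : realType)
    (P : probability T R) (H : R) (W : R -> {RV P >-> R}) : Prop := {
  fbm_gaussian : gaussian_process W ;
  fbm_continuous : forall w, {within `[0, +oo[, continuous (fun t => W t w)} ;
  fbm_start : forall w, W 0 w = 0 ;
  fbm_mean : forall t : R, 0 <= t -> 'E_P[W t]%E = 0%E ;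
  fbm_cov : forall s t : R, 0 <= s -> 0 <= t ->
    covariance P (W s) (W t) =
      (2^-1 * (t `^ (2 * H) + s `^ (2 * H) - `|t - s| `^ (2 * H)))%:E }.

Section queue.
Context d (T : measurableType d) (R : realType) (P : probability T R).
Variables (W : R -> {RV P >-> R}) (sigma : R -> R).

Definition netput (x u t : R) (w : T) : R := x - u * t + sigma u * W t w.

(* For t >= 0 the infimum is a minimum since the paths are continuous. *)
Definition regulator (x u t : R) (w : T) : R :=
  - Num.min 0 (inf [set netput x u s w | s in `[0, t]]).

Definition queue_length (x u t : R) (w : T) : R :=
  netput x u t w + regulator x u t w.

(* max_(s >= 0) (W s - v s). For v > 0 it is almost surely finite; on the null
   event where the set is unbounded, [sup] returns 0. *)
Definition max_drifted (v : R) (w : T) : R :=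
  sup [set W s w - v * s | s in `[0, +oo[].

Variables (h C : R -> R) (p : R).

Definition long_run_average_cost (x u : R) : \bar R :=
  ((h u)%:E + limf_esup (fun tau : R => (tau^-1)%:E *
     'E_P[(fun w => \int[lebesgue_measure]_(t in `[0%R, tau])
                       C (queue_length x u t w)
                     + p * regulator x u tau w)%R]) (pinfty_nbhs R))%E.

Definition mean_cost (v : R) : \bar R := 'E_P[(fun w => C (max_drifted v w))]%E.

Definition effective_drift (H u : R) : R := u / sigma u `^ H^-1.

Definition drift_cost (H u : R) : \bar R :=
  ((h u + p * u)%:E + mean_cost (effective_drift H u))%E.

End queue.

Definition strictly_convex_function (R : realType) (D : set R) (f : R -> R) :
    Prop :=
  forall t : {i01 R}, 0 < t%:num -> t%:num < 1 ->
    {in D &, forall x y : R^o, x != y ->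
      (f (x <| t |> y) : R^o) < (f x : R^o) <| t |> f y}.

Definition concave_function (R : realType) (D : set R) (f : R -> R) : Prop :=
  forall t : {i01 R}, {in D &, forall x y : R^o,
    (f x : R^o) <| t |> f y <= (f (x <| t |> y) : R^o)}.

Definition minimizer_pos (R : realType) (I : R -> \bar R) (u : R) : Prop :=
  0 < u /\ forall v : R, 0 < v -> (I u <= I v)%E.

(* Main.v *)
Require Import Defs.
From HB Require Import structures.
From mathcomp Require Import all_boot all_order all_algebra.
From mathcomp Require Import all_classical all_reals all_analysis.
From mathcomp Require Import measurable_realfun.
From mathcomp Require Import ring lra.

(** Why the theorem holds. By time reversal and self-similarity, the
    stationary law of the queue is that of a multiple of one variable Z, the
    maximum over s >= 0 of W s - s. The maximum of sigma(u) W s - u s has the law of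
    f(u) ^ (- kappa) Z with kappa = H / (1 - H) (drifted_sup_eq_law,
    drift_scale_effective), so the stationary cost is S (f(u) ^ (- kappa)),
    where S b is the mean of C (b Z) (scaled_cost, mean_costE). Everything
    about the drift cost is then read from S and from h.

    Moments of Z. Since C grows polynomially, S is finite and continuous as soon
    as Z has moments of all orders. For this, the paths are chained along dyadic
    points of [0, 2 ^ j] (chaining, path_chain_bound); Gaussian moments of a
    large order 2 m, together with 2 H < 2, give one integrable variable that
    dominates (W t - t) ^ a for all t at once (drift_moment).

    Equality in law of suprema. The suprema are taken along countable dense sets
    of times, and the joint laws are compared through linear combinations, which
    are Gaussian with variances read from the covariance. The passage from linear
    combinations to joint laws is a Cramer-Wold theorem proved with
    trigonometric polynomials (cramer_wold_le, eq_law_sup_seq).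

    Long-run cost. The queue started at x is the maximum of the free netput and
    of the queue started empty (queue_length_max). The latter has at time t the
    law of the maximum over [0, t] (reflected_eq_law), whose expected cost
    increases to the stationary one. The netput dominates only up to a random
    time with finite weighted cost, hence an error of order 1 / t
    (queue_cost_ub). Tonelli's theorem and a Cesaro argument give the time
    average, and the regulator grows like u t in mean because the queue length
    stays bounded in mean (long_run_average_limit).

    Optimal drift. If C is unbounded the cost tends to infinity at 0, where
    f(u) ^ (- kappa) blows up; it always does at infinity, because of h; so a
    minimum exists by compactness (minimum_pos). When f is concave and strictly
    increasing, f ^ (- kappa) is strictly convex at midpoints, and for convex C
    the function S is convex and nondecreasing (concave_drift_midpoint). Strict
    inequality comes from h when h is strictly convex. For p > 0 it comes from
    S, which is strictly increasing unless C is constant; and if C is constant,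
    p u makes the cost strictly increasing (minimizer_unique_linear). *)

Import Order.TTheory GRing.Theory Num.Theory.
Import numFieldNormedType.Exports.
Local Open Scope classical_set_scope.
Local Open Scope ring_scope.

Set Implicit Arguments.
Unset Strict Implicit.
Unset Printing Implicit Defensive.

(** * Equality in law and trigonometric polynomials *)

Section law.
Context d (T : measurableType d) (R : realType) (P : probability T R).

Definition eq_law (X Y : T -> R) : Prop :=
  forall A : set R, measurable A -> P (X @^-1` A) = P (Y @^-1` A).

Lemma eq_law_integral (X Y : T -> R) (phi : R -> \bar R) :
  measurable_fun setT X -> measurable_fun setT Y -> eq_law X Y ->
  measurable_fun [set: R] phi -> (forall y, 0 <= phi y)%E ->
  (\int[P]_w phi (X w) = \int[P]_w phi (Y w))%E.
Proof.
move=> mX mY XY mphi phi0.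
pose X' : {RV P >-> R} := HB.pack X (isMeasurableFun.Build _ _ _ _ _ mX).
pose Y' : {RV P >-> R} := HB.pack Y (isMeasurableFun.Build _ _ _ _ _ mY).
transitivity (\int[distribution P X']_y phi y)%E.
  by rewrite ge0_integral_distribution.
rewrite (eq_measure_integral (distribution P Y')); last first.
  by move=> A mA _; exact: XY.
by rewrite ge0_integral_distribution.
Qed.

Lemma eq_law_integrable (X Y : T -> R) (phi : R -> \bar R) :
  measurable_fun setT X -> measurable_fun setT Y -> eq_law X Y ->
  measurable_fun [set: R] phi ->
  P.-integrable setT (phi \o X) -> P.-integrable setT (phi \o Y) ->
  (\int[P]_w phi (X w) = \int[P]_w phi (Y w))%E.
Proof.
move=> mX mY XY mphi iX iY.
pose X' : {RV P >-> R} := HB.pack X (isMeasurableFun.Build _ _ _ _ _ mX).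
pose Y' : {RV P >-> R} := HB.pack Y (isMeasurableFun.Build _ _ _ _ _ mY).
transitivity (\int[distribution P X']_y phi y)%E.
  by rewrite integral_distribution.
rewrite (eq_measure_integral (distribution P Y')); last first.
  by move=> A mA _; exact: XY.
by rewrite integral_distribution.
Qed.

(** Half-lines form a pi-system generating the Borel sets, so a law is
    determined by its distribution function. *)
Lemma eq_law_le (X Y : T -> R) :
  measurable_fun setT X -> measurable_fun setT Y ->
  (forall c, P [set w | X w <= c] = P [set w | Y w <= c]) -> eq_law X Y.
Proof.
move=> mX mY XY A mA.
pose X' : {RV P >-> R} := HB.pack X (isMeasurableFun.Build _ _ _ _ _ mX).
pose Y' : {RV P >-> R} := HB.pack Y (isMeasurableFun.Build _ _ _ _ _ mY).
apply: (@measure_unique _ R _ (@RGenOInfty.G R) (fun k => `]-k%:R, +oo[%classic)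
  _ _ _ _ (distribution P X') (distribution P Y')) => //.
- exact: RGenOInfty.measurableE.
- move=> _ _ [a ->] [b ->]; exists (Num.max a b).
  by apply/seteqP; split => y /=; rewrite !in_itv/= !andbT gt_max => /andP.
- by move=> k; exists (- k%:R).
- apply/seteqP; split => // y _; exists (Num.truncn `|y|).+1 => //=.
  rewrite in_itv/= andbT ltrNl (le_lt_trans _ (truncnS_gt `|y|))//.
  by rewrite -normrN ler_norm.
- move=> _ [x ->] /=.
  have mle (Z : T -> R) : measurable_fun setT Z -> measurable [set w : T | Z w <= x].
    move=> mZ; rewrite -[X in measurable X]setTI.
    by apply: measurable_fun_le => //; exact: measurable_cst.
  have E (Z : T -> R) : Z @^-1` `]x, +oo[ = ~` [set w : T | Z w <= x].
    apply/seteqP; split => w /=; rewrite in_itv/= andbT; last by move/negP; rewrite -ltNge.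
    by rewrite ltNge => /negP.
  rewrite /distribution /pushforward !E !probability_setC ?XY//; exact: mle.
- by move=> k; rewrite ltey_eq fin_num_measure.
Qed.

Section trigonometric_polynomials.
Variable n : nat.
Implicit Types (g h : ('I_n -> R) -> R) (a x : 'I_n -> R).

(** Real trigonometric polynomials in several variables with arbitrary
    frequencies. They form an algebra, and each monomial reads its argument only
    through one linear form: that is what ties joint laws to the laws of linear
    combinations. *)
Inductive trig_poly : (('I_n -> R) -> R) -> Prop :=
| trig_cos c a b : trig_poly (fun x => c * cos (\sum_i a i * x i + b))
| trig_add g h : trig_poly g -> trig_poly h -> trig_poly (g \+ h).

Lemma trig_ext g h : trig_poly g -> g =1 h -> trig_poly h.
Proof. by move=> tg /funext <-. Qed.

Lemma trig_cst c : trig_poly (fun=> c).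
Proof.
apply: (trig_ext (trig_cos c (fun=> 0) 0)) => x.
by rewrite big1 ?addr0 ?cos0 ?mulr1// => i _; rewrite mul0r.
Qed.

(** Product-to-sum formula for the cosine. *)
Lemma trig_mul g h : trig_poly g -> trig_poly h -> trig_poly (g \* h).
Proof.
elim=> {g} [c a b|g1 g2 _ IH1 _ IH2] th; last first.
  by apply: (trig_ext (trig_add (IH1 th) (IH2 th))) => x /=; rewrite mulrDl.
elim: th => {h} [c' a' b'|h1 h2 _ IH1 _ IH2]; last first.
  by apply: (trig_ext (trig_add IH1 IH2)) => x /=; rewrite mulrDr.
apply: (trig_ext (trig_add
  (trig_cos (c * c' / 2) (fun i => a i + a' i) (b + b'))
  (trig_cos (c * c' / 2) (fun i => a i - a' i) (b - b')))) => x /=.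
set u := \sum_i a i * x i + b; set v := \sum_i a' i * x i + b'.
have -> : \sum_i (a i + a' i) * x i + (b + b') = u + v.
  by under eq_bigr do rewrite mulrDl; rewrite big_split/= addrACA.
have -> : \sum_i (a i - a' i) * x i + (b - b') = u - v.
  by under eq_bigr do rewrite mulrBl; rewrite sumrB/= /u /v; ring.
by rewrite cosB cosD; field.
Qed.

Lemma trig_exp g m : trig_poly g -> trig_poly (fun x => g x ^+ m).
Proof.
move=> tg; elim: m => [|m IH]; first exact: trig_cst.
by apply: (trig_ext (trig_mul tg IH)) => x /=; rewrite exprS.
Qed.

Lemma trig_prod (I : Type) (s : seq I) (G : I -> ('I_n -> R) -> R) :
  (forall i, trig_poly (G i)) -> trig_poly (fun x => \prod_(i <- s) G i x).
Proof.
move=> tG; elim: s => [|i s IH].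
  by apply: (trig_ext (trig_cst 1)) => x; rewrite big_nil.
by apply: (trig_ext (trig_mul (tG i) IH)) => x; rewrite big_cons.
Qed.

Lemma trig_sin c (i : 'I_n) b : trig_poly (fun x => sin (c * x i + b)).
Proof.
apply: (trig_ext (trig_cos 1 (fun j => if j == i then c else 0) (b - pi / 2))).
move=> x; rewrite mul1r addrA cosBpihalf; congr (sin (_ + _)).
rewrite (bigD1 i)//= eqxx big1 ?addr0// => j /negbTE ->.
by rewrite mul0r.
Qed.

(** Each monomial is a bounded function of a single linear combination. *)
Lemma expectation_trig_poly (X Y : 'I_n -> T -> R) g :
  (forall i, measurable_fun setT (X i)) ->
  (forall i, measurable_fun setT (Y i)) ->
  (forall a, eq_law (fun w => \sum_i a i * X i w) (fun w => \sum_i a i * Y i w)) ->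
  trig_poly g ->
  (\int[P]_w (g (X^~ w))%:E = \int[P]_w (g (Y^~ w))%:E)%E.
Proof.
move=> mX mY XY tg.
suff [] : [/\ P.-integrable setT (fun w => (g (X^~ w))%:E),
  P.-integrable setT (fun w => (g (Y^~ w))%:E) &
  (\int[P]_w (g (X^~ w))%:E = \int[P]_w (g (Y^~ w))%:E)%E] by [].
elim: tg => {g} [c a b|g h _ [iX iY IH] _ [iX' iY' IH']]; last first.
  split.
  - by rewrite -[X in _.-integrable _ X]/(fun w => (g (X^~ w))%:E + (h (X^~ w))%:E)%E; exact: integrableD.
  - by rewrite -[X in _.-integrable _ X]/(fun w => (g (Y^~ w))%:E + (h (Y^~ w))%:E)%E; exact: integrableD.
  - by under eq_integral do rewrite EFinD; under [RHS]eq_integral do rewrite EFinD;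
      rewrite !integralD// IH IH'.
have mlin (Z : 'I_n -> T -> R) : (forall i, measurable_fun setT (Z i)) ->
    measurable_fun setT (fun w => \sum_i a i * Z i w).
  by move=> mZ; apply: measurable_sum => i; exact: measurable_funM.
have mcos : measurable_fun [set: R] (fun y : R => c * cos (y + b)).
  apply: continuous_measurable_fun => y; apply: cvgM; first exact: cvg_cst.
  apply: (cvg_comp (fun y => y + b) cos); last exact: continuous_cos.
  by apply: cvgD; [exact: cvg_id|exact: cvg_cst].
have icos (Z : T -> R) : measurable_fun setT Z ->
    P.-integrable setT (fun w => (c * cos (Z w + b))%:E).
  move=> mZ; apply: measurable_bounded_integrable => //.
  - by rewrite ltey_eq fin_num_measure.
  - exact: (measurableT_comp mcos).
  - exists `|c|; split; first exact: num_real.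
    move=> M cM w _ /=; rewrite (le_trans _ (ltW cM))// normrM ler_piMr//.
    exact: cos_max.
split; [exact: icos (mlin _ mX)|exact: icos (mlin _ mY)|].
apply: (@eq_law_integrable _ _ (fun y => (c * cos (y + b))%:E)
  (mlin _ mX) (mlin _ mY) (XY a)); first exact/measurable_EFinP.
- exact: icos (mlin _ mX).
- exact: icos (mlin _ mY).
Qed.

End trigonometric_polynomials.
End law.

(** * Polynomial approximation of a threshold *)

Section threshold.
Variable R : realType.
Implicit Types y : R.

(** A polynomial on [0, 1] that tends to the indicator of [0, 1/2[: the power
    y ^ m is negligible against 2 ^ (- m) below 1/2 and at least 2 ^ (- m) from 1/2
    on, and the outer exponent m * 2 ^ m amplifies the difference. *)
Definition soft_step m y : R := (1 - y ^+ m) ^+ (m * 2 ^ m)%N.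

Lemma bernoulli_ineq y n : 0 <= y <= 1 -> 1 - n%:R * y <= (1 - y) ^+ n.
Proof.
move=> /andP[y0 y1]; elim: n => [|n IH]; first by rewrite mul0r subr0 expr0.
have y01 : 0 <= 1 - y by rewrite subr_ge0.
rewrite exprS (le_trans _ (ler_wpM2l y01 IH))//.
rewrite -subr_ge0 -natr1; suff -> : (1 - y) * (1 - n%:R * y) - (1 - (n%:R + 1) * y) = n%:R * y ^+ 2.
  by rewrite mulr_ge0// sqr_ge0.
ring.
Qed.

Lemma soft_step_itv m y : 0 <= y <= 1 -> 0 <= soft_step m y <= 1.
Proof.
move=> /andP[y0 y1]; have y01 : 0 <= 1 - y ^+ m <= 1.
  by rewrite subr_ge0 exprn_ile1//= gerBl exprn_ge0.
by case/andP: y01 => a b; rewrite exprn_ge0// exprn_ile1.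
Qed.

Lemma cvg_natr_exp y : 0 <= y < 1 -> (fun m => m%:R * y ^+ m) @ \oo --> 0.
Proof.
move=> /andP[y0 y1]; have [->|yn0] := eqVneq y 0.
  rewrite (_ : (fun _ => _) = cst 0); first exact: cvg_cst.
  by apply/funext => -[|m]; rewrite ?mul0r// expr0n/= mulr0.
have yp : 0 < y by rewrite lt_def yn0.
pose s := Num.sqrt y; have s0 : 0 < s by rewrite sqrtr_gt0.
have s1 : s < 1 by rewrite -sqrtr1 ltr_sqrt.
have sy : y = s * s by rewrite -expr2 sqr_sqrtr.
have bnd m : m%:R * s ^+ m <= (s^-1 - 1)^-1.
  have si : 0 < s^-1 - 1 by rewrite subr_gt0 invf_gt1.
  rewrite -[leRHS]mul1r ler_pdivlMr// -(@ler_pM2l _ (s^-1 ^+ m)) ?exprn_gt0 ?invr_gt0//.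
  rewrite mulr1 mulrA mulrCA -exprMn mulVf ?gt_eqF// expr1n mulr1.
  have : forall k, k%:R * (s^-1 - 1) + 1 <= s^-1 ^+ k.
    elim=> [|k IH]; first by rewrite mul0r add0r expr0.
    rewrite exprS (le_trans _ (ler_wpM2l (ltW _) IH)) ?invr_gt0//.
    rewrite -subr_ge0 -natr1.
    suff -> : s^-1 * (k%:R * (s^-1 - 1) + 1) - ((k%:R + 1) * (s^-1 - 1) + 1) =
       k%:R * (s^-1 - 1) ^+ 2 by rewrite mulr_ge0// sqr_ge0.
    ring.
  move/(_ m); lra.
apply: (@squeeze_cvgr _ _ _ _ (fun=> 0) (fun m => (s^-1 - 1)^-1 * s ^+ m)).
- apply: nearW => m; rewrite mulr_ge0 ?exprn_ge0//= sy exprMn mulrA.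
  by rewrite ler_wpM2r// exprn_ge0// ltW.
- exact: cvg_cst.
- rewrite -(mulr0 (s^-1 - 1)^-1); apply: cvgMr; apply: cvg_expr.
  by rewrite gtr0_norm.
Qed.

(** Below 1/2 Bernoulli's inequality gives 1 - m * (2 y) ^ m; from 1/2 on,
    1 - z <= exp (- z) gives exp (- m). *)
Lemma cvg_soft_step y : 0 <= y <= 1 ->
  (soft_step m y @[m --> \oo]) --> ((y < 2^-1)%R%:R : R).
Proof.
move=> y01; have /andP[y0 y1] := y01; have [ylt|yge] := ltrP y 2^-1.
  apply: (@squeeze_cvgr _ _ _ _ (fun m => 1 - m%:R * (2 * y) ^+ m) (fun=> 1)).
  - apply: nearW => m; have /andP[_ ->] := soft_step_itv m y01; rewrite andbT.
    rewrite (le_trans _ (bernoulli_ineq _ _)) ?exprn_ge0 ?exprn_ile1//.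
    by rewrite natrM exprMn natrX mulrA.
  - rewrite -[X in _ --> X]subr0; apply: cvgB; first exact: cvg_cst.
    apply: cvg_natr_exp; lra.
  - exact: cvg_cst.
apply: (@squeeze_cvgr _ _ _ _ (fun=> 0) (@harmonic R)).
- apply: nearW => m; have /andP[-> _] /= := soft_step_itv m y01.
  have h1 : 0 <= 1 - y ^+ m <= expR (- (2 ^- m)).
    rewrite subr_ge0 exprn_ile1//= (le_trans _ (expR_ge1Dx _))//.
    by rewrite lerD2l lerN2 -exprVn lerXn2r// nnegrE.
  have /andP[h10 h11] := h1.
  rewrite /soft_step (le_trans (lerXn2r _ _ _ h11)) ?nnegrE ?expR_ge0//.
  rewrite -expRM_natl mulrN natrM -mulrA natrX mulfV ?expf_neq0// mulr1.
  rewrite expRN /harmonic lef_pV2 ?posrE ?expR_gt0//.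
  by rewrite (le_trans _ (expR_ge1Dx _))// -natr1 addrC.
- exact: cvg_cst.
- exact: cvg_harmonic.
Qed.

End threshold.

Section bounded_limits.
Context d (T : measurableType d) (R : realType) (P : probability T R).

(** Dominated convergence applied twice. *)
Lemma bounded_limit_integral_eq (g g' : nat -> T -> R) (f f' : T -> R) :
  (forall n, measurable_fun setT (g n)) -> (forall n, measurable_fun setT (g' n)) ->
  (forall n w, `|g n w| <= 1) -> (forall n w, `|g' n w| <= 1) ->
  (forall w, g n w @[n --> \oo] --> f w) -> (forall w, g' n w @[n --> \oo] --> f' w) ->
  (forall n, \int[P]_w (g n w)%:E = \int[P]_w (g' n w)%:E)%E ->
  (\int[P]_w (f w)%:E = \int[P]_w (f' w)%:E)%E.
Proof.
have L (h : nat -> T -> R) k : (forall n, measurable_fun setT (h n)) ->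
    (forall n w, `|h n w| <= 1) -> (forall w, h n w @[n --> \oo] --> k w) ->
    (\int[P]_w (h n w)%:E @[n --> \oo] --> \int[P]_w (k w)%:E)%E.
  move=> mh h1 hk.
  have mk : measurable_fun setT k.
    by apply: measurable_fun_cvg => [n|w _]; [exact: mh|exact: hk].
  have [] := @dominated_convergence _ _ _ P setT measurableT
    (fun n w => (h n w)%:E) (fun w => (k w)%:E) (fun=> 1%E) => //.
  - by move=> n; exact/measurable_EFinP.
  - exact/measurable_EFinP.
  - by apply: aeW => w _; apply: cvg_EFin; [exact: nearW|exact: hk].
  - by apply: finite_measure_integrable_cst.
  - by apply: aeW => w n _; rewrite /= lee_fin.
move=> mg mg' g1 g'1 gf gf' E.
have := L _ _ mg g1 gf; have := L _ _ mg' g'1 gf'.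
under eq_cvg do rewrite -E.
by move=> l1 l2; rewrite -(cvg_lim _ l1)// -(cvg_lim _ l2).
Qed.

End bounded_limits.

(** * Joint laws from the laws of linear combinations *)

Section cramer_wold.
Context d (T : measurableType d) (R : realType) (P : probability T R).

Lemma measurable_ltc (X : T -> R) c : measurable_fun setT X ->
  measurable [set w | X w < c].
Proof.
move=> mX; have -> : [set w | X w < c] = X @^-1` `]-oo, c[%classic.
  by apply/seteqP; split => w /=; rewrite in_itv.
by rewrite -[X in measurable X]setTI; exact: mX.
Qed.

Lemma prod_indicator n (b : 'I_n -> bool) :
  \prod_(i < n) ((b i)%:R : R) = ([forall i, b i])%:R.
Proof.
have [/forallP h|/forallPn[i /negbTE h]] := boolP [forall i, b i].
  by rewrite big1// => i _; rewrite h.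
by rewrite (bigD1 i)//= h mul0r.
Qed.

(** For N large the argument falls in ]- pi, pi[, where the sine has the sign of
    its argument; this makes a bounded periodic function detect a threshold. *)
Lemma cvg_sin_sign (x : R) :
  ((sin (N.+1%:R^-1 * x) < 0)%R%:R : R) @[N --> \oo] --> ((x < 0)%R%:R : R).
Proof.
apply: (@cvg_trans _ ((fun=> ((x < 0)%R%:R : R)) @ \oo)); last exact: cvg_cst.
apply: near_eq_cvg; near=> N.
have Npos : (0 : R) < N.+1%:R^-1 by rewrite invr_gt0.
have xN : `|N.+1%:R^-1 * x| < pi.
  rewrite normrM (gtr0_norm Npos) mulrC ltr_pdivrMr//.
  have : `|x| < N.+1%:R.
    near: N; exists (Num.truncn `|x|) => // k /= hk.
    by rewrite (lt_le_trans (truncnS_gt _))// ler_nat ltnS.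
  move=> /lt_le_trans; apply; rewrite ler_peMl//.
  have := pihalf_ge1 R; lra.
congr (_ %:R); congr nat_of_bool; have [x0|x0|->] := ltrgtP x 0.
- apply/esym; rewrite -[X in sin X]opprK sinN oppr_lt0 sin_gt0_pi//.
  by rewrite oppr_gt0 pmulr_rlt0// x0/= (le_lt_trans _ xN)// -normrN ler_norm.
- apply/esym/negbTE; rewrite -leNgt ltW// sin_gt0_pi// mulr_gt0//=.
  exact: (le_lt_trans (ler_norm _) xN).
- by rewrite mulr0 sin0 ltxx.
Unshelve. all: by end_near. Qed.

(** A Cramer-Wold theorem, obtained without characteristic functions: the
    indicator of an orthant is an iterated pointwise limit of bounded
    trigonometric polynomials, whose expectations agree. *)
Lemma cramer_wold_lt n (X Y : 'I_n -> T -> R) :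
  (forall i, measurable_fun setT (X i)) ->
  (forall i, measurable_fun setT (Y i)) ->
  (forall a, eq_law P (fun w => \sum_i a i * X i w) (fun w => \sum_i a i * Y i w)) ->
  forall c : 'I_n -> R,
  P [set w | forall i, X i w < c i] = P [set w | forall i, Y i w < c i].
Proof.
move=> mX mY XY c.
pose s N i (x : 'I_n -> R) := sin (N.+1%:R^-1 * (x i - c i)).
(* the sine is rescaled into [1/4, 3/4], so that the sign of x i - c i becomes
   the position with respect to 1/2 *)
pose y N i x := 2^-1 + s N i x / 4.
have y01 N i x : 0 <= y N i x <= 1.
  by have := sin_geN1 (N.+1%:R^-1 * (x i - c i));
     have := sin_le1 (N.+1%:R^-1 * (x i - c i)); rewrite /y /s; lra.
pose g N m x := \prod_i soft_step m (y N i x).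
pose g' N x := \prod_i ((s N i x < 0)%R%:R : R).
pose g'' x := \prod_i ((x i < c i)%R%:R : R).
have tg N m : trig_poly (g N m).
  apply: trig_prod => i; apply: trig_exp.
  apply: (trig_ext (trig_add (trig_cst _ 1) (trig_mul (trig_cst _ (-1)) (trig_exp m
    (trig_add (trig_cst _ 2^-1) (trig_mul (trig_cst _ 4^-1)
    (trig_sin N.+1%:R^-1 i (- (N.+1%:R^-1 * c i))))))))) => x /=.
  by rewrite mulN1r /y /s mulrBr (mulrC 4^-1).
have mg N m (Z : 'I_n -> T -> R) : (forall i, measurable_fun setT (Z i)) ->
    measurable_fun setT (fun w => g N m (Z^~ w)).
  move=> mZ; apply: measurable_prod => i _.
  rewrite /soft_step; apply: measurable_funX; apply: measurable_funB => //.
  apply: measurable_funX; apply: measurable_funD => //.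
  apply: measurable_funM => //.
  apply: (measurableT_comp (f := fun z : R => sin (N.+1%:R^-1 * (z - c i)))) => //.
  apply: continuous_measurable_fun => z.
  apply: (cvg_comp _ sin); last exact: continuous_sin.
  by apply: cvgM; [exact: cvg_cst|apply: cvgB; [exact: cvg_id|exact: cvg_cst]].
have gg' N x : g N m x @[m --> \oo] --> g' N x.
  apply: cvg_big => [|i _]; first exact: mul_continuous.
  suff -> : (s N i x < 0) = (y N i x < 2^-1) by exact: cvg_soft_step.
  by rewrite /y; apply/idP/idP; lra.
have g'g'' x : g' N x @[N --> \oo] --> g'' x.
  apply: cvg_big => [|i _]; first exact: mul_continuous.
  by rewrite -subr_lt0; exact: cvg_sin_sign.
have b01 (h : 'I_n -> R) : (forall i, 0 <= h i <= 1) -> `|\prod_i h i| <= 1.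
  move=> h01; rewrite normr_prod; apply: prodr_ile1 => i _.
  by have /andP[h0 h1] := h01 i; rewrite normr_ge0 ger0_norm.
have bg N m x : `|g N m x| <= 1.
  by apply: b01 => i; exact: soft_step_itv.
have bg' N x : `|g' N x| <= 1.
  by apply: b01 => i; case: ltrP; rewrite ?lexx ?ler01.
have mg' N (Z : 'I_n -> T -> R) : (forall i, measurable_fun setT (Z i)) ->
    measurable_fun setT (fun w => g' N (Z^~ w)).
  move=> mZ; apply: (@measurable_fun_cvg _ _ _ _ (fun m w => g N m (Z^~ w))).
    by move=> m; exact: mg.
  by move=> w _; exact: gg'.
have E N : (\int[P]_w (g' N (X^~ w))%:E = \int[P]_w (g' N (Y^~ w))%:E)%E.
  apply: (@bounded_limit_integral_eq _ _ _ P (fun m w => g N m (X^~ w)) (fun m w => g N m (Y^~ w))).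
  all: try by move=> *; auto.
  by move=> m; exact: expectation_trig_poly (tg N m).
have : (\int[P]_w (g'' (X^~ w))%:E = \int[P]_w (g'' (Y^~ w))%:E)%E.
  apply: (@bounded_limit_integral_eq _ _ _ P (fun N w => g' N (X^~ w)) (fun N w => g' N (Y^~ w)));
  by move=> *; auto.
have I (Z : 'I_n -> T -> R) : (forall i, measurable_fun setT (Z i)) ->
    (\int[P]_w (g'' (Z^~ w))%:E = P [set w | forall i, (Z i w < c i)%R])%E.
  move=> mZ; have mA : measurable [set w | forall i, Z i w < c i].
    have -> : [set w | forall i, Z i w < c i] =
        \bigcap_(i in [set: 'I_n]) [set w | Z i w < c i].
      by apply/seteqP; split => w /= h i => [_|]; exact: h.
    apply: fin_bigcap_measurable => [|i _]; first exact: finite_finset.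
    exact: measurable_ltc.
  rewrite -[X in _ = P X]setIT -integral_indic//; apply: eq_integral => w _.
  rewrite /g'' prod_indicator indicE; congr (_ %:R%:E); congr nat_of_bool.
  by apply/forallP/idP => [h|]; rewrite ?inE.
by rewrite !I.
Qed.

(** The closed infinite orthant is the decreasing intersection of the open
    orthants that constrain the first k coordinates by c i + 1 / (k + 1). *)
Lemma cramer_wold_le (X Y : nat -> T -> R) :
  (forall i, measurable_fun setT (X i)) ->
  (forall i, measurable_fun setT (Y i)) ->
  (forall n (a : 'I_n -> R),
    eq_law P (fun w => \sum_i a i * X i w) (fun w => \sum_i a i * Y i w)) ->
  forall c : nat -> R,
  P [set w | forall i, X i w <= c i] = P [set w | forall i, Y i w <= c i].
Proof.
move=> mX mY XY c.
pose F (Z : nat -> T -> R) k := [set w | forall i : 'I_k, Z i w < c i + k.+1%:R^-1].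
have FE Z : [set w | forall i, Z i w <= c i] = \bigcap_k F Z k.
  apply/seteqP; split => w /= h.
    by move=> k _ i; rewrite (le_lt_trans (h _))// ltrDl invr_gt0.
  move=> i; apply/ler_addgt0Pr => e e0.
  have [k ik] : exists2 k, (i < k)%N & k.+1%:R^-1 < e.
    exists (maxn i.+1 (Num.truncn e^-1)); first by rewrite leq_max ltnSn.
    rewrite invf_plt ?posrE// (lt_le_trans (truncnS_gt _))//.
    by rewrite ler_nat ltnS leq_max leqnn orbT.
  by move=> ke; have := h k I (Ordinal ik); rewrite /= => /ltW/le_trans; apply; rewrite lerD2l ltW.
have mF Z : (forall i, measurable_fun setT (Z i)) -> forall k, measurable (F Z k).
  move=> mZ k; have -> : F Z k =
      \bigcap_(i in [set: 'I_k]) [set w | Z i w < c i + k.+1%:R^-1].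
    by apply/seteqP; split => w /= h i => [_|]; exact: h.
  apply: fin_bigcap_measurable => [|i _]; first exact: finite_finset.
  exact: measurable_ltc.
have L Z : (forall i, measurable_fun setT (Z i)) ->
    P (F Z k) @[k --> \oo] --> P [set w | forall i, Z i w <= c i].
  move=> mZ; rewrite FE; apply: nonincreasing_cvg_mu.
  - by rewrite ltey_eq fin_num_measure//; exact: mF.
  - exact: mF.
  - by apply: bigcapT_measurable => k; exact: mF.
  - move=> j k jk; apply/subsetPset => w h i.
    have := h (widen_ord jk i); rewrite /= => /lt_le_trans; apply.
    by rewrite lerD2l lef_pV2 ?posrE// ler_nat ltnS.
have := L _ mX; have := L _ mY.
have -> : (fun k => P (F X k)) = (fun k => P (F Y k)).
  apply/funext => k.
  exact: (@cramer_wold_lt k (fun i => X i) (fun i => Y i) _ _ _ (fun i => c i + k.+1%:R^-1)).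
by move=> l1 l2; rewrite -(cvg_lim _ l1)// -(cvg_lim _ l2).
Qed.

End cramer_wold.

(** * Laws of countable suprema *)

Section supremum_law.
Context d (T : measurableType d) (R : realType) (P : probability T R).
Implicit Types X Y : nat -> T -> R.

Definition sup_seq X (w : T) : R := sup (range (X^~ w)).

Definition bounded_above X : set T := [set w | has_ubound (range (X^~ w))].

(** Unbounded sequences are covered: there both sides take the default value 0. *)
Lemma sup_seqE X w : sup_seq X w = fine (esups (fun i => (X i w)%:E) 0).
Proof.
rewrite /esups /sdrop /=.
have -> : [set (X k w)%:E | k in [set k | (0 <= k)%N]] = EFin @` range (X^~ w).
  apply/seteqP; split => y /=.
    by move=> [k _ <-]; exists (X k w) => //; exists k.
  by move=> [_ [k _ <-] <-]; exists k.
have ne : range (X^~ w) !=set0 by exists (X 0%N w); exists 0%N.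
have [ub|nub] := pselect (has_ubound (range (X^~ w))).
  by rewrite ereal_sup_EFin.
by rewrite hasNub_ereal_sup//= /sup_seq sup_out// => -[].
Qed.

Lemma measurable_sup_seq X : (forall i, measurable_fun setT (X i)) ->
  measurable_fun setT (sup_seq X).
Proof.
move=> mX; rewrite (_ : sup_seq X = fun w => fine (esups (fun i => (X i w)%:E) 0)).
  have mE : measurable_fun setT (fun w => esups (fun i => (X i w)%:E) 0).
    by apply: (@measurable_fun_esups _ _ _ _ (fun i w => (X i w)%:E)) => i; exact/measurable_EFinP.
  exact: (measurableT_comp (fine_measurable measurableT) mE).
by apply/funext => w; exact: sup_seqE.
Qed.

Lemma measurable_all_le X (c : R) : (forall i, measurable_fun setT (X i)) ->
  measurable [set w | forall i, X i w <= c].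
Proof.
move=> mX; have -> : [set w | forall i, X i w <= c] =
    \bigcap_i (X i @^-1` `]-oo, c]%classic).
  apply/seteqP; split => w /= h i => [_|].
    by rewrite /= in_itv/= h.
  by have := h i I; rewrite /= in_itv.
by apply: bigcapT_measurable => i; rewrite -[X in measurable X]setTI; exact: mX.
Qed.

Lemma bounded_aboveE X :
  bounded_above X = \bigcup_k [set w | forall i, X i w <= k%:R].
Proof.
apply/seteqP; split => w /=.
  move=> [M ubM]; exists (Num.truncn `|M|).+1; first by [].
  move=> i /=; have XM : X i w <= M by apply: ubM; exists i.
  by rewrite (le_trans XM)// (le_trans (ler_norm _))// ltW// truncnS_gt.
by move=> [k _ h]; exists k%:R => _ [i _ <-]; exact: h.
Qed.

Lemma measurable_bounded_above X : (forall i, measurable_fun setT (X i)) ->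
  measurable (bounded_above X).
Proof.
move=> mX; rewrite bounded_aboveE; apply: bigcupT_measurable => k.
exact: measurable_all_le.
Qed.

(** The event that the supremum is at most c is the intersection over all
    indices of the events X i <= c, up to the null event of an unbounded
    sequence, on which the supremum takes a default value. Boundedness itself
    transfers from Y to X, being a limit of such events. *)
Lemma eq_law_sup_seq X Y :
  (forall i, measurable_fun setT (X i)) -> (forall i, measurable_fun setT (Y i)) ->
  (forall c, P [set w | forall i, X i w <= c] = P [set w | forall i, Y i w <= c]) ->
  {ae P, forall w, bounded_above Y w} ->
  {ae P, forall w, bounded_above X w} /\ eq_law P (sup_seq X) (sup_seq Y).
Proof.
move=> mX mY XY bY.
have L (Z : nat -> T -> R) : (forall i, measurable_fun setT (Z i)) ->
    P [set w | forall i, Z i w <= k%:R] @[k --> \oo] --> P (bounded_above Z).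
  move=> mZ; rewrite bounded_aboveE; apply: nondecreasing_cvg_mu.
  - by move=> k; exact: measurable_all_le.
  - by rewrite -bounded_aboveE; exact: measurable_bounded_above.
  - move=> j k jk; apply/subsetPset => w h i.
    by rewrite (le_trans (h i))// ler_nat.
have PXY : P (bounded_above X) = P (bounded_above Y).
  have := L _ mX; have := L _ mY.
  have -> : (fun k : nat => P [set w | forall i, X i w <= k%:R]) =
            (fun k : nat => P [set w | forall i, Y i w <= k%:R]).
    by apply/funext => k; exact: XY.
  by move=> l1 l2; rewrite -(cvg_lim _ l1)// -(cvg_lim _ l2).
have PY : P (~` bounded_above Y) = 0.
  have [N [mN N0 sN]] := bY; apply/eqP; rewrite -measure_le0 -N0.
  apply: le_measure; rewrite ?inE//; apply: measurableC; exact: measurable_bounded_above.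
have PX : P (~` bounded_above X) = 0.
  rewrite -PY !probability_setC//; [|exact: measurable_bounded_above..].
  by rewrite PXY.
split.
  by exists (~` bounded_above X); split => //; apply: measurableC; exact: measurable_bounded_above.
have K (Z : nat -> T -> R) (c : R) : (forall i, measurable_fun setT (Z i)) -> P (~` bounded_above Z) = 0 ->
    P [set w | sup_seq Z w <= c] = P [set w | forall i, Z i w <= c].
  move=> mZ PZ; have mB := measurable_bounded_above mZ.
  have mS : measurable [set w | sup_seq Z w <= c].
    have -> : [set w | sup_seq Z w <= c] = sup_seq Z @^-1` `]-oo, c]%classic.
      by apply/seteqP; split => w /=; rewrite in_itv.
    by rewrite -[X in measurable X]setTI; exact: measurable_sup_seq.
  rewrite (measureDI P mS mB) -[RHS]add0e; congr (_ + _)%E.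
    apply/eqP; rewrite -measure_le0 -PZ; apply: le_measure; rewrite ?inE//.
    - exact: measurableD.
    - exact: measurableC.
  congr (P _); apply/seteqP; split => w /=.
    move=> [h ub] i; rewrite (le_trans _ h)//.
    by apply: ub_le_sup => //; exists i.
  move=> h; split; last by exists c => _ [i _ <-].
  apply: ge_sup; first by exists (Z 0%N w); exists 0%N.
  by move=> _ [i _ <-].
apply: eq_law_le; [exact: measurable_sup_seq..|] => c.
by rewrite !K.
Qed.

End supremum_law.

(** * Centered Gaussian variables *)

Section normal_law.
Variable R : realType.
Local Notation mu := (@lebesgue_measure R).
Local Notation N01 := (@normal_prob R 0 1).

(** The density is the Radon-Nikodym derivative, up to almost everywhere
    equality. *)
Lemma integral_normal_prob (m s : R) (f : R -> \bar R) :
  measurable_fun [set: R] f -> (forall x, 0 <= f x)%E ->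
  (\int[normal_prob m s]_x f x = \int[mu]_x (f x * (normal_pdf m s x)%:E))%E.
Proof.
move=> mf f0; have dom := @normal_prob_dominates R m s.
rewrite -(Radon_Nikodym_SigmaFinite.change_of_variables dom)//.
apply: ae_eq_integral => //.
- apply: emeasurable_funM => //.
  exact: measurable_int (Radon_Nikodym_SigmaFinite.f_integrable dom).
- apply: emeasurable_funM => //.
  by apply/measurable_EFinP; apply: measurable_normal_pdf.
- rewrite -[X in ae_eq _ _ _ X]/(f \* (EFin \o normal_pdf m s))%E.
  apply: ae_eqe_mul2l; apply: integral_ae_eq => //.
  + exact: Radon_Nikodym_SigmaFinite.f_integrable.
  + by apply/measurable_EFinP; apply: measurable_normal_pdf.
  + by move=> E _ mE; rewrite -Radon_Nikodym_SigmaFinite.f_integral.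
Qed.

(** Substitution x = m + s y in the integral against the density. *)
Lemma integral_normal_prob_affine (m s : R) (g : R -> R) : 0 < s ->
  continuous g -> (forall x, 0 <= g x) ->
  (\int[normal_prob m s]_x (g x)%:E = \int[N01]_y (g (m + s * y))%:E)%E.
Proof.
move=> s0 cg g0.
have mg : measurable_fun [set: R] g by exact: continuous_measurable_fun.
pose F (y : R) : R := m + s * y.
have cF : continuous F.
  by move=> x; apply: cvgD; [exact: cvg_cst|apply: cvgM; [exact: cvg_cst|exact: cvg_id]].
have mgF : measurable_fun [set: R] (fun y => g (m + s * y)).
  apply: continuous_measurable_fun => x; apply: continuous_comp; [exact: cF|exact: cg].
rewrite (@integral_normal_prob m s (fun x => (g x)%:E)); last first.
  by move=> x; rewrite lee_fin.
  exact/measurable_EFinP.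
rewrite (@integral_normal_prob 0 1 (fun y => (g (m + s * y))%:E)); last first.
  by move=> x; rewrite lee_fin.
  exact/measurable_EFinP.
under eq_integral do rewrite -EFinM.
have F'E : F^`()%classic = cst s.
  apply/funext => x; rewrite /F derive1E deriveD// derive_cst add0r deriveM//.
  by rewrite derive_cst derive_id scaler0 addr0 scaler1.
rewrite (@increasing_ge0_integration_by_substitutionT R F (fun x => g x * normal_pdf m s x)).
- apply: eq_integral => y _; rewrite F'E /= -EFinM; congr EFin.
  rewrite -mulrA; congr (_ * _).
  rewrite !normal_pdfE ?gt_eqF ?oner_eq0// /normal_peak /normal_fun /F.
  rewrite fctE subr0 (addrC m) addrK exprMn expr1n mulrAC; congr (_ * _).
    rewrite -!mulrnAr sqrtrM ?sqr_ge0// sqrtr_sqr gtr0_norm// mul1r.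
    by rewrite invfM mulrAC mulVf ?mul1r ?gt_eqF.
  congr expR; rewrite !mulNr; congr (- _).
  by field; rewrite gt_eqF.
- by move=> x y xy; rewrite ltrD2l ltr_pM2l.
- by rewrite F'E => x; exact: cvg_cst.
- by rewrite F'E; exact: is_cvg_cst.
- by rewrite F'E; exact: is_cvg_cst.
- by move=> x; exact: derivableD.
- apply: (cvg_comp (fun y => s * y) (fun y => m + y)); last exact: cvg_addrl_Ny.
  by apply: gt0_cvgMrNy => //; exact: cvg_id.
- apply: (cvg_comp (fun y => s * y) (fun y => m + y)); last exact: cvg_addrl.
  by apply: gt0_cvgMry => //; exact: cvg_id.
- move=> x; apply: cvgM; first exact: cg.
  by apply: continuous_normal_pdf; rewrite gt_eqF.
- by move=> x; rewrite mulr_ge0// normal_pdf_ge0.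
Qed.
End normal_law.

Section standard_normal.
Variable R : realType.
Local Notation mu := (@lebesgue_measure R).
Local Notation N01 := (@normal_prob R 0 1).

Lemma normal_prob_opp (g : R -> \bar R) : measurable_fun [set: R] g ->
  (forall x, 0 <= g x)%E ->
  (\int[N01]_y g (- y)%R = \int[N01]_y g y)%E.
Proof.
move=> mg g0.
have mgN : measurable_fun [set: R] (fun y => g (- y)).
  by apply: measurableT_comp => //; exact: oppr_measurable.
rewrite (integral_normal_prob 0 1 mg g0).
rewrite (@integral_normal_prob _ 0 1 (fun y => g (- y)) mgN)//.
have mh : measurable_fun [set: R] (fun y => g y * (normal_pdf 0 1 y)%:E)%E.
  by apply: emeasurable_funM => //; apply/measurable_EFinP; apply: measurable_normal_pdf.
have h0 y : (0 <= g y * (normal_pdf 0 1 y)%:E)%E.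
  by rewrite mule_ge0// lee_fin normal_pdf_ge0.
transitivity (\int[pushforward mu (-%R : _ -> measurableTypeR R)]_y (g y * (normal_pdf 0 1 y)%:E))%E.
  have h0' : {in [set: R], forall y, 0 <= g y * (normal_pdf 0 1 y)%:E}%E by move=> y _.
  rewrite (@ge0_integral_pushforward _ _ (measurableTypeR R) (measurableTypeR R) R
    -%R (oppr_measurable (D := [set: R])) mu setT _ measurableT mh h0').
  apply: eq_integral => y _ /=.
  by rewrite !normal_pdfE ?oner_eq0// /normal_fun !subr0 sqrrN.
by apply: eq_measure_integral => A mA _; exact: lebesgue_measureN.
Qed.

Lemma normal_prob_itv_gt0 m s (c : R) : s != 0 ->
  (0 < normal_prob m s `[c, (c + 1)%R])%E.
Proof.
move=> s0; rewrite /normal_prob.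
pose M := `|c - m| + 1.
pose e := normal_peak s * expR (- M ^+ 2 / (s ^+ 2 *+ 2)).
have e0 : 0 < e by rewrite mulr_gt0 ?normal_peak_gt0 ?expR_gt0.
apply: (@lt_le_trans _ _ (\int[mu]_(x in `[c, (c + 1)%R]) e%:E)%E).
  rewrite integral_cst//= lebesgue_measure_itv/= lte_fin ltrDl ltr01.
  by rewrite -EFinD addrAC subrr add0r mule1 lte_fin.
apply: ge0_le_integral => //.
- by move=> x _; rewrite lee_fin ltW.
- by apply/measurable_EFinP; apply: measurable_funTS; apply: measurable_normal_pdf.
- move=> x; rewrite /= in_itv/= => /andP[cx xc].
  rewrite lee_fin normal_pdfE// ler_wpM2l ?normal_peak_ge0// ler_expR !mulNr lerN2.
  rewrite ler_wpM2r// ?invr_ge0 ?mulrn_wge0 ?sqr_ge0//.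
  rewrite -(real_normK (num_real (x - m))) lerXn2r ?nnegrE ?addr_ge0//.
  rewrite /M (_ : x - m = (c - m) + (x - c)); last by ring.
  by rewrite (le_trans (ler_normD _ _))// lerD2l ler_norml; lra.
Qed.

(** The exponential series dominates each of its terms. *)
Lemma exprn_even_le_expR k (x : R) :
  (x ^+ 2) ^+ k <= (k`!%:R * 4 ^+ k) * expR (x ^+ 2 / 4).
Proof.
have y0 : 0 <= x ^+ 2 / 4 by rewrite divr_ge0// sqr_ge0.
have h : (x ^+ 2 / 4) ^+ k <= k`!%:R * expR (x ^+ 2 / 4).
  case: k => [|k]; first by rewrite expr0 fact0 mul1r -[leLHS]expR0 ler_expR.
  rewrite -ler_pdivrMl ?ltr0n ?fact_gt0// mulrC.
  by rewrite (le_trans _ (expR_ge1Dxn k y0))// lerDr.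
have xz : x ^+ 2 = 4 * (x ^+ 2 / 4) by rewrite mulrCA mulfV// mulr1.
rewrite [in leLHS]xz; move: (x ^+ 2 / 4) h => z h.
by rewrite exprMn (mulrC k`!%:R) -mulrA ler_wpM2l ?exprn_ge0.
Qed.

Definition even_moment k : \bar R := (\int[N01]_y ((y ^+ 2) ^+ k)%:E)%E.

(** A power is dominated by exp (y ^ 2 / 4), which turns the standard normal
    density into a multiple of the normal density of variance 2. *)
Lemma even_moment_fin k : even_moment k \is a fin_num.
Proof.
have m2k : measurable_fun [set: R] (fun y : R => (y ^+ 2) ^+ k).
  by apply: measurable_funX; apply: measurable_funX.
rewrite ge0_fin_numE; last by apply: integral_ge0 => y _; rewrite lee_fin exprn_ge0 ?sqr_ge0.
rewrite /even_moment integral_normal_prob; last first.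
  by move=> y; rewrite lee_fin exprn_ge0 ?sqr_ge0.
  exact/measurable_EFinP.
pose s : R := Num.sqrt 2.
have s0 : 0 < s by rewrite sqrtr_gt0.
pose c := (k`!%:R * 4 ^+ k) * (normal_peak 1 / normal_peak s) : R.
have c0 : 0 <= c by rewrite !mulr_ge0 ?exprn_ge0 ?invr_ge0 ?normal_peak_ge0.
apply: (@le_lt_trans _ _ (\int[mu]_y (c%:E * (normal_pdf 0 s y)%:E))%E).
  apply: ge0_le_integral => //.
  - by move=> y _; rewrite mule_ge0// lee_fin ?normal_pdf_ge0// exprn_ge0 ?sqr_ge0.
  - apply: emeasurable_funM; first exact/measurable_EFinP.
    by apply/measurable_EFinP; apply: measurable_normal_pdf.
  - apply: emeasurable_funM => //.
    by apply/measurable_EFinP; apply: measurable_normal_pdf.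
  - move=> y _; rewrite -!EFinM lee_fin.
    rewrite (le_trans (ler_wpM2r (normal_pdf_ge0 _ _ _) (exprn_even_le_expR k y)))//.
    rewrite /c -!mulrA; do 2 (apply: ler_wpM2l; rewrite ?exprn_ge0//).
    rewrite !normal_pdfE ?oner_eq0 ?gt_eqF//.
    rewrite (mulrA (normal_peak s)^-1) mulVf ?gt_eqF ?normal_peak_gt0 ?gt_eqF// mul1r.
    rewrite mulrCA ler_wpM2l ?normal_peak_ge0// /normal_fun !subr0 -expRD ler_expR.
    by rewrite /s sqr_sqrtr// expr1n; lra.
rewrite ge0_integralZl//=.
- by rewrite integral_normal_pdf mule1 ltry.
- by apply/measurable_EFinP; apply: measurable_normal_pdf.
- by move=> y _; rewrite lee_fin normal_pdf_ge0.
Qed.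

Lemma even_moment1_gt0 : (0 < even_moment 1)%E.
Proof.
have := normal_prob_itv_gt0 0 1 (oner_neq0 R) => /lt_le_trans; apply.
have mI : measurable_fun `[1 : R, 1 + 1]%classic (fun y : R => ((y ^+ 2) ^+ 1)%:E).
  by apply/measurable_EFinP; apply: measurable_funTS; apply: measurable_funX; apply: measurable_funX.
have -> : N01 `[1%R : R, (1 + 1)%R] = (\int[N01]_(y in `[1%R, (1 + 1)%R]) 1%:E)%E.
  by rewrite integral_cst// mul1e.
rewrite (@le_trans _ _ (\int[N01]_(y in `[1%R, (1 + 1)%R]) ((y ^+ 2) ^+ 1)%:E)%E)//.
  apply: ge0_le_integral => //.
  - move=> y; rewrite /= in_itv/= => /andP[y1 _].
    by rewrite lee_fin expr1 -(expr1n _ 2) lerXn2r ?nnegrE// (le_trans _ y1).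
apply: ge0_subset_integral => //.
- by apply/measurable_EFinP; apply: measurable_funX; apply: measurable_funX.
- by move=> y _; rewrite lee_fin exprn_ge0 ?sqr_ge0.
Qed.

End standard_normal.

Section gaussian_variables.
Context d (T : measurableType d) (R : realType) (P : probability T R).
Local Notation N01 := (@normal_prob R 0 1).
Implicit Types X Y : T -> R.

Lemma normal_prob_norm (m s : R) : normal_prob m s = normal_prob m `|s|.
Proof.
apply/funext => A; apply: eq_integral => x _; congr EFin.
by rewrite /normal_pdf /normal_peak /normal_fun normr_eq0 !real_normK ?num_real.
Qed.

(** Replacing s by its absolute value makes the representation m + s N, with N
    standard normal, cover the Dirac case s = 0 as well. *)
Lemma gaussian_repr X : measurable_fun setT X -> gaussian P X ->
  exists m s : R, [/\ 0 <= s,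
    forall A, measurable A ->
      P (X @^-1` A) = if s == 0 then \d_m A else normal_prob m s A &
    forall g : R -> R, continuous g -> (forall x, 0 <= g x) ->
      (\int[P]_w (g (X w))%:E = \int[N01]_y (g (m + s * y)%R)%:E)%E].
Proof.
move=> mX [m [s PX]]; exists m, `|s|.
have PXn A : measurable A ->
    P (X @^-1` A) = if `|s| == 0 then \d_m A else normal_prob m `|s| A.
  move=> mA; rewrite (PX A mA) normr_eq0; case: eqP => _; first reflexivity.
  exact: (congr1 (@^~ A) (normal_prob_norm m s)).
split => // g cg g0.
pose X' : {RV P >-> measurableTypeR R} :=
  HB.pack X (isMeasurableFun.Build _ _ _ (measurableTypeR R) _ mX).
have mg : measurable_fun [set: measurableTypeR R] (EFin \o g).
  by apply/measurable_EFinP; exact: continuous_measurable_fun.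
have gE0 x : (0 <= (EFin \o g) x)%E by rewrite lee_fin.
rewrite -[LHS]/(\int[P]_w ((EFin \o g) \o X') w)%E -(ge0_integral_distribution X' mg gE0).
have [s0|s0] := eqVneq `|s| 0.
  transitivity (\int[\d_(m : measurableTypeR R)]_x (g x)%:E)%E.
    apply: eq_measure_integral => A mA _.
    by rewrite -[LHS]/(P (X @^-1` A)) (PXn A mA) s0 eqxx.
  rewrite integral_dirac// diracT mul1e.
  under eq_integral do rewrite s0 mul0r addr0.
  by rewrite integral_cst//= probability_setT mule1.
transitivity (\int[normal_prob m `|s|]_x (g x)%:E)%E.
  apply: eq_measure_integral => A mA _.
  by rewrite -[LHS]/(P (X @^-1` A)) (PXn A mA) (negbTE s0).
by apply: integral_normal_prob_affine => //; rewrite lt_def s0/=.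
Qed.

(** The second moment of the standard normal law, kept symbolic: the scale of a
    centered Gaussian variable is read off by dividing its variance by it. *)
Definition variance_unit : R := fine (@even_moment R 1).

Lemma variance_unit_gt0 : 0 < variance_unit.
Proof. by rewrite fine_gt0// even_moment1_gt0 ltey_eq even_moment_fin. Qed.

Definition centered_gaussian X (v : R) :=
  [/\ measurable_fun setT X, gaussian P X, (\int[P]_w (X w)%:E = 0)%E &
      (\int[P]_w (X w ^+ 2)%:E = v%:E)%E].

(** The parameters m and s of the law are recovered from the first two moments.
    The positive and negative parts of X - m have the same mean by symmetry of
    the normal law, hence m = 0, and then v = s ^ 2 * variance_unit. *)
Lemma centered_gaussian_repr X v : centered_gaussian X v ->
  [/\ 0 <= v,
    forall A, measurable A -> P (X @^-1` A) =
      if Num.sqrt (v / variance_unit) == 0 then \d_(0 : R) A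
      else normal_prob 0 (Num.sqrt (v / variance_unit)) A &
    forall g : R -> R, continuous g -> (forall x, 0 <= g x) ->
      (\int[P]_w (g (X w))%:E =
       \int[N01]_y (g (Num.sqrt (v / variance_unit) * y)%R)%:E)%E].
Proof.
move=> [mX gX EX EX2]; have [m [s [s0 law Eg]]] := gaussian_repr mX gX.
have c1 : continuous (fun x : R => x ^+ 2) by exact: exprn_continuous.
pose posp (x : R) := Num.max x 0.
have cpos : continuous posp.
  move=> x; apply: continuous_max; [exact: cvg_id|exact: cvg_cst].
have cm : continuous (fun x : R => x - m).
  by move=> x; apply: cvgB; [exact: cvg_id|exact: cvg_cst].
have cmN : continuous (fun x : R => - (x - m)).
  by move=> x; apply: cvgN; exact: cm.
have pos0 x : 0 <= posp x by rewrite le_max lexx orbT.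
have Ep := Eg (posp \o (fun x => x - m)) (fun x => continuous_comp (cm x) (cpos _)) (fun=> pos0 _).
have En := Eg (posp \o (fun x => - (x - m))) (fun x => continuous_comp (cmN x) (cpos _)) (fun=> pos0 _).
pose A := (\int[N01]_y (posp (s * y))%:E)%E.
have mposp : measurable_fun [set: R] (fun y => posp (s * y)).
  apply: measurable_maxr => //; exact: measurable_funM.
have EpA : (\int[P]_w (posp (X w - m))%:E = A)%E.
  by rewrite Ep; apply: eq_integral => y _ /=; rewrite addrAC subrr add0r.
have EnA : (\int[P]_w (posp (- (X w - m)))%:E = A)%E.
  rewrite En /A -(@normal_prob_opp _ (fun y => (posp (s * y))%:E)); last first.
  - by move=> y; rewrite lee_fin.
  - exact/measurable_EFinP.
  by apply: eq_integral => y _ /=; rewrite addrAC subrr add0r mulrN.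
have Afin : (A < +oo)%E.
  apply: (@le_lt_trans _ _ (\int[N01]_y (1 + (s ^+ 2)%:E * (((y ^+ 2) ^+ 1))%:E))%E).
    apply: ge0_le_integral => //.
    - by move=> y _; rewrite lee_fin.
    - exact/measurable_EFinP.
    - apply/measurable_EFinP; apply: measurable_funD => //; apply: measurable_funM => //.
      by apply: measurable_funX; apply: measurable_funX.
    - move=> y _; rewrite -EFinM -EFinD lee_fin /posp expr1 -exprMn ge_max.
      by have := sqr_ge0 (s * y - 1); have := sqr_ge0 (s * y); nra.
  rewrite ge0_integralD//=.
  - rewrite integral_cst//= probability_setT mule1 ge0_integralZl//=.
    + rewrite -/(even_moment R 1) -(fineK (even_moment_fin R 1)) -EFinM -EFinD.
      by rewrite ltry.
    + by apply/measurable_EFinP; apply: measurable_funX; apply: measurable_funX.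
    + by move=> y _; rewrite lee_fin expr1 sqr_ge0.
    + by rewrite lee_fin sqr_ge0.
  - by move=> y _; rewrite -EFinM lee_fin mulr_ge0 ?expr1 ?sqr_ge0.
  - apply/measurable_EFinP; apply: measurable_funM => //.
    by apply: measurable_funX; apply: measurable_funX.
have mXm : measurable_fun setT (fun w => X w - m) by exact: measurable_funB.
have ipos : P.-integrable setT (fun w => (posp (X w - m))%:E).
  apply/integrableP; split; first by apply/measurable_EFinP; apply: measurable_maxr.
  by under eq_integral do rewrite gee0_abs ?lee_fin//; rewrite EpA.
have ineg : P.-integrable setT (fun w => (posp (- (X w - m)))%:E).
  apply/integrableP; split.
    by apply/measurable_EFinP; apply: measurable_maxr => //; exact: measurable_funN.
  by under eq_integral do rewrite gee0_abs ?lee_fin//; rewrite EnA.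
have XE w : (X w)%:E = ((posp (X w - m))%:E - (posp (- (X w - m)))%:E + m%:E)%E.
  rewrite -EFinB -EFinD; congr EFin; rewrite /posp.
  by have [h|h] := lerP (X w - m) 0; have [h'|h'] := lerP (- (X w - m)) 0; lra.
have m0 : m = 0.
  apply: EFin_inj; rewrite -[RHS]EX; under eq_integral do rewrite XE.
  have ib := integrableB measurableT ipos ineg.
  have ic : P.-integrable setT (fun=> m%:E) by exact: finite_measure_integrable_cst.
  rewrite (integralD measurableT ib ic) (integralB measurableT ipos ineg) EpA EnA subee ?add0e; last first.
    by rewrite ge0_fin_numE// /A integral_ge0// => y _; rewrite lee_fin.
  by rewrite integral_cst//= probability_setT mule1.
have vE : v = s ^+ 2 * variance_unit.
  apply: EFin_inj; rewrite -EX2 (Eg _ c1 (@sqr_ge0 R)).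
  rewrite m0; under eq_integral do rewrite add0r exprMn EFinM.
  rewrite ge0_integralZl//=.
  - by rewrite [RHS]EFinM /variance_unit fineK ?even_moment_fin.
  - by apply/measurable_EFinP; apply: measurable_funX.
  - by move=> y _; rewrite lee_fin sqr_ge0.
  - by rewrite lee_fin sqr_ge0.
have -> : Num.sqrt (v / variance_unit) = s.
  by rewrite vE mulfK ?gt_eqF ?variance_unit_gt0// sqrtr_sqr ger0_norm.
split.
- by rewrite vE mulr_ge0// ?sqr_ge0// ltW// variance_unit_gt0.
- by move=> B mB; rewrite (law B mB) m0.
- by move=> g cg g0; rewrite Eg// m0; apply: eq_integral => y _; rewrite add0r.
Qed.

Lemma centered_gaussian_eq_law X Y v :
  centered_gaussian X v -> centered_gaussian Y v -> eq_law P X Y.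
Proof.
move=> /centered_gaussian_repr[_ lX _] /centered_gaussian_repr[_ lY _] A mA.
by rewrite (lX A mA) (lY A mA).
Qed.

(** Scaling: the 2k-th moment is proportional to the k-th power of the
    variance. *)
Lemma centered_gaussian_moment k : exists2 c : R, 0 <= c &
  forall X v, centered_gaussian X v ->
    (\int[P]_w ((X w ^+ 2) ^+ k)%:E = (c * v ^+ k)%:E)%E.
Proof.
exists (fine (@even_moment R k) / variance_unit ^+ k).
  rewrite divr_ge0 ?exprn_ge0 ?(ltW variance_unit_gt0)// fine_ge0//.
  by apply: integral_ge0 => y _; rewrite lee_fin exprn_ge0 ?sqr_ge0.
move=> X v /centered_gaussian_repr[v0 _ /(_ (fun x => (x ^+ 2) ^+ k))] ->; last 2 first.
- move=> x; apply: (@continuous_comp _ _ _ (fun z : R => z ^+ 2) (fun z => z ^+ k));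
    exact: exprn_continuous.
- by move=> x; rewrite exprn_ge0 ?sqr_ge0.
have vu0 : 0 <= v / variance_unit by rewrite divr_ge0// ltW// variance_unit_gt0.
have E (y : R) : (((Num.sqrt (v / variance_unit) * y) ^+ 2) ^+ k)%:E =
    (((v / variance_unit) ^+ k)%:E * ((y ^+ 2) ^+ k)%:E)%E.
  by rewrite -EFinM -(exprMn k) -[in RHS](sqr_sqrtr vu0) -(exprMn 2).
under eq_integral do rewrite E.
rewrite ge0_integralZl//=.
- rewrite -/(even_moment R k) -(fineK (even_moment_fin R k)) -EFinM expr_div_n.
  by congr EFin; rewrite mulrAC [RHS]mulrAC (mulrC (fine _)).
- by apply/measurable_EFinP; apply: measurable_funX; apply: measurable_funX.
- by move=> y _; rewrite lee_fin exprn_ge0 ?sqr_ge0.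
- by rewrite lee_fin exprn_ge0// divr_ge0// ltW// variance_unit_gt0.
Qed.

Lemma centered_gaussian_tail_gt0 X v (c : R) : centered_gaussian X v -> 0 < v ->
  (0 < P [set w | (c < X w)%R])%E.
Proof.
move=> cX v0; have [mX _ _ _] := cX; have [_ law _] := centered_gaussian_repr cX.
have s0 : Num.sqrt (v / variance_unit) != 0.
  by rewrite gt_eqF// sqrtr_gt0 divr_gt0// variance_unit_gt0.
have -> : [set w | c < X w] = X @^-1` `]c, +oo[%classic.
  by apply/seteqP; split => w /=; rewrite in_itv/= andbT.
rewrite law ?(negbTE s0); last exact: measurable_itv.
rewrite (lt_le_trans (normal_prob_itv_gt0 0 (c + 1) s0))//.
apply: le_measure; rewrite ?inE// => x /=; rewrite !in_itv/= andbT => /andP[+ _].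
by apply: lt_le_trans; rewrite ltrDl.
Qed.

End gaussian_variables.

(** * Gaussian families *)

Section gaussian_families.
Context d (T : measurableType d) (R : realType) (P : probability T R).

Definition square_integrable (X : T -> R) : Prop :=
  measurable_fun setT X /\ P.-integrable setT (fun w => (X w * X w)%:E).

(** 2 |x y| <= x ^ 2 + y ^ 2. *)
Lemma square_integrable_mul X Y : square_integrable X -> square_integrable Y ->
  P.-integrable setT (fun w => (X w * Y w)%:E).
Proof.
move=> [mX iX] [mY iY].
apply: (@le_integrable _ _ _ P setT measurableT _
    (fun w => (X w * X w)%:E + (Y w * Y w)%:E)%E).
- by apply/measurable_EFinP; exact: measurable_funM.
- move=> w _; rewrite -EFinD !abse_EFin lee_fin.
  rewrite [leRHS]ger0_norm; last by rewrite addr_ge0// -expr2 sqr_ge0.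
  rewrite ler_norml; have := sqr_ge0 (X w - Y w); have := sqr_ge0 (X w + Y w).
  by have := sqr_ge0 (X w); have := sqr_ge0 (Y w); nra.
- exact: integrableD.
Qed.

Lemma square_integrable_cst c : square_integrable (fun=> c).
Proof. by split => //; exact: finite_measure_integrable_cst. Qed.

Lemma square_integrable_integrable X : square_integrable X ->
  P.-integrable setT (fun w => (X w)%:E).
Proof.
move=> iX; have := square_integrable_mul iX (square_integrable_cst 1).
by apply: eq_integrable => // w _; rewrite mulr1.
Qed.

Lemma gaussian_square_integrable X : measurable_fun setT X -> gaussian P X ->
  square_integrable X.
Proof.
move=> mX gX; split => //; have [m [s [s0 _ Eg]]] := gaussian_repr mX gX.
apply/integrableP; split; first by apply/measurable_EFinP; exact: measurable_funM.
under eq_integral do rewrite gee0_abs ?lee_fin -?expr2 ?sqr_ge0//.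
rewrite (Eg (fun x => x ^+ 2) (@exprn_continuous R 2) (@sqr_ge0 R)).
apply: (@le_lt_trans _ _ (\int[@normal_prob R 0 1]_y
    ((2 * m ^+ 2)%:E + (2 * s ^+ 2)%:E * (((y ^+ 2) ^+ 1))%:E))%E).
  apply: ge0_le_integral => //.
  - by move=> y _; rewrite lee_fin sqr_ge0.
  - by apply/measurable_EFinP; apply: measurable_funX; apply: measurable_funD.
  - apply/measurable_EFinP; apply: measurable_funD => //; apply: measurable_funM => //.
    by apply: measurable_funX; apply: measurable_funX.
  - move=> y _; rewrite -EFinM -EFinD lee_fin expr1.
    by have := sqr_ge0 (m - s * y); nra.
rewrite ge0_integralD//=.
- rewrite integral_cst//= probability_setT mule1 ge0_integralZl//=.
  + rewrite -/(even_moment R 1) -(fineK (even_moment_fin R 1)) -EFinM -EFinD.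
    by rewrite ltry.
  + by apply/measurable_EFinP; apply: measurable_funX; apply: measurable_funX.
  + by move=> y _; rewrite lee_fin expr1 sqr_ge0.
  + by rewrite lee_fin mulr_ge0// sqr_ge0.
- by move=> y _; rewrite lee_fin mulr_ge0// sqr_ge0.
- by move=> y _; rewrite -EFinM lee_fin mulr_ge0 ?expr1 ?sqr_ge0// mulr_ge0// sqr_ge0.
- apply/measurable_EFinP; apply: measurable_funM => //.
  by apply: measurable_funX; apply: measurable_funX.
Qed.

Definition gaussian_family (X : nat -> T -> R) (G : nat -> nat -> R) : Prop :=
  [/\ forall i, measurable_fun setT (X i),
      forall n (a : 'I_n -> R), gaussian P (fun w => \sum_i a i * X i w),
      forall i, (\int[P]_w (X i w)%:E = 0)%E &
      forall i j, (\int[P]_w (X i w * X j w)%:E = (G i j)%:E)%E].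

Lemma gaussian_family_square X G i : gaussian_family X G ->
  square_integrable (X i).
Proof.
move=> [mX _ _ EX]; split => //; apply/integrableP; split.
  by apply/measurable_EFinP; exact: measurable_funM.
under eq_integral do rewrite gee0_abs ?lee_fin -?expr2 ?sqr_ge0//.
under eq_integral do rewrite expr2.
by rewrite EX ltry.
Qed.

Lemma gaussian_family_lincomb X G n (a : 'I_n -> R) : gaussian_family X G ->
  centered_gaussian P (fun w => \sum_i a i * X i w)
    (\sum_i \sum_j a i * a j * G i j).
Proof.
move=> fX; have [mX gX mean cov] := fX; split => //.
- by apply: measurable_sum => i; exact: measurable_funM.
- under eq_integral do rewrite -sumEFin.
  rewrite integral_sum//; last first.
    move=> i; have := integrableZl measurableT (a i) (square_integrable_integrable (gaussian_family_square i fX)).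
    by apply: eq_integrable.
  rewrite big1// => i _; under eq_integral do rewrite EFinM.
  rewrite integralZl//; last exact/square_integrable_integrable/(gaussian_family_square i fX).
  by rewrite mean mule0.
- have iXX (i j : nat) c : P.-integrable setT (fun w => (c * (X i w * X j w))%:E).
    have := integrableZl measurableT c (square_integrable_mul (gaussian_family_square i fX) (gaussian_family_square j fX)).
    by apply: eq_integrable.
  transitivity (\int[P]_w (\sum_(i < n) \sum_(j < n) (a i * a j * (X i w * X j w))%:E))%E.
    apply: eq_integral => w _; rewrite expr2 mulr_suml -sumEFin; apply: eq_bigr => i _.
    by rewrite mulr_sumr -sumEFin; apply: eq_bigr => j _; congr EFin; ring.
  rewrite integral_sum//; last by move=> i; apply: integrable_sum => //.
  rewrite -sumEFin; apply: eq_bigr => i _; rewrite integral_sum// -sumEFin.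
  apply: eq_bigr => j _; under eq_integral do rewrite EFinM.
  rewrite integralZl//; last exact: square_integrable_mul (gaussian_family_square i fX) (gaussian_family_square j fX).
  by rewrite cov.
Qed.

(** Linear combinations are centered Gaussian with a variance read from the
    covariance kernel G, so two families with the same kernel agree in law. *)
Lemma gaussian_family_eq_law X Y G : gaussian_family X G -> gaussian_family Y G ->
  forall n (a : 'I_n -> R),
    eq_law P (fun w => \sum_i a i * X i w) (fun w => \sum_i a i * Y i w).
Proof.
move=> fX fY n a.
exact: centered_gaussian_eq_law (gaussian_family_lincomb a fX) (gaussian_family_lincomb a fY).
Qed.

End gaussian_families.

(** * Invariance properties of fractional Brownian motion *)

Section fractional_brownian_motion.
Context d (T : measurableType d) (R : realType) (P : probability T R).
Variables (H : R) (W : R -> {RV P >-> R}).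
Hypotheses (H_gt0 : 0 < H) (fbmW : fractional_brownian_motion H W).

Definition fbm_kernel (s t : R) : R :=
  2^-1 * (t `^ (2 * H) + s `^ (2 * H) - `|t - s| `^ (2 * H)).

Let mW t : measurable_fun setT (W t). Proof. by []. Qed.

Lemma fbm_integral t : 0 <= t -> (\int[P]_w (W t w)%:E = 0)%E.
Proof. by move=> t0; have := fbm_mean fbmW t0; rewrite unlock. Qed.

Lemma fbm_integral_mul s t : 0 <= s -> 0 <= t ->
  (\int[P]_w (W s w * W t w)%:E = (fbm_kernel s t)%:E)%E.
Proof.
move=> s0 t0; rewrite -(fbm_cov fbmW s0 t0).
have E r : 0 <= r -> (W r \- cst (fine 'E_P[W r]%E) = W r)%R.
  by move=> r0; apply/funext => w /=; rewrite (fbm_mean fbmW r0) subr0.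
by rewrite unlock (E _ s0) (E _ t0) unlock.
Qed.

Lemma fbm_square_integrable t : 0 <= t -> square_integrable P (W t).
Proof.
move=> t0; apply: gaussian_square_integrable => //.
have := fbm_gaussian fbmW (t := fun _ : 'I_1 => t) (fun=> 1) (fun=> t0).
by congr gaussian; apply/funext => w; rewrite big_ord1 mul1r.
Qed.

Lemma fbm_kernel_diag t : 0 <= t -> fbm_kernel t t = t `^ (2 * H).
Proof.
move=> t0; rewrite /fbm_kernel subrr normr0 powR0 ?mulf_neq0 ?gt_eqF//; lra.
Qed.

(** The covariance of the time-reversed increments W t - W (t - s) is again the
    kernel, since |(t - r) - (t - s)| = |r - s| and the other terms cancel. *)
Lemma fbm_kernel_reversal t r s : 0 <= r <= t -> 0 <= s <= t ->
  fbm_kernel t t - fbm_kernel t (t - s) - fbm_kernel (t - r) t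
    + fbm_kernel (t - r) (t - s) = fbm_kernel r s.
Proof.
move=> /andP[r0 rt] /andP[s0 st]; rewrite /fbm_kernel.
have -> : t - s - t = - s by ring.
have -> : t - (t - r) = r by ring.
have -> : t - s - (t - r) = r - s by ring.
rewrite subrr normr0 powR0 ?mulf_neq0 ?gt_eqF// normrN (ger0_norm s0) (ger0_norm r0) (distrC r s); lra.
Qed.

Lemma fbm_family c (tau : nat -> R) : (forall i, 0 <= tau i) ->
  gaussian_family P (fun i w => c * W (tau i) w)
    (fun i j => c ^+ 2 * fbm_kernel (tau i) (tau j)).
Proof.
move=> tau0; split.
- by move=> i; exact: measurable_funM.
- move=> n a; have := fbm_gaussian fbmW (t := fun i : 'I_n => tau i) (fun i => a i * c) (fun i => tau0 i).
  by congr gaussian; apply/funext => w; apply: eq_bigr => i _; rewrite mulrA.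
- move=> i; under eq_integral do rewrite EFinM.
  rewrite integralZl//; last exact/square_integrable_integrable/fbm_square_integrable.
  by rewrite fbm_integral// mule0.
- move=> i j; transitivity (\int[P]_w ((c ^+ 2)%:E * (W (tau i) w * W (tau j) w)%:E))%E.
    by apply: eq_integral => w _; rewrite -EFinM; congr EFin; ring.
  rewrite integralZl//; last by apply: square_integrable_mul; exact: fbm_square_integrable.
  by rewrite fbm_integral_mul.
Qed.

Lemma fbm_reversed_family c t (s : nat -> R) : (forall i, 0 <= s i <= t) ->
  gaussian_family P (fun i w => c * (W t w - W (t - s i) w))
    (fun i j => c ^+ 2 * fbm_kernel (s i) (s j)).
Proof.
move=> s0t; have t0 : 0 <= t by have /andP[/le_trans h /h] := s0t 0%N.
have ts0 i : 0 <= t - s i by rewrite subr_ge0; have /andP[] := s0t i.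
have iW r : 0 <= r -> P.-integrable setT (fun w => (W r w)%:E).
  by move=> r0; exact/square_integrable_integrable/fbm_square_integrable.
have iWW r r' : 0 <= r -> 0 <= r' -> P.-integrable setT (fun w => (W r w * W r' w)%:E).
  by move=> r0 r'0; apply: square_integrable_mul; exact: fbm_square_integrable.
split.
- by move=> i; apply: measurable_funM => //; exact: measurable_funB.
- move=> n a.
  pose t' k := if unlift (@ord0 n) k is Some i then t - s i else t.
  pose a' k := if unlift (@ord0 n) k is Some i then - (a i * c) else \sum_i a i * c.
  have t'0 k : 0 <= t' k by rewrite /t'; case: unliftP.
  have := fbm_gaussian fbmW a' t'0.
  congr gaussian; apply/funext => w; rewrite big_ord_recl /a' /t' unlift_none.
  rewrite mulr_suml -big_split/=; apply: eq_bigr => i _; rewrite liftK; ring.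
- move=> i; transitivity (\int[P]_w (c%:E * ((W t w)%:E - (W (t - s i) w)%:E)))%E.
    by apply: eq_integral => w _; rewrite -EFinB -EFinM.
  rewrite integralZl//; last by apply: integrableB => //; exact: iW.
  rewrite integralB//; [|exact: iW..].
  by rewrite !fbm_integral// sube0 mule0.
- move=> i j; transitivity (\int[P]_w ((c ^+ 2)%:E *
      ((W t w * W t w)%:E - (W t w * W (t - s j) w)%:E
       - (W (t - s i) w * W t w)%:E + (W (t - s i) w * W (t - s j) w)%:E)))%E.
    apply: eq_integral => w _; rewrite -!EFinB -EFinD -EFinM; congr EFin; ring.
  have i1 := iWW _ _ t0 t0; have i2 := iWW _ _ t0 (ts0 j).
  have i3 := iWW _ _ (ts0 i) t0; have i4 := iWW _ _ (ts0 i) (ts0 j).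
  have i12 := integrableB measurableT i1 i2.
  have i123 := integrableB measurableT i12 i3.
  have i1234 := integrableD measurableT i123 i4.
  rewrite (integralZl measurableT i1234) (integralD measurableT i123 i4).
  rewrite (integralB measurableT i12 i3) (integralB measurableT i1 i2).
  rewrite !fbm_integral_mul// -!EFinB -EFinD -EFinM; congr (_ * _)%:E.
  by rewrite -(fbm_kernel_reversal (s0t i) (s0t j)).
Qed.

(** Self-similarity: time scaled by a multiplies the kernel by a ^ (2 H). *)
Lemma fbm_scaling_eq_law c a (q : nat -> R) : 0 < a -> (forall i, 0 <= q i) ->
  forall n (b : 'I_n -> R),
    eq_law P (fun w => \sum_i b i * (c * W (a * q i) w))
             (fun w => \sum_i b i * (c * a `^ H * W (q i) w)).
Proof.
move=> a0 q0 n b; have a0' := ltW a0.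
have F1 := @fbm_family c (fun i => a * q i) (fun i => mulr_ge0 a0' (q0 i)).
have := @fbm_family (c * a `^ H) q q0.
rewrite (_ : (fun i j => _) = fun i j => c ^+ 2 * fbm_kernel (a * q i) (a * q j)).
  by move=> F2; exact: (gaussian_family_eq_law F1 F2).
apply/funext => i; apply/funext => j; rewrite /fbm_kernel.
rewrite -mulrBr normrM (gtr0_norm a0) !powRM// exprMn -mulrA; congr (_ * _).
have -> : (a `^ H) ^+ 2 = a `^ (2 * H) by rewrite -powR_mulrn ?powR_ge0// -powRrM mulrC.
ring.
Qed.

(** Time reversal on [0, t]. *)
Lemma fbm_reversal_eq_law c t (s : nat -> R) : (forall i, 0 <= s i <= t) ->
  forall n (b : 'I_n -> R),
    eq_law P (fun w => \sum_i b i * (c * (W t w - W (t - s i) w)))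
             (fun w => \sum_i b i * (c * W (s i) w)).
Proof.
move=> s0t n b.
have s0 i : 0 <= s i by have /andP[] := s0t i.
exact: (gaussian_family_eq_law (@fbm_reversed_family c t s s0t) (@fbm_family c s s0)).
Qed.

Lemma fbm_marginal t : 0 <= t -> centered_gaussian P (W t) (t `^ (2 * H)).
Proof.
move=> t0; have := gaussian_family_lincomb (fun _ : 'I_1 => 1) (@fbm_family 1 (fun=> t) (fun=> t0)).
rewrite !big_ord1 expr1n !mul1r fbm_kernel_diag//; congr centered_gaussian.
by apply/funext => w; rewrite big_ord1 !mul1r.
Qed.

Lemma fbm_increment s t : 0 <= s <= t ->
  centered_gaussian P (fun w => W t w - W s w) ((t - s) `^ (2 * H)).
Proof.
move=> /andP[s0 st].
have h i : 0 <= (fun _ : nat => t - s) i <= t by rewrite subr_ge0 st gerBl.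
have := gaussian_family_lincomb (fun _ : 'I_1 => 1) (@fbm_reversed_family 1 t _ h).
rewrite !big_ord1 expr1n !mul1r fbm_kernel_diag ?subr_ge0//; congr centered_gaussian.
by apply/funext => w; rewrite big_ord1 !mul1r subKr.
Qed.

End fractional_brownian_motion.

(** * Dyadic chaining *)

Section nonnegative_extension.
Variable R : realType.

(** Clipping negative times to 0 turns continuity on the half-line into plain
    continuity. *)
Lemma continuous_extension (f : R -> R) : {within `[0, +oo[, continuous f} ->
  continuous (fun t : R => f (Num.max t 0)).
Proof.
move=> cf t; pose u (s : R) := Num.max s 0.
have u0 s : `[0, +oo[%classic (u s).
  by rewrite /= in_itv/= andbT le_max lexx orbT.
have cu : u s @[s --> t] --> u t.
  apply: continuous_max; [exact: cvg_id|exact: cvg_cst].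
have fu : f y @[y --> within `[0, +oo[%classic (nbhs (u t))] --> f (u t).
  by rewrite (nbhs_subspace_in (u0 t)); exact: cf (u t).
apply: cvg_comp fu => U; rewrite /within/= => hU.
have : \forall s \near t, `[0, +oo[%classic (u s) -> U (u s) by exact: cu hU.
by apply: filterS => s; apply; exact: u0.
Qed.

End nonnegative_extension.

Section dyadic_chaining.
Variable R : realType.
Implicit Types (X : R -> R) (i j k : nat).

(** The k-th point of the i-th dyadic subdivision of [0, 2 ^ j]. *)
Definition dyadic j i k : R := k%:R * (2 ^+ j / 2 ^+ i).

Definition dyadic_increment X j i k := X (dyadic j i k.+1) - X (dyadic j i k).

Lemma dyadic_ge0 j i k : 0 <= dyadic j i k.
Proof. by rewrite mulr_ge0// divr_ge0// exprn_ge0. Qed.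

Lemma dyadic_double j i k : dyadic j i.+1 k.*2 = dyadic j i k.
Proof.
rewrite /dyadic -muln2 natrM exprS; field.
by rewrite expf_neq0.
Qed.

Lemma dyadic_step j i k : dyadic j i k.+1 - dyadic j i k = 2 ^+ j / 2 ^+ i.
Proof. by rewrite /dyadic -mulrBl -natr1 addrAC subrr add0r mul1r. Qed.

(** A dyadic point of level i + 1 is at most one step of that level away from a
    point of level i. *)
Lemma chaining X j (delta : nat -> R) : X 0 = 0 ->
  (forall i k, (k < 2 ^ i)%N -> `|dyadic_increment X j i k| <= delta i) ->
  forall i k, (k <= 2 ^ i)%N -> `|X (dyadic j i k)| <= \sum_(l < i.+1) delta l.
Proof.
move=> X0 inc; have delta0 i : 0 <= delta i.
  by rewrite (le_trans _ (inc i 0%N _)) ?expn_gt0.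
elim=> [|i IH] k.
  rewrite expn0 leq_eqVlt ltnS leqn0 => /orP[|] /eqP ->; rewrite big_ord1.
    rewrite (le_trans _ (inc 0%N 0%N _))// /dyadic_increment.
    by rewrite {3}/dyadic mul0r X0 subr0.
  by rewrite /dyadic mul0r X0 normr0.
move=> ki; rewrite big_ord_recr/=.
have k2 : (k./2 <= 2 ^ i)%N by rewrite leq_half_double -mul2n -expnS (leq_trans ki).
have kE := odd_double_half k; case: (odd k) kE => [kE|].
  rewrite -kE add1n -[X in `|X|](subrK (X (dyadic j i.+1 k./2.*2))).
  rewrite (le_trans (ler_normD _ _))// [leLHS]addrC lerD//.
    by rewrite dyadic_double IH.
  by apply: inc; rewrite -kE add1n in ki.
rewrite add0n => <-; rewrite dyadic_double (le_trans (IH _ k2))//.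
by rewrite lerDl.
Qed.

Lemma dyadic_dense j (t e : R) : 0 <= t <= 2 ^+ j -> 0 < e ->
  exists i k, (k <= 2 ^ i)%N /\ `|dyadic j i k - t| < e.
Proof.
move=> /andP[t0 tj] e0; have pj : (0 : R) < 2 ^+ j by rewrite exprn_gt0.
have [i ie] : exists i, 2 ^+ j / 2 ^+ i < e.
  exists (Num.truncn (2 ^+ j / e)).+1; rewrite ltr_pdivrMr ?exprn_gt0// mulrC -ltr_pdivrMr//.
  rewrite (lt_le_trans (truncnS_gt _))//.
  by move: (Num.truncn _) => n; rewrite -natrX ler_nat ltnW// ltn_expl.
pose k := Num.truncn (t / (2 ^+ j / 2 ^+ i)).
have s0 : 0 < 2 ^+ j / 2 ^+ i :> R by rewrite divr_gt0// exprn_gt0.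
have /andP[k1 k2] : k%:R <= t / (2 ^+ j / 2 ^+ i) < k.+1%:R.
  by apply: truncn_itv; rewrite divr_ge0// ltW.
exists i, k; split.
  rewrite -(ler_nat R) (le_trans k1)// natrX ler_pdivrMr// mulrCA mulfV ?mulr1//.
rewrite ler_pdivlMr// in k1; rewrite ltr_pdivrMr// in k2.
rewrite distrC ger0_norm ?subr_ge0//; apply: le_lt_trans ie.
by rewrite lerBlDl -(dyadic_step j i k) addrC subrK ltW.
Qed.

Lemma dyadic_sup_bound X j (B : R) : {within `[0, +oo[, continuous X} ->
  (forall i k, (k <= 2 ^ i)%N -> `|X (dyadic j i k)| <= B) ->
  forall t, 0 <= t <= 2 ^+ j -> `|X t| <= B.
Proof.
move=> /continuous_extension cX hB t tj; apply/ler_addgt0Pr => e e0.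
have /cvgrPdist_lt/(_ e e0) := cX t.
move=> /nbhs_ballP[eta /= eta0 near_t].
have [i [k [ki dk]]] := dyadic_dense tj eta0.
have := near_t (dyadic j i k); rewrite -ball_normE/= distrC => /(_ dk).
have /andP[t0 _] := tj; rewrite !max_l ?dyadic_ge0// => h.
rewrite -(subrK (X (dyadic j i k)) (X t)) (le_trans (ler_normD _ _))// [leLHS]addrC lerD ?hB//.
exact: ltW.
Qed.

End dyadic_chaining.

(** * Moments of the drifted maximum *)

Section series_lemmas.
Variable R : realType.

Lemma eseries_geometric (a z : R) : 0 <= z < 1 ->
  (\sum_(i <oo) (a * z ^+ i)%:E = (a / (1 - z))%:E)%E.
Proof.
move=> /andP[z0 z1]; apply: cvg_lim => //.
have := @cvg_geometric_series R a z; rewrite ger0_norm// => /(_ z1) h.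
under eq_cvg do rewrite sumEFin.
by apply: cvg_EFin => //; exact: nearW.
Qed.

Lemma nneseries_term_le (u : nat -> \bar R) i : (forall n, 0 <= u n)%E ->
  (u i <= \sum_(n <oo) u n)%E.
Proof.
move=> u0; apply: le_trans (nneseries_lim_ge i.+1 _) => //.
by rewrite big_nat_recr//= leeDr// sume_ge0.
Qed.

Lemma sum_geometric_le (n : nat) : \sum_(l < n) (9 / 10 : R) ^+ l <= 10.
Proof.
suff -> : \sum_(l < n) (9 / 10 : R) ^+ l = 10 * (1 - (9 / 10) ^+ n).
  by rewrite ler_piMr// gerBl exprn_ge0//; lra.
elim: n => [|n IH]; first by rewrite big_ord0 expr0 subrr mulr0.
by rewrite big_ord_recr/= IH exprS; lra.
Qed.

Lemma expr2n_norm (x : R) m : (x ^+ 2) ^+ m = `|x| ^+ (2 * m).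
Proof. by rewrite exprM real_normK// num_real. Qed.

Lemma sqr_addr1_le (x : R) m : ((x + 1) ^+ 2) ^+ m <= 4 ^+ m * (1 + (x ^+ 2) ^+ m).
Proof.
have [x1|x1] := lerP (x ^+ 2) 1.
  apply: (@le_trans _ _ (4 ^+ m)).
    rewrite lerXn2r ?nnegrE ?sqr_ge0//.
    rewrite -subr_ge0 (_ : 4 - (x + 1) ^+ 2 = 2 * (1 - x ^+ 2) + (x - 1) ^+ 2); last by ring.
    by rewrite addr_ge0 ?sqr_ge0// mulr_ge0// subr_ge0.
  by rewrite ler_peMr ?exprn_ge0// lerDl exprn_ge0 ?sqr_ge0.
apply: (@le_trans _ _ ((4 * x ^+ 2) ^+ m)).
  rewrite lerXn2r ?nnegrE ?sqr_ge0 ?(mulr_ge0 _ (sqr_ge0 x))//.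
  rewrite -subr_ge0 (_ : 4 * x ^+ 2 - (x + 1) ^+ 2 = 2 * (x ^+ 2 - 1) + (x - 1) ^+ 2); last by ring.
  by rewrite addr_ge0 ?sqr_ge0// mulr_ge0// subr_ge0 ltW.
by rewrite (exprMn m) ler_wpM2l ?exprn_ge0// lerDr.
Qed.

(** Picks the dyadic block that contains t, with a length comparable to t + 1. *)
Lemma dyadic_scale (t : R) : 0 <= t -> exists j, t <= 2 ^+ j <= 2 * (t + 1).
Proof.
move=> t0; have ex : exists j, t <= 2 ^+ j.
  exists (Num.truncn t).+1; rewrite (le_trans (ltW (truncnS_gt _)))//.
  by move: (Num.truncn _) => n; rewrite -natrX ler_nat ltnW// ltn_expl.
exists (ex_minn ex); case: ex_minnP => -[|j] tj jmin; rewrite tj/=; first by lra.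
have : 2 ^+ j < t by rewrite ltNge; apply/negP => /jmin; rewrite ltnn.
by rewrite exprS; lra.
Qed.

End series_lemmas.

Section drifted_moments.
Context d (T : measurableType d) (R : realType) (P : probability T R).
Variables (H : R) (W : R -> {RV P >-> R}).
Hypotheses (H_ge : 2^-1 <= H) (fbmW : fractional_brownian_motion H W).

Let H_gt0 : 0 < H. Proof. by apply: lt_le_trans H_ge; rewrite invr_gt0. Qed.

(** Sum of the 2m-th powers of the increments of level i, weighted by
    (10 / 9) ^ (2 m i). A bound s on the sum over all levels then bounds each
    increment of level i by (9 / 10) ^ i * s ^ (1 / 2m), a summable sequence,
    which is what chaining asks for. *)
Definition chain_term m j i (w : T) : R :=
  ((10 / 9) ^+ (2 * m)) ^+ i *
  \sum_(k < 2 ^ i) ((dyadic_increment (W^~ w) j i k) ^+ 2) ^+ m.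

Definition chain_sum m j (w : T) : \bar R :=
  (\sum_(i <oo) (chain_term m j i w)%:E)%E.

Lemma chain_term_ge0 m j i w : 0 <= chain_term m j i w.
Proof.
apply: mulr_ge0; first by rewrite !exprn_ge0// divr_ge0.
by apply: sumr_ge0 => k _; rewrite exprn_ge0 ?sqr_ge0.
Qed.

Lemma chain_sum_ge0 m j w : (0 <= chain_sum m j w)%E.
Proof. by apply: nneseries_ge0 => i _ _; rewrite lee_fin chain_term_ge0. Qed.

Lemma measurable_chain_term m j i : measurable_fun setT (chain_term m j i).
Proof.
apply: measurable_funM => //; apply: measurable_sum => k.
do 2 apply: measurable_funX; exact: measurable_funB.
Qed.

Lemma measurable_chain_sum m j : measurable_fun setT (chain_sum m j).
Proof.
apply: ge0_emeasurable_sum => [i w _ _|i _].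
  by rewrite lee_fin chain_term_ge0.
exact/measurable_EFinP/measurable_chain_term.
Qed.

(** Chaining with increments bounded by (9 / 10) ^ i * rho, where rho is the
    2m-th root of the chain sum; the geometric series contributes the factor
    10. *)
Lemma path_chain_bound m j w t : (0 < m)%N -> 0 <= t <= 2 ^+ j ->
  (((W t w ^+ 2) ^+ m)%:E <= (10 ^+ (2 * m))%:E * chain_sum m j w)%E.
Proof.
move=> m0 tj; have S0 := chain_sum_ge0 m j w.
have m2 : (0 < 2 * m)%N by rewrite muln_gt0.
have [->|Sy] := eqVneq (chain_sum m j w) +oo%E.
  by rewrite gt0_muley ?leey// lte_fin exprn_gt0.
have Sfin : chain_sum m j w \is a fin_num by rewrite ge0_fin_numE// ltey.
set s := fine (chain_sum m j w); have SE : chain_sum m j w = s%:E by rewrite fineK.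
have s0 : 0 <= s by rewrite fine_ge0.
pose rho := s `^ ((2 * m)%:R^-1).
have rho0 : 0 <= rho by exact: powR_ge0.
have rhoE : rho ^+ (2 * m) = s.
  by rewrite -powR_mulrn// -powRrM mulVf ?powRr1// pnatr_eq0 -lt0n.
have inc i k : (k < 2 ^ i)%N ->
    `|dyadic_increment (W^~ w) j i k| <= (9 / 10) ^+ i * rho.
  move=> ki.
  have q0 : 0 <= (9 / 10) ^+ i * rho by rewrite mulr_ge0// exprn_ge0// divr_ge0.
  rewrite -(ler_pXn2r m2) ?nnegrE// -expr2n_norm (exprMn (2 * m)) rhoE.
  have : chain_term m j i w <= s.
    rewrite -lee_fin -SE; apply: (@nneseries_term_le _ (fun i => (chain_term m j i w)%:E)) => n.
    by rewrite lee_fin chain_term_ge0.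
  rewrite /chain_term (bigD1 (Ordinal ki))//= => h.
  have c0 : 0 < ((10 / 9) ^+ (2 * m)) ^+ i :> R by rewrite !exprn_gt0// divr_gt0.
  rewrite -(ler_pM2l c0) mulrA; apply: le_trans (le_trans h _).
    rewrite ler_pM2l// lerDl sumr_ge0// => l _; by rewrite exprn_ge0 ?sqr_ge0.
  rewrite (exprAC _ i) -(exprMn i) -(exprMn (2 * m)) (_ : 10 / 9 * (9 / 10) = 1); last by field.
  by rewrite !expr1n mul1r.
have bound i k : (k <= 2 ^ i)%N -> `|W (dyadic R j i k) w| <= 10 * rho.
  move=> ki; rewrite (le_trans (chaining (fbm_start fbmW w) inc ki))//.
  by rewrite -mulr_suml ler_wpM2r// sum_geometric_le.
have := dyadic_sup_bound (@fbm_continuous _ _ _ _ _ _ fbmW w) bound tj => h.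
rewrite SE -EFinM lee_fin expr2n_norm -rhoE -(exprMn (2 * m)).
by rewrite lerXn2r ?nnegrE// mulr_ge0.
Qed.

(** There are 2 ^ i increments of level i, each with 2m-th moment proportional
    to (2 ^ (j - i)) ^ (2 H m). As 2 H >= 1 and m >= 2 this beats both the number
    of increments and the weight, so the levels sum geometrically. *)
Lemma integral_chain_sum m (c : R) : (1 < m)%N -> 0 <= c ->
  (forall X v, centered_gaussian P X v ->
    (\int[P]_w ((X w ^+ 2) ^+ m)%:E = (c * v ^+ m)%:E)%E) ->
  exists2 c' : R, 0 <= c' & forall j,
    (\int[P]_w chain_sum m j w = (c' * ((2 `^ (2 * H)) ^+ m) ^+ j)%:E)%E.
Proof.
move=> m1 c0 mom.
pose theta : R := 2 `^ (2 * H).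
have th0 : 0 < theta by rewrite powR_gt0.
have th2 : 2 <= theta.
  rewrite -[leLHS]powRr1// ler_powR ?ler1n// -ler_pdivrMl// mulr1; exact: H_ge.
pose x : R := (10 / 9) ^+ (2 * m) * 2 / theta ^+ m.
have x0 : 0 <= x by rewrite mulr_ge0 ?invr_ge0 ?exprn_ge0 ?(ltW th0)// mulr_ge0// exprn_ge0// divr_ge0.
have x1 : x < 1.
  rewrite ltr_pdivrMr ?exprn_gt0// mul1r exprM.
  have -> : theta ^+ m = ((10 / 9) ^+ 2) ^+ m * (theta / (10 / 9) ^+ 2) ^+ m.
    by rewrite -(exprMn m) mulrCA mulfV ?mulr1// gt_eqF// exprn_gt0// divr_gt0.
  rewrite ltr_pM2l ?exprn_gt0 ?divr_gt0//.
  (* (8/5) ^ 2 > 2 is where m >= 2 is needed, and 8/5 <= 2 / (10/9) ^ 2 is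
     where theta = 2 ^ (2 H) >= 2 is *)
  apply: (@lt_le_trans _ _ ((8 / 5) ^+ 2)); first by lra.
  apply: (@le_trans _ _ ((8 / 5) ^+ m)); first by rewrite ler_weXn2l//; lra.
  apply: lerXn2r; rewrite ?nnegrE ?(divr_ge0 (ltW th0)) ?exprn_ge0 ?divr_ge0//.
  have -> : (10 / 9 : R) ^+ 2 = 100 / 81 by field.
  rewrite ler_pdivlMr; lra.
exists (c / (1 - x)); first by rewrite divr_ge0// subr_ge0 ltW.
move=> j; rewrite integral_nneseries//; last 2 first.
- by move=> i; exact/measurable_EFinP/measurable_chain_term.
- by move=> i w _; rewrite lee_fin chain_term_ge0.
transitivity (\sum_(i <oo) ((c * (theta ^+ m) ^+ j) * x ^+ i)%:E)%E; last first.
  by rewrite eseries_geometric ?x0//; congr EFin; rewrite mulrAC.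
apply: eq_eseriesr => i _.
have mf k : measurable_fun setT (fun w => (((dyadic_increment (W^~ w) j i k) ^+ 2) ^+ m)).
  do 2 apply: measurable_funX; exact: measurable_funB.
have mfE k := (measurable_EFinP _ _).2 (mf k).
have f0 k w : (0 <= (((dyadic_increment (W^~ w) j i k) ^+ 2) ^+ m)%:E)%E.
  by rewrite lee_fin exprn_ge0 ?sqr_ge0.
under eq_integral do rewrite EFinM -sumEFin.
rewrite (@ge0_integralZl_EFin _ _ _ P _ measurableT
    (fun w => \sum_(k < 2 ^ i) (((dyadic_increment (W^~ w) j i k) ^+ 2) ^+ m)%:E)%E).
- rewrite (@ge0_integral_sum _ _ _ P _ measurableT _ (fun k : 'I_(2 ^ i) => _)); last 2 first.
  + by move=> k; exact: mfE.
  + by move=> k w _; exact: f0.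
  have E (k : 'I_(2 ^ i)) : (\int[P]_w (((dyadic_increment (W^~ w) j i k) ^+ 2) ^+ m)%:E =
      (c * ((theta ^+ m) ^+ j / (theta ^+ m) ^+ i))%:E)%E.
    have le : 0 <= dyadic R j i k <= dyadic R j i k.+1.
      rewrite dyadic_ge0/= -subr_ge0 dyadic_step divr_ge0// exprn_ge0//.
    rewrite (mom _ _ (fbm_increment H_gt0 fbmW le)) dyadic_step; congr (c * _)%:E.
    have powRX n : (2 ^+ n : R) `^ (2 * H) = theta ^+ n.
      by rewrite -powR_mulrn// -powRrM mulrC powRrM powR_mulrn ?powR_ge0.
    have powRV (y r : R) : 0 < y -> (y^-1) `^ r = (y `^ r)^-1.
      move=> y0; rewrite -(powR_inv1 (ltW y0)) -(powR_inv1 (powR_ge0 y r)).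
      by rewrite -powRrM mulrC powRrM.
    rewrite powRM ?invr_ge0 ?exprn_ge0// powRV ?exprn_gt0// !powRX.
    by rewrite (exprMn m) exprVn (exprAC theta j m) (exprAC theta i m).
  under eq_bigr do rewrite E.
  rewrite sumEFin -EFinM; congr EFin; rewrite sumr_const card_ord /x.
  move: ((10 / 9) ^+ (2 * m)) (theta ^+ m) => u v.
  by rewrite -[_ *+ (2 ^ i)%N]mulr_natl natrX expr_div_n (exprMn i); ring.
- by move=> w _; apply: sume_ge0 => k _; exact: f0.
- by apply: emeasurable_sum => k; exact: mfE.
- by rewrite !exprn_ge0// divr_ge0.
Qed.

End drifted_moments.

Section drift_moment.
Context d (T : measurableType d) (R : realType) (P : probability T R).
Variables (H : R) (W : R -> {RV P >-> R}).
Hypotheses (H_ge : 2^-1 <= H) (H_lt : H < 1) (fbmW : fractional_brownian_motion H W).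

Let theta : R := 2 `^ (2 * H).

(** As 2 ^ (2 H) < 4, the moments of order 2m of W on [0, 2 ^ j] grow more
    slowly than 2 ^ ((2 m - a) j) once m is large. *)
Lemma moment_exponent (a : nat) :
  exists m, [/\ (1 < m)%N, (a <= 2 * m)%N & theta ^+ m < 2 ^+ (2 * m - a)].
Proof.
have th0 : 0 < theta by rewrite powR_gt0.
have th4 : theta < 4.
  have -> : (4 : R) = 2 `^ (2%:R) by rewrite powR_mulrn//; ring.
  by rewrite /theta /powR gt_eqF// ltr_expR ltr_pM2r ?ln_gt0 ?ltr1n// gtr_pMr.
have r0 : 0 <= theta / 4 by rewrite divr_ge0 ?ltW.
have r1 : theta / 4 < 1 by rewrite ltr_pdivrMr ?mul1r.
have e0 : (0 : R) < 2 ^- a by rewrite invr_gt0 exprn_gt0.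
have := @cvg_expr R (theta / 4); rewrite ger0_norm// => /(_ r1) /cvgrPdist_lt /(_ _ e0).
move=> [N _ hN]; pose m := (N + (a + 2))%N; exists m.
have am : (a <= 2 * m)%N 
  by rewrite (leq_trans _ (leq_pmull m (ltn0Sn 1)))// /m addnCA leq_addr.
split => //; first by rewrite /m addnA addn2.
have /hN : (N <= m)%N by rewrite /m leq_addr.
rewrite /= sub0r normrN ger0_norm ?exprn_ge0// expr_div_n ltr_pdivrMr ?exprn_gt0//.
rewrite (_ : 4 = 2 ^+ 2); last by ring.
by rewrite -exprM -{1}(subnKC am) exprD mulKf// expf_neq0.
Qed.

(** A single integrable variable D dominates the a-th power of the positive part
    of W t - t for all t. On a block where t is of order 2 ^ j and W t = t + y
    with y >= 0, both y and 2 ^ j / 2 are at most W t + 1, hence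
    y ^ a * (2 ^ j / 2) ^ (2 m - a) <= (W t + 1) ^ (2 m), and the right-hand side
    has expectation of order 2 ^ (2 H m j). Summing over j converges by the choice
    of m. This is the only place where the growth of the paths at infinity is
    controlled, and it gives both the finiteness and all the moments of the
    drifted maximum. *)
Lemma drift_moment (a : nat) : exists D : T -> \bar R,
  [/\ measurable_fun setT D, forall w, (0 <= D w)%E, (\int[P]_w D w < +oo)%E &
      forall w t, 0 <= t -> t <= W t w -> (((W t w - t) ^+ a)%:E <= D w)%E].
Proof.
have [m [m1 am thm]] := moment_exponent a.
have [c c0 mom] := centered_gaussian_moment P m.
have [c' c'0 intS] := integral_chain_sum H_ge fbmW m1 c0 mom.
set b := (2 * m - a)%N in thm.
pose A : R := 2 ^+ b * 4 ^+ m.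
have A0 : 0 <= A by rewrite mulr_ge0 ?exprn_ge0.
pose S j w := (1 + (10 ^+ (2 * m))%:E * chain_sum W m j w)%E.
have S0 j w : (0 <= S j w)%E.
  by rewrite adde_ge0// mule_ge0 ?chain_sum_ge0// lee_fin exprn_ge0.
have mS j : measurable_fun setT (S j).
  apply: emeasurable_funD => //; apply: emeasurable_funM => //.
  exact: measurable_chain_sum.
pose D_ j w := ((A / (2 ^+ b) ^+ j)%:E * S j w)%E.
have cj0 j : 0 <= A / (2 ^+ b) ^+ j by rewrite divr_ge0// !exprn_ge0.
have D_0 j w : (0 <= D_ j w)%E by rewrite mule_ge0// lee_fin.
have mD_ j : measurable_fun setT (D_ j) by exact: emeasurable_funM.
exists (fun w => \sum_(j <oo) D_ j w)%E; split.
- by apply: ge0_emeasurable_sum => [j w _ _|j _].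
- by move=> w; apply: nneseries_ge0.
- rewrite integral_nneseries//.
  have z01 : 0 <= theta ^+ m / 2 ^+ b < 1.
    by rewrite divr_ge0 ?exprn_ge0 ?powR_ge0//= ltr_pdivrMr ?mul1r ?exprn_gt0.
  pose B := A * (1 + 10 ^+ (2 * m) * c').
  apply: (@le_lt_trans _ _ (\sum_(j <oo) (B * (theta ^+ m / 2 ^+ b) ^+ j)%:E)%E); last first.
    by rewrite eseries_geometric// ltry.
  apply: lee_nneseries => [j _ _|j _]; first by apply: integral_ge0 => w _.
  rewrite (@ge0_integralZl_EFin _ _ _ P _ measurableT (S j))//.
  rewrite /S ge0_integralD//; last 2 first.
  + by move=> w _; rewrite mule_ge0 ?chain_sum_ge0// lee_fin exprn_ge0.
  + by apply: emeasurable_funM => //; exact: measurable_chain_sum.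
  rewrite integral_cst//= probability_setT mule1.
  have p10 : 0 <= 10 ^+ (2 * m) :> R by rewrite exprn_ge0.
  have mcs : measurable_fun setT (chain_sum W m j) by exact: measurable_chain_sum.
  rewrite (@ge0_integralZl_EFin _ _ _ P _ measurableT _ _ mcs _ p10); last first.
    by move=> w _; exact: chain_sum_ge0.
  rewrite intS -/theta.
  rewrite -[leLHS]/((A / (2 ^+ b) ^+ j * (1 + 10 ^+ (2 * m) * (c' * (theta ^+ m) ^+ j)))%:E).
  rewrite lee_fin.
  have th1 : 1 <= (theta ^+ m) ^+ j.
    by rewrite !exprn_ege1// -(powRr0 2) ler_powR ?ler1n// mulr_ge0// (le_trans _ H_ge).
  rewrite /B expr_div_n.
  have -> : A * (1 + 10 ^+ (2 * m) * c') * ((theta ^+ m) ^+ j / (2 ^+ b) ^+ j) =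
      A / (2 ^+ b) ^+ j * ((1 + 10 ^+ (2 * m) * c') * (theta ^+ m) ^+ j) by ring.
  by rewrite ler_wpM2l// mulrDl mul1r mulrA lerD.
move=> w t t0 tW; have [j /andP[tj jt]] := dyadic_scale t0.
apply: (le_trans _ (nneseries_term_le j (D_0^~ w))).
have chain := path_chain_bound fbmW w (ltnW m1) (introT andP (conj t0 tj)).
apply: (@le_trans _ _ ((A / (2 ^+ b) ^+ j)%:E * (1 + ((W t w ^+ 2) ^+ m)%:E))%E); last first.
  by rewrite lee_wpmul2l ?lee_fin// leeD2l.
rewrite -EFinD -EFinM lee_fin.
set y := W t w - t; have y0 : 0 <= y by rewrite subr_ge0.
have Wy : W t w + 1 = y + (t + 1) by rewrite /y; ring.
have p0 : (0 : R) < 2 ^+ j by rewrite exprn_gt0.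
have h1 : y ^+ a * (2 ^+ j / 2) ^+ b <= 4 ^+ m * (1 + (W t w ^+ 2) ^+ m).
  apply: le_trans (sqr_addr1_le _ _); rewrite Wy -exprM -(subnKC am) exprD.
  have s0 : 0 <= y + (t + 1) by lra.
  have p20 : (0 : R) <= 2 ^+ j / 2 by rewrite divr_ge0// ltW.
  apply: ler_pM; [exact: exprn_ge0|exact: exprn_ge0|apply: lerXn2r|apply: lerXn2r];
    by rewrite ?nnegrE//; lra.
move: h1; rewrite expr_div_n (exprAC 2 j b) => h1.
have q0 : (0 : R) < (2 ^+ b) ^+ j / 2 ^+ b by rewrite divr_gt0 ?exprn_gt0.
rewrite -(ler_pM2r q0); apply: (le_trans h1); rewrite le_eqVlt; apply/orP; left; apply/eqP.
by rewrite /A; field; rewrite !expf_neq0.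
Qed.

End drift_moment.

(** * Dense sequences and measurability of continuous processes *)

Section dense_sequences.
Variable R : realType.

(** Enumerates the nonnegative dyadic numbers; integers that encode no pair give
    0. *)
Definition dyadic_seq (n : nat) : R :=
  let ik := odflt (0, 0)%N (unpickle n) in ik.2%:R / 2 ^+ ik.1.

Definition unit_seq (n : nat) : R := Num.min (dyadic_seq n) 1.

Lemma dyadic_seq_ge0 n : 0 <= dyadic_seq n.
Proof. by rewrite divr_ge0// exprn_ge0. Qed.

Lemma unit_seq_itv n : 0 <= unit_seq n <= 1.
Proof. by rewrite le_min dyadic_seq_ge0 ler01/= ge_min lexx orbT. Qed.

Lemma dyadic_seq_dense (t e : R) : 0 <= t -> 0 < e ->
  exists n, `|dyadic_seq n - t| < e.
Proof.
move=> t0 e0; have [j /andP[tj _]] := dyadic_scale t0.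
have [i [k [_ h]]] := dyadic_dense (introT andP (conj t0 tj)) e0.
exists (pickle (i, (k * 2 ^ j)%N)); rewrite /dyadic_seq pickleK/=.
by rewrite natrM natrX -mulrA.
Qed.

Lemma unit_seq_dense (t e : R) : 0 <= t <= 1 -> 0 < e ->
  exists n, `|unit_seq n - t| < e.
Proof.
move=> /andP[t0 t1] e0; have [n h] := dyadic_seq_dense t0 e0; exists n.
apply: le_lt_trans h; rewrite /unit_seq minElt; case: ifPn => //.
rewrite -leNgt => d1; rewrite ger0_norm ?subr_ge0//.
by rewrite (le_trans _ (ler_norm _))// lerD2r.
Qed.

(** Suprema of paths are compared through their upper bounds, which also settles
    the case where the supremum is infinite. *)
Lemma ubound_dense (f : R -> R) (D : set R) (s : nat -> R) :
  (forall n, D (s n)) ->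
  (forall t e, D t -> 0 < e -> exists n, `|f (s n) - f t| < e) ->
  ubound [set f t | t in D] = ubound (range (f \o s)).
Proof.
move=> Ds dense; apply/seteqP; split => M /= ub.
  by move=> _ [n _ <-]; apply: ub; exists (s n).
move=> _ [t Dt <-]; apply/ler_addgt0Pr => e e0.
have [n] := dense t e Dt e0; rewrite ltr_norml => /andP[h _].
have : f (s n) <= M by apply: ub; exists n.
lra.
Qed.

Lemma sup_ubound_eq (A B : set R) : A !=set0 -> B !=set0 ->
  ubound A = ubound B -> sup A = sup B.
Proof.
move=> A0 B0 AB; have [ubA|nubA] := pselect (has_ubound A); last first.
  rewrite !sup_out// => -[_] //; apply: contra_not nubA; rewrite /has_ubound AB//.
have ubB : has_ubound B by rewrite /has_ubound -AB.
apply/eqP; rewrite eq_le; apply/andP; split.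
  apply: ge_sup => //; rewrite -/(ubound A _) AB; exact: sup_upper_bound.
apply: ge_sup => //; rewrite -/(ubound B _) -AB; exact: sup_upper_bound.
Qed.

Lemma has_ubound_eq (A B : set R) : ubound A = ubound B ->
  has_ubound A = has_ubound B.
Proof. by rewrite /has_ubound => ->. Qed.

Lemma sup_scale (b : R) (A : set R) : 0 < b -> A !=set0 ->
  sup [set b * x | x in A] = b * sup A.
Proof.
move=> b0 A0; have bA0 : [set b * x | x in A] !=set0.
  by have [x Ax] := A0; exists (b * x); exists x.
have [ubA|nubA] := pselect (has_ubound A); last first.
  rewrite !sup_out ?mulr0// => -[_] //; apply: contra_not nubA => -[M h].
  by exists (M / b) => x Ax; rewrite ler_pdivlMr// mulrC; apply: h; exists x.
have ubbA : has_ubound [set b * x | x in A].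
  have [M h] := ubA; exists (b * M) => _ [x Ax <-]; rewrite ler_pM2l//; exact: h.
apply/eqP; rewrite eq_le; apply/andP; split.
  apply: ge_sup => // _ [x Ax <-]; rewrite ler_pM2l//; exact: ub_le_sup.
rewrite mulrC -ler_pdivlMr//; apply: ge_sup => // x Ax.
by rewrite ler_pdivlMr// mulrC; apply: ub_le_sup => //; exists x.
Qed.

End dense_sequences.

Section continuous_functions.
Variable R : realType.
Implicit Types f : R -> R.

Lemma segment_bounded f t : {within `[0, +oo[, continuous f} -> 0 <= t ->
  exists B, forall s, 0 <= s <= t -> `|f s| <= B.
Proof.
move=> /continuous_extension cf t0.
have cg : continuous (fun s : R => f (Num.max s 0) * f (Num.max s 0)).
  by move=> s; apply: cvgM; exact: cf.
have [s _ smax] := EVT_max t0 (continuous_subspaceT cg).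
exists (1 + f (Num.max s 0) * f (Num.max s 0)) => r /andP[r0 rt].
have := smax r; rewrite in_itv/= r0 rt (max_l r0) => /(_ isT) h.
rewrite ler_norml; have := sqr_ge0 (f r - 1); have := sqr_ge0 (f r + 1); nra.
Qed.

Lemma continuous_dense_values f (s : nat -> R) t e :
  {within `[0, +oo[, continuous f} -> (forall n, 0 <= s n) -> 0 <= t -> 0 < e ->
  (forall e', 0 < e' -> exists n, `|s n - t| < e') ->
  exists n, `|f (s n) - f t| < e.
Proof.
move=> /continuous_extension cf s0 t0 e0 dense.
have /cvgrPdist_lt/(_ e e0)/nbhs_ballP[eta /= eta0 near_t] := cf t.
have [n sn] := dense _ eta0; exists n.
have := near_t (s n); rewrite -ball_normE/= distrC => /(_ sn).
by rewrite !max_l// distrC.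
Qed.

Lemma continuous_affine_comb f (a b k : R) : {within `[0, +oo[, continuous f} ->
  {within `[0, +oo[, continuous (fun s => k + a * f s + b * s)}.
Proof.
move=> cf s; apply: cvgD; last first.
  apply: cvgM; [exact: cvg_cst|].
  exact: (continuous_subspaceT (fun x : R => @cvg_id _ (nbhs x))).
by apply: cvgD; [exact: cvg_cst|apply: cvgM; [exact: cvg_cst|exact: cf]].
Qed.

End continuous_functions.

Section joint_measurability.
Context d (T : measurableType d) (R : realType).

(** The process sampled at the points k / (n + 1) below t is a countable gluing of
    measurable rectangles, and it converges to the process by continuity. *)
Lemma measurable_continuous_process (f : R -> T -> R) :
  (forall t, 0 <= t -> measurable_fun setT (f t)) ->
  (forall w, {within `[0, +oo[, continuous (f^~ w)}) ->
  measurable_fun setT (fun z : measurableTypeR R * T => f (Num.max z.1 0) z.2).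
Proof.
move=> mf cf.
pose h n (t : R) : R := (Num.truncn (n.+1%:R * t))%:R / n.+1%:R.
have h0 n t : 0 <= h n t by rewrite divr_ge0.
apply: (@measurable_fun_cvg _ _ _ _ (fun n z => f (h n z.1) z.2)) => [n|z _].
  move=> _ B mB; rewrite setTI.
  have -> : (fun z : measurableTypeR R * T => f (h n z.1) z.2) @^-1` B =
     \bigcup_k ([set t : R | Num.truncn (n.+1%:R * t) = k] `*`
                ((f (k%:R / n.+1%:R)) @^-1` B)).
    apply/seteqP; split => [[t w] /= hB|[t w] /= [k _ [/= <-]]] //.
    by exists (Num.truncn (n.+1%:R * t)).
  apply: bigcupT_measurable => k; apply: measurableX; last first.
    by rewrite -[X in measurable X]setTI; apply: mf => //; rewrite divr_ge0.
  have mtr : measurable_fun [set: R] (fun t : R => (Num.truncn (n.+1%:R * t))%:R : R).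
    apply: nondecreasing_measurable => // x y xy.
    by rewrite ler_nat le_truncn// ler_wpM2l.
  have -> : [set t : R | Num.truncn (n.+1%:R * t) = k] =
      (fun t : R => (Num.truncn (n.+1%:R * t))%:R : R) @^-1` [set k%:R].
    apply/seteqP; split => t /=; first by move->.
    by move/eqP; rewrite eqr_nat => /eqP.
  by rewrite -[X in measurable X]setTI; exact: mtr.
have hz : h n z.1 @[n --> \oo] --> Num.max z.1 0.
  have [z0|z0] := lerP z.1 0.
    rewrite (_ : (fun n => _) = cst 0); first exact: cvg_cst.
    apply/funext => n; rewrite /h (_ : Num.truncn _ = 0%N) ?mul0r//.
    apply/eqP; rewrite -leqn0 -(truncn0 R) le_truncn//.
    by rewrite mulr_ge0_le0.
  apply: (@squeeze_cvgr _ _ _ _ (fun n => z.1 - harmonic n) (fun=> z.1)).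
  - apply: nearW => n; have n0 : (0 : R) < n.+1%:R by [].
    have /andP[a b] : (Num.truncn (n.+1%:R * z.1))%:R <= n.+1%:R * z.1 < (Num.truncn (n.+1%:R * z.1)).+1%:R.
      by apply: truncn_itv; rewrite mulr_ge0// ltW.
    rewrite /h/= ler_pdivrMr// [z.1 * _]mulrC a andbT ler_pdivlMr// mulrBl mulVf ?gt_eqF//.
    by rewrite lerBlDr natr1 mulrC ltW.
  - rewrite -[X in _ --> X]subr0; apply: cvgB; [exact: cvg_cst|exact: cvg_harmonic].
  - exact: cvg_cst.
have cx : continuous (fun t : R => f (Num.max t 0) z.2) by exact: continuous_extension (cf z.2).
have cz := cvg_comp _ _ hz (cx (Num.max z.1 0)).
rewrite max_l ?le_max ?lexx ?orbT// in cz.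
apply: cvg_trans cz; apply: near_eq_cvg; apply: nearW => n /=.
by rewrite max_l.
Qed.

End joint_measurability.

(** * The reflected process as a supremum *)

Section path_suprema.
Context d (T : measurableType d) (R : realType) (P : probability T R).
Variables (H : R) (W : R -> {RV P >-> R}).
Hypotheses (H_ge : 2^-1 <= H) (H_lt : H < 1) (fbmW : fractional_brownian_motion H W).
Variables (c u : R).

Let H_gt0 : 0 < H. Proof. by apply: lt_le_trans H_ge; rewrite invr_gt0. Qed.

Let cW w : {within `[0, +oo[, continuous ((fun t => W t w) : R -> R)}.
Proof. exact: (@fbm_continuous _ _ _ _ _ _ fbmW w). Qed.

Let D0 : set R := `[0, +oo[%classic.

Definition drifted_sup (D : set R) (w : T) : R :=
  sup [set c * W s w - u * s | s in D].

(** The queue started empty: by the reflection formula its content is the largest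
    increment of the netput over a final interval [s, t]. *)
Definition reflected (t : R) (w : T) : R :=
  sup [set c * (W t w - W s w) - u * (t - s) | s in `[0, t]].

Lemma path_bounded t w : 0 <= t -> exists B, forall s, 0 <= s <= t -> `|W s w| <= B.
Proof. by move=> t0; have [B h] := segment_bounded (@cW w) t0; exists B => s; exact: h. Qed.

Lemma unit_scaled_dense t s e : 0 <= s <= t -> 0 < e ->
  exists n, `|t * unit_seq R n - s| < e.
Proof.
move=> /andP[s0 st] e0; have [t0|t0] := ltrP 0 t; last first.
  have tE : t = 0 by apply/eqP; rewrite eq_le t0 (le_trans s0).
  exists 0%N; rewrite tE mul0r sub0r normrN ger0_norm//.
  by rewrite (le_lt_trans st)// tE.
have st01 : 0 <= s / t <= 1 by rewrite divr_ge0 ?(ltW t0)//= ler_pdivrMr// mul1r.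
have [n h] := unit_seq_dense st01 (divr_gt0 e0 t0); exists n.
have -> : t * unit_seq R n - s = t * (unit_seq R n - s / t).
  by rewrite mulrBr mulrCA mulfV ?mulr1// gt_eqF.
by rewrite normrM gtr0_norm// mulrC -ltr_pdivlMr.
Qed.

Let cdrift w : {within `[0, +oo[, continuous (fun s : R => 0 + c * W s w + (- u) * s)}.
Proof. exact (@continuous_affine_comb R _ c (- u) 0 (@cW w)). Qed.

Let cdriftE w s : c * W s w - u * s = 0 + c * W s w + (- u) * s.
Proof. by rewrite add0r mulNr. Qed.

Definition drifted_seq (s : nat -> R) n (w : T) : R := c * W (s n) w - u * s n.

Lemma drifted_sup_dense D s w : D `<=` D0 -> (forall n, D (s n)) ->
  (forall t e, D t -> 0 < e -> exists n, `|s n - t| < e) ->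
  ubound [set c * W s w - u * s | s in D] = ubound (range (drifted_seq s ^~ w)) /\
  drifted_sup D w = sup_seq (drifted_seq s) w.
Proof.
move=> DD0 Ds dense.
have ub : ubound [set c * W s w - u * s | s in D] = ubound (range (drifted_seq s ^~ w)).
  apply: ubound_dense => // t e Dt e0.
  have pos x : D x -> 0 <= x by move=> /DD0; rewrite /D0/= in_itv/= andbT.
  have sd e' : 0 < e' -> exists n, `|s n - t| < e' by move=> e'0; exact: dense.
  have [n h] := continuous_dense_values (@cdrift w) (fun n => pos _ (Ds n)) (pos _ Dt) e0 sd.
  by exists n; rewrite !cdriftE.
split => //; apply: sup_ubound_eq => //.
- by exists (c * W (s 0%N) w - u * s 0%N); exists (s 0%N).
- by exists (drifted_seq s 0%N w); exists 0%N.
Qed.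

Lemma measurable_drifted_seq s i : measurable_fun setT (drifted_seq s i).
Proof. by apply: measurable_funB => //; exact: measurable_funM. Qed.

Lemma drifted_sup_all w :
  ubound [set c * W s w - u * s | s in D0] =
    ubound (range (drifted_seq (@dyadic_seq R) ^~ w)) /\
  drifted_sup D0 w = sup_seq (drifted_seq (@dyadic_seq R)) w.
Proof.
apply: drifted_sup_dense => //.
- by move=> n; rewrite /D0/= in_itv/= andbT dyadic_seq_ge0.
- move=> t e; rewrite /D0/= in_itv/= andbT => t0; exact: dyadic_seq_dense.
Qed.

Lemma drifted_sup_finite t w : 0 <= t ->
  ubound [set c * W s w - u * s | s in `[0, t]] =
    ubound (range (drifted_seq (fun n => t * unit_seq R n) ^~ w)) /\
  drifted_sup `[0, t] w = sup_seq (drifted_seq (fun n => t * unit_seq R n)) w.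
Proof.
move=> t0; apply: drifted_sup_dense => //.
- by move=> s; rewrite /D0/= !in_itv/= andbT => /andP[].
- move=> n; rewrite /= in_itv/=; have /andP[r0 r1] := unit_seq_itv R n.
  by rewrite mulr_ge0//= ler_piMr.
- by move=> s e; rewrite /= in_itv/=; exact: unit_scaled_dense.
Qed.

(** The end point s of the increment is parametrized by the elapsed time t - s, so
    that time reversal turns it into drifted_seq term by term. *)
Definition reflected_seq t n (w : T) : R :=
  c * (W t w - W (t - t * unit_seq R n) w) - u * (t * unit_seq R n).

Lemma reflected_dense t w : 0 <= t ->
  ubound [set c * (W t w - W s w) - u * (t - s) | s in `[0, t]] =
    ubound (range (reflected_seq t ^~ w)) /\
  reflected t w = sup_seq (reflected_seq t) w.
Proof.
move=> t0; pose f s := c * (W t w - W s w) - u * (t - s).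
pose s n := t - t * unit_seq R n.
have sE : reflected_seq t ^~ w = f \o s.
  by apply/funext => n; rewrite /f /s /reflected_seq/= subKr.
have rt n : 0 <= t * unit_seq R n <= t.
  have /andP[r0 r1] := unit_seq_itv R n.
  by rewrite mulr_ge0//= ler_piMr.
have s0 n : 0 <= s n by have /andP[_] := rt n; rewrite subr_ge0.
have st n : s n <= t by have /andP[h _] := rt n; rewrite gerBl.
have cf : {within `[0, +oo[, continuous f}.
  have -> : f = fun s => (c * W t w - u * t) + (- c) * W s w + u * s.
    by apply/funext => r; rewrite /f; ring.
  exact (@continuous_affine_comb R _ (- c) u _ (@cW w)).
have ub : ubound [set f s | s in `[0, t]] = ubound (range (reflected_seq t ^~ w)).
  rewrite sE; apply: ubound_dense => [n|r e].
    by rewrite /= in_itv/= s0 st.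
  rewrite /= in_itv/= => /andP[r0 rlet] e0; apply: (continuous_dense_values cf) => // e' e'0.
  have tr : 0 <= t - r <= t by rewrite subr_ge0 rlet gerBl.
  have [n h] := unit_scaled_dense tr e'0; exists n; rewrite /s.
  by rewrite (_ : _ - r = - (t * unit_seq R n - (t - r))) ?normrN//; ring.
split => //; rewrite /reflected -/f; apply: sup_ubound_eq => //.
- by exists (f t); exists t => //=; rewrite in_itv/= t0 lexx.
- by exists (reflected_seq t 0%N w); exists 0%N.
Qed.

End path_suprema.

Section shifted_suprema.
Context d (T : measurableType d) (R : realType) (P : probability T R).

(** Equality in law of two Gaussian sequences passes to their suprema after
    subtraction of a common deterministic sequence, here the drift. *)
Lemma eq_law_sup_shift (X Y : nat -> T -> R) (b : nat -> R) :
  (forall i, measurable_fun setT (X i)) -> (forall i, measurable_fun setT (Y i)) ->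
  (forall n (a : 'I_n -> R),
    eq_law P (fun w => \sum_i a i * X i w) (fun w => \sum_i a i * Y i w)) ->
  {ae P, forall w, bounded_above (fun i w => Y i w - b i) w} ->
  {ae P, forall w, bounded_above (fun i w => X i w - b i) w} /\
  eq_law P (sup_seq (fun i w => X i w - b i)) (sup_seq (fun i w => Y i w - b i)).
Proof.
move=> mX mY XY bY; apply: eq_law_sup_seq => //.
- by move=> i; exact: measurable_funB.
- by move=> i; exact: measurable_funB.
move=> k; have E (Z : nat -> T -> R) :
    [set w | forall i, Z i w - b i <= k] = [set w | forall i, Z i w <= k + b i].
  by apply/seteqP; split => w /= hw i; have := hw i; rewrite lerBlDr.
by rewrite !E; exact: (cramer_wold_le mX mY XY (fun i => k + b i)).
Qed.

End shifted_suprema.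

Section queue_identities.
Context d (T : measurableType d) (R : realType) (P : probability T R).
Variables (H : R) (W : R -> {RV P >-> R}).
Hypotheses (H_ge : 2^-1 <= H) (H_lt : H < 1) (fbmW : fractional_brownian_motion H W).

Let H_gt0 : 0 < H. Proof. by apply: lt_le_trans H_ge; rewrite invr_gt0. Qed.

Lemma sup_shift (k : R) (A : set R) : has_sup A ->
  sup [set k + x | x in A] = k + sup A.
Proof.
move=> [A0 ubA]; have kA0 : [set k + x | x in A] !=set0.
  by have [x Ax] := A0; exists (k + x); exists x.
have ubkA : has_ubound [set k + x | x in A].
  by have [M h] := ubA; exists (k + M) => _ [x Ax <-]; rewrite lerD2l; exact: h.
apply/eqP; rewrite eq_le; apply/andP; split.
  by apply: ge_sup => // _ [x Ax <-]; rewrite lerD2l; exact: ub_le_sup.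
rewrite -lerBrDl; apply: ge_sup => // x Ax.
by rewrite lerBrDl; apply: ub_le_sup => //; exists x.
Qed.

Lemma drifted_bounded (c u t : R) w : 0 <= t -> exists B, forall s, 0 <= s <= t ->
  `|c * W s w - u * s| <= B.
Proof.
move=> t0; have [B hB] := path_bounded fbmW w t0.
exists (`|c| * B + `|u| * t) => s /andP[s0 st].
rewrite (le_trans (ler_normB _ _))// !normrM lerD// ler_wpM2l//.
  by apply: hB; rewrite s0.
by rewrite ger0_norm.
Qed.

Lemma has_ubound_drifted (c u t : R) w : 0 <= t ->
  has_ubound [set c * W s w - u * s | s in `[0, t]].
Proof.
move=> t0; have [B hB] := drifted_bounded c u w t0; exists B => y [s /=].
rewrite in_itv/= => st <-; exact: le_trans (ler_norm _) (hB _ st).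
Qed.

Lemma has_ubound_reflected (c u t : R) w : 0 <= t ->
  has_ubound [set c * (W t w - W s w) - u * (t - s) | s in `[0, t]].
Proof.
move=> t0; have [B hB] := drifted_bounded c u w t0; exists (B + B) => y [s /=].
rewrite in_itv/= => st <-.
have -> : c * (W t w - W s w) - u * (t - s) =
  (c * W t w - u * t) - (c * W s w - u * s) by ring.
rewrite (le_trans (ler_norm _))// (le_trans (ler_normB _ _))// lerD ?hB//.
by rewrite t0 lexx.
Qed.

Lemma reflected_ge0 (c u t : R) w : 0 <= t -> 0 <= reflected W c u t w.
Proof.
move=> t0; apply: ub_le_sup; first exact: has_ubound_reflected.
by exists t; rewrite /= ?in_itv/= ?t0 ?lexx// !subrr !mulr0 subrr.
Qed.

(** Lindley's identity: the queue started at x is the larger of the free netput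
    and the queue started empty. *)
Lemma queue_length_max (sigma : R -> R) (x u t : R) w : 0 <= t ->
  queue_length W sigma x u t w =
    Num.max (netput W sigma x u t w) (reflected W (sigma u) u t w).
Proof.
move=> t0; rewrite /queue_length /regulator.
set A := [set netput W sigma x u s w | s in `[0, t]].
have supA : has_sup [set - y | y in A].
  split; first by exists (- netput W sigma x u t w), (netput W sigma x u t w) => //; exists t => //=; rewrite in_itv/= t0 lexx.
  have [B hB] := drifted_bounded (sigma u) u w t0.
  exists (- x + B) => y [z [s /=]]; rewrite in_itv/= => st <- <-.
  have := hB _ st; rewrite ler_norml /netput => /andP[+ _]; lra.
have -> : reflected W (sigma u) u t w = netput W sigma x u t w - inf A.
  rewrite /inf opprK -sup_shift//; congr sup; apply/seteqP; split => y /=.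
    move=> [s st <-]; exists (- netput W sigma x u s w).
      by exists (netput W sigma x u s w) => //; exists s.
    by rewrite /netput; ring.
  by move=> [_ [_ [s st <-] <-] <-]; exists s => //; rewrite /netput; ring.
have [i0|i0] := leP 0 (inf A).
  by rewrite oppr0 addr0 max_l// gerBl.
by rewrite max_r// lerDl oppr_ge0 ltW.
Qed.

Lemma queue_length_ge0 sigma (x u t : R) w : 0 <= t ->
  0 <= queue_length W sigma x u t w.
Proof. by move=> t0; rewrite queue_length_max// le_max reflected_ge0 ?orbT. Qed.

Lemma measurable_reflected_seq (c u t : R) i :
  measurable_fun setT (reflected_seq W c u t i).
Proof.
by apply: measurable_funB => //; apply: measurable_funM => //; exact: measurable_funB.
Qed.

(** Time reversal: the increments over the intervals [t - s, t] have the joint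
    law of the values at the times s. *)
Lemma reflected_eq_law (c u t : R) : 0 <= t ->
  [/\ measurable_fun setT (reflected W c u t),
      measurable_fun setT (drifted_sup W c u `[0, t]) &
      eq_law P (reflected W c u t) (drifted_sup W c u `[0, t])].
Proof.
move=> t0; have mr := measurable_reflected_seq c u t.
have md := measurable_drifted_seq W c u (fun n => t * unit_seq R n).
have -> : reflected W c u t = sup_seq (reflected_seq W c u t).
  by apply/funext => w; have [_] := reflected_dense fbmW c u w t0.
have -> : drifted_sup W c u `[0, t] = sup_seq (drifted_seq W c u (fun n => t * unit_seq R n)).
  by apply/funext => w; have [_] := drifted_sup_finite fbmW c u w t0.
split; [exact: measurable_sup_seq|exact: measurable_sup_seq|].
have rt i : 0 <= t * unit_seq R i <= t.
  have /andP[r0 r1] := unit_seq_itv R i.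
  by rewrite mulr_ge0//= ler_piMr.
apply: (eq_law_sup_shift (X := fun i w => c * (W t w - W (t - t * unit_seq R i) w))
  (Y := fun i w => c * W (t * unit_seq R i) w) (b := fun i => u * (t * unit_seq R i)) _ _ _ _).2.
- by move=> i; apply: measurable_funM => //; exact: measurable_funB.
- by move=> i; exact: measurable_funM.
- exact: (fbm_reversal_eq_law H_gt0 fbmW c rt).
apply: aeW => w.
rewrite -[bounded_above _ w]/(has_ubound (range (drifted_seq W c u (fun n => t * unit_seq R n) ^~ w))).
rewrite (has_ubound_eq (esym (drifted_sup_finite fbmW c u w t0).1)).
exact: has_ubound_drifted.
Qed.

Lemma max_driftedE : max_drifted W 1 = drifted_sup W 1 1 `[0, +oo[.
Proof.
apply/funext => w; congr sup; apply/seteqP; split => _ /= [s s0 <-];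
  by exists s; rewrite // !mul1r.
Qed.

(** The dominating variable of order 1 is almost surely finite. *)
Lemma ae_bounded_drift : {ae P, forall w, has_ubound [set W s w - s | s in `[0, +oo[]}.
Proof.
have [D [mD D0 Dfin bnd]] := drift_moment H_ge H_lt fbmW 1.
have iD : P.-integrable setT D.
  apply/integrableP; split => //.
  rewrite (eq_integral D)// => w _; exact: gee0_abs.
have := integrable_ae measurableT iD.
apply: filterS => w /(_ I) Dw; exists (fine (D w)) => y [s /=].
rewrite in_itv/= andbT => s0 <-; have [sW|Ws] := leP s (W s w).
  by rewrite -lee_fin fineK//; exact: bnd.
by rewrite (le_trans (ltW _) (fine_ge0 (D0 w)))// subr_lt0.
Qed.

(** Self-similarity. With time scaled by a = (c / u) ^ (1 / (1 - H)) the noise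
    c * a ^ H and the drift u * a coincide, so the process c W s - u s becomes
    u * a times the process W s - s. *)
Lemma drifted_sup_eq_law (c u : R) : 0 < c -> 0 < u ->
  [/\ {ae P, forall w, has_ubound [set c * W s w - u * s | s in `[0, +oo[]},
      measurable_fun setT (drifted_sup W c u `[0, +oo[),
      measurable_fun setT (max_drifted W 1) &
      eq_law P (drifted_sup W c u `[0, +oo[)
        (fun w => u * (c / u) `^ (1 - H)^-1 * max_drifted W 1 w)].
Proof.
move=> c0 u0; have cu0 : 0 < c / u by rewrite divr_gt0.
have H1 : 1 - H != 0 by rewrite subr_eq0 gt_eqF.
set a := (c / u) `^ (1 - H)^-1; have a0 : 0 < a by rewrite powR_gt0.
have uaE : c * a `^ H = u * a.
  have : a `^ (1 - H) = c / u by rewrite /a -powRrM mulVf// powRr1// ltW.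
  move=> /(congr1 (fun y => u * y * a `^ H)); rewrite mulrCA mulfV ?gt_eqF// mulr1 => <-.
  by rewrite -mulrA -powRD ?subrK ?powRr1 ?(ltW a0)// gt_eqF// implybT.
have ua0 : 0 < u * a by rewrite mulr_gt0.
have q0 i : 0 <= dyadic_seq R i by exact: dyadic_seq_ge0.
have aq_dense t e : 0 <= t -> 0 < e -> exists n, `|a * dyadic_seq R n - t| < e.
  move=> t0 e0; have [n h] := dyadic_seq_dense (divr_ge0 t0 (ltW a0)) (divr_gt0 e0 a0).
  exists n; have -> : a * dyadic_seq R n - t = a * (dyadic_seq R n - t / a).
    by rewrite mulrBr (mulrC t) mulVKf// gt_eqF.
  by rewrite normrM gtr0_norm// mulrC -ltr_pdivlMr.
have aq0 i : 0 <= a * dyadic_seq R i by rewrite mulr_ge0// ltW.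
have dE w : ubound [set c * W s w - u * s | s in `[0, +oo[] =
      ubound (range (drifted_seq W c u (fun n => a * dyadic_seq R n) ^~ w)) /\
    drifted_sup W c u `[0, +oo[ w = sup_seq (drifted_seq W c u (fun n => a * dyadic_seq R n)) w.
  apply: (drifted_sup_dense fbmW) => // [n|t e].
    by rewrite /= in_itv/= andbT.
  by rewrite /= in_itv/= andbT; exact: aq_dense.
pose Y i w := c * a `^ H * W (dyadic_seq R i) w - u * (a * dyadic_seq R i).
have YE w : range (Y ^~ w) =
    [set u * a * y | y in range (drifted_seq W 1 1 (@dyadic_seq R) ^~ w)].
  have YiE i : Y i w = u * a * drifted_seq W 1 1 (@dyadic_seq R) i w.
    by rewrite /Y /drifted_seq uaE; ring.
  apply/seteqP; split => y /=.
    by move=> [i _ <-]; exists (drifted_seq W 1 1 (@dyadic_seq R) i w) => //; exists i.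
  by move=> [_ [i _ <-] <-]; exists i.
have supY : sup_seq Y = fun w => u * a * max_drifted W 1 w.
  apply/funext => w; rewrite /sup_seq YE sup_scale//; last first.
    by exists (drifted_seq W 1 1 (@dyadic_seq R) 0%N w); exists 0%N.
  by rewrite max_driftedE (drifted_sup_all fbmW 1 1 w).2.
have bY : {ae P, forall w, bounded_above Y w}.
  apply: filterS ae_bounded_drift => w [M hM]; rewrite /bounded_above/= YE.
  exists (u * a * M) => _ [_ [i _ <-] <-]; rewrite ler_pM2l//; apply: hM.
  exists (dyadic_seq R i); first by rewrite /= in_itv/= andbT.
  by rewrite /drifted_seq !mul1r.
have mX i : measurable_fun setT (fun w => c * W (a * dyadic_seq R i) w).
  exact: measurable_funM.
have mY i : measurable_fun setT (fun w => c * a `^ H * W (dyadic_seq R i) w).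
  exact: measurable_funM.
have [bX lawX] := eq_law_sup_shift (b := fun i => u * (a * dyadic_seq R i)) mX mY
  (fbm_scaling_eq_law fbmW c a0 q0) bY.
have supE : drifted_sup W c u `[0, +oo[ = sup_seq (drifted_seq W c u (fun n => a * dyadic_seq R n)).
  by apply/funext => w; exact: (dE w).2.
split.
- by apply: filterS bX => w bw; rewrite (has_ubound_eq (dE w).1); exact: bw.
- by rewrite supE; apply: measurable_sup_seq => i; exact: measurable_drifted_seq.
- have -> : max_drifted W 1 = sup_seq (drifted_seq W 1 1 (@dyadic_seq R)).
    by rewrite max_driftedE; apply/funext => w; exact: (drifted_sup_all fbmW 1 1 w).2.
  by apply: measurable_sup_seq => i; exact: measurable_drifted_seq.
- by rewrite supE -supY; exact: lawX.
Qed.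

End queue_identities.

(** * Expected cost of a scaled variable *)

Section polynomial_growth.
Variable R : realType.

(** Integer powers are enough for integrability, and they are easier to
    dominate. *)
Lemma powR_le_exprn (K gamma : R) (C : R -> R) : 0 < K -> 0 < gamma ->
  (forall y, 0 <= y -> C y <= K * (1 + y `^ gamma)) ->
  exists q, forall y, 0 <= y -> C y <= 2 * K * (1 + y ^+ q).
Proof.
move=> K0 g0 bound; exists (Num.truncn gamma).+1 => y y0.
rewrite (le_trans (bound y y0))// (mulrC 2) -mulrA ler_wpM2l ?(ltW K0)//.
have q0 : 0 <= y ^+ (Num.truncn gamma).+1 by rewrite exprn_ge0.
suff : y `^ gamma <= 1 + y ^+ (Num.truncn gamma).+1 by lra.
have [y1|y1] := leP y 1.
  have h1 : (1 : R) `^ gamma = 1 by rewrite powR1.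
  rewrite (@le_trans _ _ 1) ?lerDl// -[leRHS]h1.
  by rewrite ge0_ler_powR ?nnegrE// ltW.
rewrite (@le_trans _ _ (y ^+ (Num.truncn gamma).+1)) ?lerDr//.
rewrite -powR_mulrn// ler_powR ?(ltW y1)//.
exact/ltW/truncnS_gt.
Qed.

End polynomial_growth.

Section cost_of_scaled_variable.
Context d (T : measurableType d) (R : realType) (P : probability T R).
Variables (C : R -> R) (K' : R) (q : nat).
Hypotheses (C_ge0 : forall y : R, 0 <= y -> 0 <= C y)
  (C_cont : {within `[0, +oo[, continuous C})
  (C_nd : {in `[0, +oo[ &, {homo C : x y / x <= y}})
  (C_bound : forall y, 0 <= y -> C y <= K' * (1 + y ^+ q)).

Let Ce (y : R) : R := C (Num.max y 0).

Lemma cost_le x y : 0 <= x -> x <= y -> C x <= C y.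
Proof.
move=> x0 xy; apply: C_nd => //; rewrite in_itv/= andbT//.
exact: le_trans xy.
Qed.

Lemma measurable_extended_cost : measurable_fun [set: R] Ce.
Proof. by apply: continuous_measurable_fun; exact (continuous_extension C_cont). Qed.

Lemma measurable_cost d' (T' : measurableType d') (X : T' -> R) :
  measurable_fun setT X ->
  (forall w, 0 <= X w) -> measurable_fun setT (fun w => C (X w)).
Proof.
move=> mX X0; rewrite (_ : (fun w => C (X w)) = Ce \o X).
  exact: measurableT_comp measurable_extended_cost mX.
by apply/funext => w; rewrite /Ce/= max_l.
Qed.

Let K'_ge0 : 0 <= K'.
Proof.
have h0 : 0 <= (1 + 0 ^+ q : R) by rewrite addr_ge0// exprn_ge0.
have h1 : 0 < (1 + 0 ^+ q : R) by rewrite ltr_wpDr// exprn_ge0.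
rewrite -(pmulr_lge0 _ h1); exact: le_trans (C_ge0 (lexx 0)) (C_bound (lexx 0)).
Qed.

Lemma cost_integrable (X : T -> R) : measurable_fun setT X ->
  (forall w, 0 <= X w) -> (\int[P]_w (X w ^+ q)%:E < +oo)%E ->
  P.-integrable setT (fun w => (C (X w))%:E).
Proof.
move=> mX X0 fin.
have iq : P.-integrable setT (fun w => (X w ^+ q)%:E).
  apply/integrableP; split; first by apply/measurable_EFinP; exact: measurable_funX.
  by under eq_integral do rewrite gee0_abs ?lee_fin ?exprn_ge0//.
apply: (@le_integrable _ _ _ P setT measurableT _
    (fun w => K'%:E * (1 + (X w ^+ q)%:E))%E).
- by apply/measurable_EFinP; exact: measurable_cost.
- move=> w _; rewrite -EFinD -EFinM !abse_EFin lee_fin ger0_norm ?C_ge0//.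
  by rewrite (le_trans (C_bound (X0 w)))// ler_norm.
- apply: integrableZl => //; apply: integrableD => //.
  exact: finite_measure_integrable_cst.
Qed.

Variable Z : T -> R.
Hypotheses (mZ : measurable_fun setT Z) (Z_ge0 : forall w, 0 <= Z w)
  (Z_mom : forall n, (\int[P]_w (Z w ^+ n)%:E < +oo)%E).

(** All the costs of the problem have this form with Z the maximum of W s - s:
    the drift enters only through the scale b. *)
Definition scaled_cost (b : R) : \bar R := (\int[P]_w (C (b * Z w))%:E)%E.

Lemma scaled_cost_integrable b : 0 <= b ->
  P.-integrable setT (fun w => (C (b * Z w))%:E).
Proof.
move=> b0; apply: cost_integrable.
- exact: measurable_funM.
- by move=> w; rewrite mulr_ge0.
- under eq_integral do rewrite exprMn EFinM.
  have bq0 : 0 <= b ^+ q by rewrite exprn_ge0.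
  rewrite (@ge0_integralZl_EFin _ _ _ P _ measurableT (fun w => (Z w ^+ q)%:E) _ _ _ bq0).
  + by rewrite lte_mul_pinfty ?lee_fin//.
  + by move=> w _; rewrite lee_fin exprn_ge0.
  + by apply/measurable_EFinP; exact: measurable_funX.
Qed.

Lemma scaled_cost_fin b : 0 <= b -> scaled_cost b \is a fin_num.
Proof. by move=> b0; apply: integrable_fin_num => //; exact: scaled_cost_integrable. Qed.

Lemma scaled_cost_le b b' : 0 <= b -> b <= b' -> (scaled_cost b <= scaled_cost b')%E.
Proof.
move=> b0 bb'; have b'0 := le_trans b0 bb'.
apply: le_integral => //; [exact: scaled_cost_integrable|exact: scaled_cost_integrable|].
move=> w _; rewrite lee_fin; apply: cost_le; first by rewrite mulr_ge0.
exact: ler_wpM2r.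
Qed.

Lemma scaled_cost_ge0 b : 0 <= b -> (0 <= scaled_cost b)%E.
Proof. by move=> b0; apply: integral_ge0 => w _; rewrite lee_fin C_ge0// mulr_ge0. Qed.

(** Continuity under the integral, dominated on ]0, b + 1[ by the cost at scale
    b + 1. *)
Lemma scaled_cost_continuous b : 0 < b -> {for b, continuous (fun b => fine (scaled_cost b))}.
Proof.
move=> b0.
have := @continuity_under_integral R _ T P (fun b w => C (b * Z w)) setT measurableT 0 (b + 1).
move=> /(_ _ _ (fun w => C ((b + 1) * Z w)) _ _ b); apply.
- move=> x /=; rewrite in_itv/= => /andP[x0 _]; exact/scaled_cost_integrable/ltW.
- apply: aeW => w _ x; rewrite inE/= in_itv/= => /andP[x0 _].
  have cC : continuous Ce by exact (continuous_extension C_cont).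
  have cx : continuous (fun y : R => Ce (y * Z w)).
    move=> y; apply: (cvg_comp (fun y : R => y * Z w) Ce); last exact: cC.
    by apply: cvgM; [exact: cvg_id|exact: cvg_cst].
  have := cx x; rewrite /continuous_at /Ce max_l ?mulr_ge0 ?(ltW x0)//.
  apply: cvg_trans; apply: near_eq_cvg; near=> y.
  rewrite max_l// mulr_ge0//; near: y.
  exact: (cvgr_ge x).
- exact/scaled_cost_integrable/addr_ge0/ler01/ltW.
- move=> x /=; rewrite in_itv/= => /andP[x0 xb]; apply: aeW => w _.
  rewrite ger0_norm ?C_ge0 ?mulr_ge0 ?(ltW x0)//.
  by apply: cost_le; rewrite ?mulr_ge0 ?ler_wpM2r ?(ltW x0) ?(ltW xb).
- by rewrite inE/= in_itv/= b0 ltrDl ltr01.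
Unshelve. all: by end_near. Qed.

(** On the event Z > 1, of positive probability, C (b Z) is at least C b. *)
Lemma scaled_cost_cvgy : C y @[y --> +oo] --> +oo -> (0 < P [set w | (1 < Z w)%R])%E ->
  forall A : R, exists2 B : R, 0 < B & forall b, B <= b -> (A%:E <= scaled_cost b)%E.
Proof.
move=> C_oo PZ A; pose E : set T := [set w | 1 < Z w]; set pz := P E in PZ.
have mZ1 : measurable E.
  have -> : E = Z @^-1` `]1, +oo[%classic.
    by apply/seteqP; split => w /=; rewrite in_itv/= andbT.
  by rewrite -[X in measurable X]setTI; exact: mZ.
have pzfin : pz \is a fin_num by exact: fin_num_measure.
have pz0 : 0 < fine pz by rewrite fine_gt0// PZ ltey_eq pzfin.
have /cvgryPge/(_ (A / fine pz)) [M [_ hM]] := C_oo.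
pose B := Num.max M 0 + 1; have B0 : 0 < B by rewrite ltr_wpDl// le_max lexx orbT.
have CB : A / fine pz <= C B by apply: hM; rewrite /B ltr_pwDr// le_max lexx.
exists B => // b Bb; rewrite ler_pdivrMr// in CB.
have b0 : 0 <= b by rewrite (le_trans _ Bb)// ltW.
apply: (@le_trans _ _ (\int[P]_(w in E) (C B)%:E)%E).
  by rewrite integral_cst// -[X in (_ <= _ * X)%E](fineK pzfin) -EFinM lee_fin.
apply: (@le_trans _ _ (\int[P]_(w in E) (C (b * Z w))%:E)%E).
  have mC := measurable_int _ (scaled_cost_integrable b0).
  apply: ge0_le_integral => //.
  - by move=> w _; rewrite lee_fin C_ge0// ltW.
  - exact: measurable_funTS.
  - move=> w; rewrite /E/= => Zw; rewrite lee_fin; apply: cost_le; first exact: ltW.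
    by rewrite (le_trans Bb)// ler_peMr// ltW.
apply: ge0_subset_integral => //; first exact: measurable_int (scaled_cost_integrable b0).
by move=> w _; rewrite lee_fin C_ge0// mulr_ge0.
Qed.

Lemma scaled_cost_midpoint b b' :
  (forall x y, 0 <= x -> 0 <= y -> C ((x + y) / 2) <= (C x + C y) / 2) ->
  0 <= b -> 0 <= b' ->
  fine (scaled_cost ((b + b') / 2)) <= (fine (scaled_cost b) + fine (scaled_cost b')) / 2.
Proof.
move=> cC b0 b'0; have m0 : 0 <= (b + b') / 2 by rewrite divr_ge0// addr_ge0.
rewrite ler_pdivlMr// mulrC -lee_fin EFinM [leRHS]EFinD !fineK ?scaled_cost_fin//.
have ib := scaled_cost_integrable b0; have ib' := scaled_cost_integrable b'0.
have im := scaled_cost_integrable m0.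
rewrite /scaled_cost -(integralZl measurableT im) -(integralD measurableT ib ib').
apply: le_integral => //; [exact: integrableZl|exact: integrableD|].
move=> w _; rewrite -EFinM -EFinD lee_fin mulrC -ler_pdivlMr//.
have -> : (b + b') / 2 * Z w = (b * Z w + b' * Z w) / 2 by ring.
by apply: cC; rewrite mulr_ge0.
Qed.

(** On the event b Z > y2, of positive probability, the cost increases strictly; a
    nonnegative function with zero integral vanishes almost everywhere. *)
Lemma scaled_cost_lt b b' y2 :
  (forall x y, 0 <= x -> 0 <= y -> y2 <= x -> x < y -> C x < C y) ->
  0 <= y2 -> (0 < P [set w | (y2 / b < Z w)%R])%E ->
  0 < b -> b < b' -> fine (scaled_cost b) < fine (scaled_cost b').
Proof.
move=> strict y20 PZ b0 bb'; have b'0 : 0 < b' := lt_trans b0 bb'.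
have ib := scaled_cost_integrable (ltW b0); have ib' := scaled_cost_integrable (ltW b'0).
rewrite lt_neqAle fine_le ?scaled_cost_fin ?(ltW b0) ?(ltW b'0)//; last first.
  by apply: scaled_cost_le; exact: ltW.
rewrite andbT; apply/negP => /eqP E.
pose f w := ((C (b' * Z w))%:E - (C (b * Z w))%:E)%E.
have f0 w : (0 <= f w)%E.
  rewrite /f -EFinB lee_fin subr_ge0 cost_le ?mulr_ge0 ?(ltW b0)//.
  by rewrite ler_wpM2r// ltW.
have intf0 : (\int[P]_w `|f w| = 0)%E.
  under eq_integral do rewrite (gee0_abs (f0 _)).
  transitivity (scaled_cost b' - scaled_cost b)%E; first exact: integralB.
  rewrite (_ : scaled_cost b = scaled_cost b') ?subee ?scaled_cost_fin ?(ltW b'0)//.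
  by rewrite -(fineK (scaled_cost_fin (ltW b0))) E fineK// scaled_cost_fin// ltW.
have mf : measurable_fun setT f.
  by apply: emeasurable_funB; [exact: measurable_int ib'|exact: measurable_int ib].
have [N [mN N0 sN]] := (ae_eq_integral_abs P measurableT mf).1 intf0.
move: PZ; apply/negP; rewrite -leNgt -N0; apply: le_measure; rewrite ?inE//.
  have -> : [set w | y2 / b < Z w] = Z @^-1` `]y2 / b, +oo[%classic.
    by apply/seteqP; split => w /=; rewrite in_itv/= andbT.
  by rewrite -[X in measurable X]setTI; exact: mZ.
move=> w /= Zw; apply: sN => /= /(_ I); rewrite /f -EFinB => -[] /eqP.
rewrite subr_eq0 => /eqP.
have Z0 : 0 < Z w by apply: le_lt_trans Zw; rewrite divr_ge0// ltW.
apply/eqP; rewrite gt_eqF//; apply: strict.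
- by rewrite mulr_ge0// ltW.
- by rewrite mulr_ge0// ltW.
- by rewrite mulrC -ler_pdivrMr// ltW.
- by rewrite ltr_pM2r.
Qed.

End cost_of_scaled_variable.

(** * The stationary maximum and its scaling *)

Section stationary_cost.
Context d (T : measurableType d) (R : realType) (P : probability T R).
Variables (H : R) (W : R -> {RV P >-> R}).
Hypotheses (H_ge : 2^-1 <= H) (H_lt : H < 1) (fbmW : fractional_brownian_motion H W).

Let H_gt0 : 0 < H. Proof. by apply: lt_le_trans H_ge; rewrite invr_gt0. Qed.

Local Notation Z := (max_drifted W 1).

Lemma drifted_sup_ge0 (c u : R) (D : set R) w : D 0 -> 0 <= drifted_sup W c u D w.
Proof.
move=> D0; have [ub|nub] := pselect (has_ubound [set c * W s w - u * s | s in D]); last first.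
  by rewrite /drifted_sup sup_out// => -[].
apply: ub_le_sup => //; exists 0 => //.
by rewrite (fbm_start fbmW) !mulr0 subrr.
Qed.

Lemma max_drifted1_ge0 w : 0 <= Z w.
Proof. by rewrite max_driftedE drifted_sup_ge0//= in_itv/= lexx. Qed.

Lemma measurable_max_drifted1 : measurable_fun setT Z.
Proof. by have [] := drifted_sup_eq_law H_ge H_lt fbmW ltr01 ltr01. Qed.

Lemma max_drifted1_moment n : (\int[P]_w (Z w ^+ n)%:E < +oo)%E.
Proof.
case: n => [|n].
  by under eq_integral do rewrite expr0; rewrite integral_cst//= probability_setT mule1 ltry.
have [D [mD D0 Dfin bnd]] := drift_moment H_ge H_lt fbmW n.+1.
apply: le_lt_trans Dfin; apply: ge0_le_integral => //.
- by move=> w _; rewrite lee_fin exprn_ge0// max_drifted1_ge0.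
- apply/measurable_EFinP; apply: measurable_funX; exact: measurable_max_drifted1.
move=> w _; have [->|Dy] := eqVneq (D w) +oo%E; first exact: leey.
have DE : D w = (fine (D w))%:E by rewrite fineK// ge0_fin_numE// ltey.
have M0 : 0 <= fine (D w) by rewrite fine_ge0.
rewrite DE lee_fin; set M := fine (D w) in DE M0 *.
pose r := M `^ (n.+1%:R^-1).
have r0 : 0 <= r by exact: powR_ge0.
have rE : r ^+ n.+1 = M by rewrite -powR_mulrn// -powRrM mulVf ?powRr1// pnatr_eq0.
rewrite -rE lerXn2r ?nnegrE ?max_drifted1_ge0//.
apply: ge_sup; first by exists (W 0 w - 1 * 0), 0; rewrite //= in_itv/= lexx.
move=> y [s /=]; rewrite in_itv/= andbT mul1r => s0 <-.
have [sW|Ws] := leP s (W s w); last by rewrite (le_trans _ r0)// subr_le0 ltW.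
rewrite -(ler_pXn2r (ltn0Sn n)) ?nnegrE ?subr_ge0// rE -lee_fin -DE; exact: bnd.
Qed.

(** Already the value W 1 - 1 is an unbounded Gaussian variable. *)
Lemma max_drifted1_tail (y : R) : (0 < P [set w | (y < Z w)%R])%E.
Proof.
have W1 := fbm_marginal H_gt0 fbmW (ler01 : 0 <= 1 :> R).
have := centered_gaussian_tail_gt0 (y + 1) W1; rewrite powR_gt0// => /(_ isT) /lt_le_trans; apply.
have mlt (X : T -> R) c : measurable_fun setT X -> measurable [set w | c < X w].
  move=> mX; have -> : [set w | c < X w] = X @^-1` `]c, +oo[%classic.
    by apply/seteqP; split => w /=; rewrite in_itv/= andbT.
  by rewrite -[X in measurable X]setTI; exact: mX.
have [N [mN N0 sN]] := ae_bounded_drift H_ge H_lt fbmW.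
have mA := mlt (W 1) (y + 1) (measurable_funPT _).
have mB := mlt Z y measurable_max_drifted1.
apply: (@le_trans _ _ (P ([set w | y < Z w] `|` N))); last first.
  by apply: (le_trans (measureU2 _ mB mN)); rewrite [X in (_ + X)%E]N0 adde0.
apply: le_measure; rewrite ?inE//; first exact: measurableU.
move=> w /= yW; have [Nw|nNw] := pselect (N w); [by right|left].
have ub : has_ubound [set W s w - s | s in `[0, +oo[].
  by apply: contra_notP nNw => /sN.
rewrite max_driftedE; apply: (@lt_le_trans _ _ (1 * W 1 w - 1 * 1)).
  by rewrite !mul1r ltrBrDr.
apply: ub_le_sup; last by exists 1; rewrite //= in_itv/= ler01.
by have [M hM] := ub; exists M => z [s s0 <-]; apply: hM; exists s => //; rewrite !mul1r.
Qed.

(** The maximum of c W s - u s has the law of this multiple of the maximum of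
    W s - s. *)
Definition drift_scale (c u : R) : R := u * (c / u) `^ (1 - H)^-1.

Lemma drift_scale_gt0 c u : 0 < c -> 0 < u -> 0 < drift_scale c u.
Proof. by move=> c0 u0; rewrite mulr_gt0// powR_gt0// divr_gt0. Qed.

(** The maximum of W s - v s has the law of v ^ (- H / (1 - H)) times that of
    W s - s. *)
Definition hurst_exponent : R := H / (1 - H).

Lemma hurst_exponent_gt0 : 0 < hurst_exponent.
Proof. by rewrite divr_gt0// subr_gt0. Qed.

Lemma drift_scale1 v : 0 < v -> drift_scale 1 v = v `^ (- hurst_exponent).
Proof.
move=> v0; rewrite /drift_scale div1r.
have -> : v^-1 `^ (1 - H)^-1 = v `^ (- (1 - H)^-1).
  by rewrite -(powR_inv1 (ltW v0)) -powRrM mulN1r.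
rewrite -[X in X * _](powRr1 (ltW v0)) -powRD; last by rewrite (gt_eqF v0) implybT.
congr powR; rewrite /hurst_exponent; field.
by rewrite subr_eq0 gt_eqF.
Qed.

(** Noise intensity and drift enter the stationary law only through the effective
    drift u / sigma u ^ (1 / H). *)
Lemma drift_scale_effective (sigma : R -> R) u : 0 < sigma u -> 0 < u ->
  0 < effective_drift sigma H u /\
  drift_scale (sigma u) u = effective_drift sigma H u `^ (- hurst_exponent).
Proof.
move=> s0 u0; have sH : 0 < sigma u `^ H^-1 by rewrite powR_gt0.
have f0 : 0 < effective_drift sigma H u by rewrite divr_gt0.
split => //; rewrite -drift_scale1// /drift_scale /effective_drift.
have H1 : 1 - H != 0 by rewrite subr_eq0 gt_eqF.
have key : sigma u `^ (1 - H)^-1 =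
    (sigma u `^ H^-1)^-1 * (sigma u `^ H^-1) `^ (1 - H)^-1.
  rewrite -powRrM -powRN -powRD; last by rewrite (gt_eqF s0) implybT.
  congr powR; field.
  by rewrite H1 gt_eqF.
rewrite div1r invf_div.
rewrite (powRM _ (ltW s0)) ?invr_ge0 ?(ltW u0)// (powRM _ (ltW sH)) ?invr_ge0 ?(ltW u0)//.
by rewrite key; ring.
Qed.

Section cost.
Variable (C : R -> R).
Hypothesis (C_ge0 : forall y : R, 0 <= y -> 0 <= C y)
  (C_cont : {within `[0, +oo[, continuous C}).

Lemma eq_law_cost (X Y : T -> R) :
  measurable_fun setT X -> measurable_fun setT Y ->
  (forall w, 0 <= X w) -> (forall w, 0 <= Y w) -> eq_law P X Y ->
  (\int[P]_w (C (X w))%:E = \int[P]_w (C (Y w))%:E)%E.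
Proof.
move=> mX mY X0 Y0 XY.
have mC := measurable_extended_cost C_cont.
have := @eq_law_integral _ _ _ P X Y (fun y => (C (Num.max y 0))%:E) mX mY XY.
move=> /(_ ((measurable_EFinP _ _).2 mC)) h.
under eq_integral do rewrite -[X _](max_l (X0 _)).
under [RHS]eq_integral do rewrite -[Y _](max_l (Y0 _)).
by apply: h => y; rewrite lee_fin C_ge0// le_max lexx orbT.
Qed.

Lemma cost_drifted_sup c u : 0 < c -> 0 < u ->
  (\int[P]_w (C (drifted_sup W c u `[0, +oo[ w))%:E =
   scaled_cost P C Z (drift_scale c u))%E.
Proof.
move=> c0 u0; have [_ mM mZ law] := drifted_sup_eq_law H_ge H_lt fbmW c0 u0.
apply: eq_law_cost => //.
- exact: measurable_funM.
- by move=> w; rewrite drifted_sup_ge0//= in_itv/= lexx.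
- by move=> w; rewrite mulr_ge0 ?max_drifted1_ge0// ltW// drift_scale_gt0.
Qed.

Lemma mean_costE v : 0 < v -> mean_cost W C v = scaled_cost P C Z (v `^ (- hurst_exponent)).
Proof.
move=> v0; rewrite -drift_scale1// -(cost_drifted_sup ltr01 v0) /mean_cost unlock.
apply: eq_integral => w _; congr (C _)%:E; congr sup; apply/seteqP; split => y /= [s s0 <-];
  by exists s; rewrite // mul1r.
Qed.

End cost.

End stationary_cost.

(** * Limits superior and time averages *)

Section long_time_averages.
Variable R : realType.
Local Notation mu := (@lebesgue_measure R).

Lemma limf_esup_pinfty (F : R -> \bar R) (l : R) :
  (forall e, 0 < e -> exists A, forall t, A <= t ->
    ((l - e)%:E <= F t <= (l + e)%:E)%E) ->
  limf_esup F (pinfty_nbhs R) = l%:E.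
Proof.
move=> h; apply/eqP; rewrite eq_le; apply/andP; split.
  apply/lee_addgt0Pr => e e0; have [A hA] := h e e0.
  apply: (@le_trans _ _ (ereal_sup [set F t | t in [set t | A <= t]])).
    apply: ereal_inf_lbound; exists [set t | A <= t] => //.
    by exists A; split; [exact: num_real|move=> t /ltW].
  by apply: ge_ereal_sup => _ [t /= At <-]; have /andP[_] := hA t At.
apply/lee_subgt0Pr => e e0; have [A hA] := h e e0.
apply: le_ereal_inf_tmp => _ [V [B [_ hB]] <-].
pose t := Num.max A B + 1.
have At : A <= t by rewrite /t ler_wpDr// le_max lexx.
have Vt : V t by apply: hB; rewrite ltr_pwDr// le_max lexx orbT.
apply: le_trans (ereal_sup_ubound _); last by exists t.
by have /andP[+ _] := hA t At.
Qed.

(** The integral up to A, where g is only bounded by B, is at most A * B, which is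
    negligible against tau. *)
Lemma cesaro_mean (g : R -> \bar R) (G B : R) :
  measurable_fun [set: R] g -> (forall t, 0 <= g t)%E -> 0 <= G -> 0 <= B ->
  (forall t, (0 <= t)%R -> (g t <= B%:E)%E) ->
  (forall e, 0 < e -> exists A, forall t, A <= t ->
    ((G - e)%:E <= g t <= (G + e)%:E)%E) ->
  forall e, 0 < e -> exists A, forall tau, A <= tau ->
    ((tau * (G - e))%:E <= \int[mu]_(t in `[0%R, tau]) g t <= (tau * (G + e))%:E)%E.
Proof.
move=> mg g0 G0 B0 gB gG e e0.
have e20 : 0 < e / 2 by rewrite divr_gt0.
have [A1 hA1] := gG _ e20; pose A := Num.max A1 0.
have A0 : 0 <= A by rewrite le_max lexx orbT.
have hA t : A <= t -> ((G - e / 2)%:E <= g t <= (G + e / 2)%:E)%E.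
  by move=> At; apply: hA1; apply: le_trans At; rewrite le_max lexx.
exists (Num.max 1 (Num.max A (2 * A * (G + B) / e))) => tau.
rewrite ge_max => /andP[tau1]; rewrite ge_max => /andP[Atau tauL].
have tau0 : 0 <= tau by rewrite (le_trans _ tau1).
have tau_e : A * (G + B) <= tau * (e / 2).
  by move: tauL; rewrite ler_pdivrMr// => tauL; lra.
have AG : 0 <= A * G by rewrite mulr_ge0.
have AB : 0 <= A * B by rewrite mulr_ge0.
apply/andP; split.
  (* clipping at 0 makes the lower bound integrable as a nonnegative function *)
  pose L := Num.max (G - e / 2) 0; have L0 : 0 <= L by rewrite le_max lexx orbT.
  apply: (@le_trans _ _ (\int[mu]_(t in `[A, tau]) L%:E)%E).
    rewrite integral_cst//= lebesgue_measure_itv/= lte_fin; have [lt|ge] := ltP A tau.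
      rewrite -EFinB -EFinM lee_fin /L.
      by have [h|h] := lerP (G - e / 2) 0; nra.
    have E : A = tau by apply/eqP; rewrite eq_le Atau.
    rewrite mule0 lee_fin; move: tau_e AB AG tau1; rewrite E => *; nra.
  apply: (@le_trans _ _ (\int[mu]_(t in `[A, tau]) g t)%E).
    apply: ge0_le_integral => //.
    - exact: measurable_funTS.
    - move=> t; rewrite /= in_itv/= => /andP[At _]; rewrite /L.
      by have /andP[h _] := hA t At; have [_|_] := lerP (G - e / 2) 0; [exact: g0|].
  apply: ge0_subset_integral => //; first exact: measurable_funTS.
  by move=> t; rewrite /= !in_itv/= => /andP[At ->]; rewrite (le_trans A0).
apply: (@le_trans _ _ (\int[mu]_(t in `[0%R, tau]) ((G + e / 2)%:E + B%:E * (\1_(`[0%R, A]%classic) t)%:E))%E).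
  apply: ge0_le_integral => //.
  - exact: measurable_funTS.
  - apply/measurable_funTS/measurable_EFinP; apply: measurable_funD => //.
    apply: measurable_funM => //.
  - move=> t; rewrite /= in_itv/= => /andP[t0 _].
    rewrite -EFinM -EFinD indicE; have [tA|tA] := boolP (t \in `[0, A]%classic).
      by rewrite mulr1 (le_trans (gB t t0))// lee_fin lerDr addr_ge0// ltW.
    rewrite mulr0 addr0; have : A <= t.
      by apply/ltW; rewrite ltNge; apply: contra tA => tA; rewrite inE/= in_itv/= t0.
    by move=> /hA /andP[].
rewrite ge0_integralD//; last 3 first.
- by move=> t _; rewrite lee_fin addr_ge0// ltW.
- by move=> t _; rewrite -EFinM lee_fin mulr_ge0// indicE.
- apply/measurable_funTS/measurable_EFinP; apply: measurable_funM => //.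
rewrite integral_cst//= ge0_integralZl//=; last first.
  apply: measurable_funTS; apply/measurable_EFinP; exact: measurable_indic.
rewrite integral_indic//=.
apply: (@le_trans _ _ ((G + e / 2)%:E * mu `[0%R, tau] + B%:E * mu `[0%R, A])%E).
  rewrite leeD2l// lee_wpmul2l// ?lee_fin//; apply: le_measure; rewrite ?inE//.
  exact: measurableI.
have m0 a : 0 <= a -> mu `[0%R, a] = a%:E.
  by move=> a0; rewrite lebesgue_measure_itv/= lte_fin; case: ltP => [_|a0']; rewrite ?sube0//;
    congr EFin; apply/eqP; rewrite eq_le a0.
rewrite !m0// -!EFinM -EFinD lee_fin; nra.
Qed.

End long_time_averages.

(** * Convergence of the expected cost of the queue *)

Section long_run_cost.
Context d (T : measurableType d) (R : realType) (P : probability T R).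
Variables (H : R) (W : R -> {RV P >-> R}).
Hypotheses (H_ge : 2^-1 <= H) (H_lt : H < 1) (fbmW : fractional_brownian_motion H W).
Variables (sigma C : R -> R) (K' : R) (q : nat).
Hypotheses (C_ge0 : forall y : R, 0 <= y -> 0 <= C y)
  (C_cont : {within `[0, +oo[, continuous C})
  (C_nd : {in `[0, +oo[ &, {homo C : x y / x <= y}})
  (C_bound : forall y, 0 <= y -> C y <= K' * (1 + y ^+ q)).
Variables (x u : R).
Hypotheses (x_ge0 : 0 <= x) (u_gt0 : 0 < u) (sigma_gt0 : 0 < sigma u).

Local Notation c := (sigma u).
Local Notation Z := (max_drifted W 1).
Local Notation M := (drifted_sup W c u `[0, +oo[).
Local Notation M2 := (drifted_sup W c (u / 2) `[0, +oo[).
Local Notation queue := (queue_length W sigma x u).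

Let u2_gt0 : 0 < u / 2. Proof. by rewrite divr_gt0. Qed.

Let H_gt0 : 0 < H. Proof. by apply: lt_le_trans H_ge; rewrite invr_gt0. Qed.

Let mM : measurable_fun setT M.
Proof. by have [] := drifted_sup_eq_law H_ge H_lt fbmW sigma_gt0 u_gt0. Qed.

Let mM2 : measurable_fun setT M2.
Proof. by have [] := drifted_sup_eq_law H_ge H_lt fbmW sigma_gt0 u2_gt0. Qed.

Let M_ge0 w : 0 <= M w.
Proof. by rewrite (drifted_sup_ge0 fbmW)//= in_itv/= lexx. Qed.

Let M2_ge0 w : 0 <= M2 w.
Proof. by rewrite (drifted_sup_ge0 fbmW)//= in_itv/= lexx. Qed.

Lemma drifted_sup_moment v n : 0 < v ->
  (\int[P]_w ((drifted_sup W c v `[0, +oo[ w) ^+ n)%:E < +oo)%E.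
Proof.
move=> v0; have [_ mS mZ law] := drifted_sup_eq_law H_ge H_lt fbmW sigma_gt0 v0.
have := @eq_law_cost _ _ _ P (fun y => y ^+ n) (fun y y0 => exprn_ge0 n y0).
move=> /(_ (continuous_subspaceT (@exprn_continuous R n)) _ _ mS).
set b := v * _ in law *; have b0 : 0 <= b by rewrite ltW// mulr_gt0// powR_gt0// divr_gt0.
move=> /(_ (fun w => b * Z w)) ->.
- under eq_integral do rewrite exprMn EFinM.
  have bn0 : 0 <= b ^+ n by rewrite exprn_ge0.
  rewrite (@ge0_integralZl_EFin _ _ _ P _ measurableT (fun w => (Z w ^+ n)%:E) _ _ _ bn0).
  + by rewrite lte_mul_pinfty ?lee_fin// (max_drifted1_moment H_ge H_lt fbmW).
  + by move=> w _; rewrite lee_fin exprn_ge0// (max_drifted1_ge0 fbmW).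
  + by apply/measurable_EFinP; exact: measurable_funX.
- exact: measurable_funM.
- by move=> w; rewrite (drifted_sup_ge0 fbmW)//= in_itv/= lexx.
- by move=> w; rewrite mulr_ge0// (max_drifted1_ge0 fbmW).
- exact: law.
Qed.

Lemma shifted_moment n : (\int[P]_w ((x + M2 w) ^+ n)%:E < +oo)%E.
Proof.
apply: (@le_lt_trans _ _ (\int[P]_w (((2 * x) ^+ n)%:E + (2 ^+ n)%:E * (M2 w ^+ n)%:E))%E).
  apply: ge0_le_integral => //.
  - by move=> w _; rewrite lee_fin exprn_ge0// addr_ge0.
  - by apply/measurable_EFinP; apply: measurable_funX; exact: measurable_funD.
  - apply/measurable_EFinP; apply: measurable_funD => //; apply: measurable_funM => //.
    exact: measurable_funX.
  - move=> w _; rewrite -EFinM -EFinD lee_fin -(exprMn n).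
    have [h|h] := leP (M2 w) x.
      rewrite (@le_trans _ _ ((2 * x) ^+ n))//.
        by apply: lerXn2r; rewrite ?nnegrE ?addr_ge0 ?mulr_ge0//; lra.
      by rewrite lerDl exprn_ge0// mulr_ge0.
    rewrite (@le_trans _ _ ((2 * M2 w) ^+ n))//.
      by apply: lerXn2r; rewrite ?nnegrE ?addr_ge0 ?mulr_ge0//; lra.
    by rewrite lerDr exprn_ge0// mulr_ge0.
have i2 : P.-integrable setT (fun w => (M2 w ^+ n)%:E).
  apply/integrableP; split; first by apply/measurable_EFinP; exact: measurable_funX.
  under eq_integral do rewrite gee0_abs ?lee_fin ?exprn_ge0//.
  exact: drifted_sup_moment.
have ic : P.-integrable setT (fun=> ((2 * x) ^+ n)%:E) by exact: finite_measure_integrable_cst.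
have iz := integrableZl measurableT (2 ^+ n) i2.
have := integrable_fin_num measurableT (integrableD measurableT ic iz).
by move=> h; rewrite ltey_eq; apply/orP; left; exact: h.
Qed.

Let overshoot w : R := C (x + M2 w).

Let xM2_ge0 w : 0 <= x + M2 w. Proof. by rewrite addr_ge0. Qed.

Let mxM2 : measurable_fun setT (fun w => x + M2 w).
Proof. exact: measurable_funD. Qed.

Lemma overshoot_integrable : P.-integrable setT (fun w => (overshoot w)%:E).
Proof. exact: (cost_integrable C_ge0 C_cont C_bound mxM2 xM2_ge0 (shifted_moment q)). Qed.

Lemma weighted_overshoot_integrable :
  P.-integrable setT (fun w => (overshoot w * (x + M2 w))%:E).
Proof.
have K'0 : 0 <= K'.
  have h1 : 0 < (1 + 0 ^+ q : R) by rewrite ltr_wpDr// exprn_ge0.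
  rewrite -(pmulr_lge0 _ h1); exact: le_trans (C_ge0 (lexx 0)) (C_bound (lexx 0)).
pose D y := C y * y.
have D_ge0 y : 0 <= y -> 0 <= D y by move=> y0; rewrite mulr_ge0// C_ge0.
have D_cont : {within `[0, +oo[, continuous D}.
  move=> y; apply: cvgM; first exact: C_cont.
  exact: (continuous_subspaceT (fun x : R => @cvg_id _ (nbhs x))).
have D_bound y : 0 <= y -> D y <= 2 * K' * (1 + y ^+ q.+1).
  move=> y0; rewrite (le_trans (ler_wpM2r y0 (C_bound y0)))//.
  rewrite mulrAC (mulrC 2) -!mulrA ler_wpM2l// mulrDr mulr1 -exprS.
  have : 0 <= y ^+ q.+1 by rewrite exprn_ge0.
  suff : y <= 1 + y ^+ q.+1 by lra.
  have [y1|y1] := leP y 1; first by rewrite (le_trans y1)// lerDl exprn_ge0.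
  rewrite (@le_trans _ _ (y ^+ q.+1)) ?lerDr// exprS ler_peMr// exprn_ege1//.
  exact: ltW.
exact: (cost_integrable D_ge0 D_cont D_bound mxM2 xM2_ge0 (shifted_moment q.+1)).
Qed.

(** Half of the drift is kept aside: the netput started at x is bounded by
    x + M2 - (u / 2) t with M2 the maximum for the drift u / 2. The netput can
    thus exceed the reflected process only up to the random time
    2 (x + M2) / u. *)
Lemma netput_le t w : 0 <= t -> has_ubound [set c * W s w - u / 2 * s | s in `[0, +oo[] ->
  netput W sigma x u t w <= x + M2 w - u / 2 * t.
Proof.
move=> t0 ub; rewrite /netput.
have : c * W t w - u / 2 * t <= M2 w.
  by apply: ub_le_sup => //; exists t => //; rewrite /= in_itv/= t0.
lra.
Qed.

(** When the netput exceeds the reflected process, its cost is at most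
    C (x + M2) and t is at most 2 (x + M2) / u. The second bound makes the excess
    cost of order 1 / t after integration. *)
Lemma queue_cost_ub t w : 0 <= t -> has_ubound [set c * W s w - u / 2 * s | s in `[0, +oo[] ->
  C (queue t w) <= C (reflected W c u t w) + overshoot w /\
  t * C (queue t w) <= t * C (reflected W c u t w) + 2 / u * (overshoot w * (x + M2 w)).
Proof.
move=> t0 ub; have nl := netput_le t0 ub.
have r0 := reflected_ge0 fbmW c u w t0.
have o0 : 0 <= overshoot w by exact: C_ge0.
have Cr0 := C_ge0 r0.
rewrite (queue_length_max fbmW)//.
have w0 : 0 <= 2 / u * (overshoot w * (x + M2 w)).
  by rewrite mulr_ge0 ?divr_ge0 ?(ltW u_gt0)// mulr_ge0.
have [h|h] := leP (netput W sigma x u t w) (reflected W c u t w).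
  by split; rewrite lerDl.
have ut0 : 0 <= u / 2 * t by rewrite mulr_ge0// ltW.
have Cn : C (netput W sigma x u t w) <= overshoot w.
  apply: (cost_le C_nd); first exact: le_trans (ltW h).
  by rewrite (le_trans nl)// gerBl.
split; first by rewrite (le_trans Cn)// lerDr.
have ut : u / 2 * t <= x + M2 w by lra.
rewrite (@le_trans _ _ (2 / u * (overshoot w * (x + M2 w))))//; last first.
  by rewrite lerDr mulr_ge0.
have Cn0 : 0 <= C (netput W sigma x u t w) by apply: C_ge0; exact: le_trans (ltW h).
set y := C _ in Cn Cn0 *.
have -> : t * y = 2 / u * (y * (u / 2 * t)) by field; rewrite gt_eqF.
by rewrite ler_wpM2l ?divr_ge0 ?(ltW u_gt0)// ler_pM.
Qed.

Lemma queue_cost_lb t w : 0 <= t -> C (reflected W c u t w) <= C (queue t w).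
Proof.
move=> t0; apply: (cost_le C_nd); first exact: (reflected_ge0 fbmW).
by rewrite (queue_length_max fbmW)// le_max lexx orbT.
Qed.

Let M_bounded : {ae P, forall w, has_ubound [set c * W s w - u * s | s in `[0, +oo[]}.
Proof. by have [] := drifted_sup_eq_law H_ge H_lt fbmW sigma_gt0 u_gt0. Qed.

Let M2_bounded : {ae P, forall w, has_ubound [set c * W s w - u / 2 * s | s in `[0, +oo[]}.
Proof. by have [] := drifted_sup_eq_law H_ge H_lt fbmW sigma_gt0 u2_gt0. Qed.

Let D_ge0 t w : 0 <= t -> 0 <= drifted_sup W c u `[0, t] w.
Proof. by move=> t0; rewrite (drifted_sup_ge0 fbmW)//= in_itv/= lexx t0. Qed.

Lemma drifted_sup_le_itv (t t' : R) w : 0 <= t -> t <= t' ->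
  drifted_sup W c u `[0, t] w <= drifted_sup W c u `[0, t'] w.
Proof.
move=> t0 tt'; apply: ge_sup.
  by exists (c * W 0 w - u * 0), 0 => //; rewrite /= in_itv/= lexx.
move=> y [s /=]; rewrite in_itv/= => /andP[s0 st] <-.
apply: ub_le_sup; first exact: (has_ubound_drifted fbmW _ _ _ (le_trans t0 tt')).
by exists s => //; rewrite /= in_itv/= s0 (le_trans st).
Qed.

Lemma drifted_sup_le_all (t : R) w : 0 <= t ->
  has_ubound [set c * W s w - u * s | s in `[0, +oo[] ->
  drifted_sup W c u `[0, t] w <= M w.
Proof.
move=> t0 ub; apply: ge_sup.
  by exists (c * W 0 w - u * 0), 0 => //; rewrite /= in_itv/= lexx.
move=> y [s /=]; rewrite in_itv/= => /andP[s0 st] <-.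
by apply: ub_le_sup => //; exists s => //; rewrite /= in_itv/= s0.
Qed.

Lemma drifted_sup_cvg w :
  has_ubound [set c * W s w - u * s | s in `[0, +oo[] ->
  drifted_sup W c u `[0, n%:R] w @[n --> \oo] --> M w.
Proof.
move=> ub; apply/cvgrPdist_le => e e0.
have ne : [set c * W s w - u * s | s in `[0, +oo[] !=set0.
  by exists (c * W 0 w - u * 0), 0 => //; rewrite /= in_itv/= lexx.
have [_ [s /=] + <- h] := sup_adherent e0 (conj ne ub).
rewrite in_itv/= andbT => s0.
exists (Num.truncn s).+1 => // n /= sn.
have sn' : s <= n%:R.
  by rewrite (le_trans (ltW (truncnS_gt s)))// ler_nat.
have n0 : 0 <= n%:R :> R by [].
have h1 := drifted_sup_le_all n0 ub.
have h2 : c * W s w - u * s <= drifted_sup W c u `[0, n%:R] w.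
  apply: ub_le_sup; first exact: (has_ubound_drifted fbmW).
  by exists s => //; rewrite /= in_itv/= s0.
rewrite ger0_norm ?subr_ge0//.
by move: h; rewrite -/(drifted_sup W c u `[0, +oo[ w); lra.
Qed.

Local Notation G := (\int[P]_w (C (M w))%:E)%E.

Lemma stationary_cost_integrable : P.-integrable setT (fun w => (C (M w))%:E).
Proof.
apply: (cost_integrable C_ge0 C_cont C_bound mM M_ge0).
exact: drifted_sup_moment.
Qed.

Let mC (X : T -> R) : measurable_fun setT X -> (forall w, 0 <= X w) ->
  measurable_fun setT (fun w => (C (X w))%:E).
Proof. by move=> mX X0; apply/measurable_EFinP; exact: measurable_cost. Qed.

(** Time reversal: at a fixed time the queue started empty has the law of the
    maximum over [0, t]. *)
Lemma reflected_costE t : 0 <= t ->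
  (\int[P]_w (C (reflected W c u t w))%:E =
   \int[P]_w (C (drifted_sup W c u `[0%R, t] w))%:E)%E.
Proof.
move=> t0; have [mr md law] := reflected_eq_law H_ge fbmW c u t0.
apply: (eq_law_cost C_ge0 C_cont mr md) => // w; first exact: (reflected_ge0 fbmW).
exact: D_ge0.
Qed.

Lemma reflected_cost_le t : 0 <= t -> (\int[P]_w (C (reflected W c u t w))%:E <= G)%E.
Proof.
move=> t0; have [_ md _] := reflected_eq_law H_ge fbmW c u t0.
rewrite reflected_costE//; apply: ae_ge0_le_integral => //.
- by move=> w _; rewrite lee_fin C_ge0// D_ge0.
- by apply: mC => // w; exact: D_ge0.
- by move=> w _; rewrite lee_fin C_ge0.
- exact: mC.
- apply: filterS M_bounded => w ub _; rewrite lee_fin (cost_le C_nd)// ?D_ge0//.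
  exact: drifted_sup_le_all.
Qed.

(** Dominated convergence along the integers, then monotonicity in t. *)
Lemma reflected_cost_cvg e : 0 < e -> exists A, forall t, A <= t ->
  (G - e%:E <= \int[P]_w (C (reflected W c u t w))%:E)%E.
Proof.
move=> e0; have Gfin : G \is a fin_num.
  by apply: integrable_fin_num => //; exact: stationary_cost_integrable.
have mD n : measurable_fun setT (drifted_sup W c u `[0, n%:R]).
  by have [] := reflected_eq_law H_ge fbmW c u (ler0n R n).
have := @dominated_convergence _ _ _ P setT measurableT
  (fun n w => (C (drifted_sup W c u `[0, n%:R] w))%:E) (fun w => (C (M w))%:E)
  (fun w => (C (M w))%:E).
have fin n : (\int[P]_w (C (drifted_sup W c u `[0%R, n%:R] w))%:E)%E \is a fin_num.
  rewrite -reflected_costE// ge0_fin_numE.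
    by rewrite (le_lt_trans (reflected_cost_le (ler0n R n)))// ltey_eq Gfin.
  by apply: integral_ge0 => w _; rewrite lee_fin C_ge0// (reflected_ge0 fbmW).
case=> [n| | | | |_ _ cvg].
- by apply: mC => // w; exact: D_ge0.
- exact: mC.
- apply: filterS M_bounded => w ub _.
  have := cvg_comp _ _ (drifted_sup_cvg ub) (continuous_extension C_cont (x := M w)).
  rewrite (max_l (M_ge0 w)) => h; apply: cvg_EFin; first exact: nearW.
  apply: cvg_trans h; apply: near_eq_cvg; apply: nearW => n /=.
  by rewrite max_l// D_ge0.
- exact: stationary_cost_integrable.
- apply: filterS M_bounded => w ub n _; rewrite abse_EFin lee_fin ger0_norm ?C_ge0 ?D_ge0//.
  by rewrite (cost_le C_nd)// ?D_ge0//; exact: drifted_sup_le_all.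
have cvgG : (\int[P]_w (C (drifted_sup W c u `[0%R, n%:R] w))%:E)%E @[n --> \oo] --> (fine G)%:E.
  by rewrite fineK.
have /fine_cvgP[_ /cvgrPdist_le/(_ e e0)[N _ hN]] := cvgG.
exists N%:R => t Nt; have t0 : 0 <= t by exact: le_trans Nt.
have := hN N (leqnn N) => /=; rewrite ler_norml => /andP[_ h].
apply: (@le_trans _ _ (\int[P]_w (C (drifted_sup W c u `[0%R, N%:R] w))%:E)%E).
  by rewrite -(fineK Gfin) -(fineK (fin N)) -EFinB lee_fin; lra.
rewrite reflected_costE//.
have [_ md _] := reflected_eq_law H_ge fbmW c u t0.
apply: ge0_le_integral => //.
- by move=> w _; rewrite lee_fin C_ge0// D_ge0.
- by apply: mC => // w; exact: D_ge0.
- by apply: mC => // w; exact: D_ge0.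
- by move=> w _; rewrite lee_fin (cost_le C_nd)// ?D_ge0//; exact: drifted_sup_le_itv.
Qed.

Lemma measurable_queue t : 0 <= t -> measurable_fun setT (queue t).
Proof.
move=> t0; have [mr _ _] := reflected_eq_law H_ge fbmW c u t0.
rewrite (_ : queue t = (netput W sigma x u t \max reflected W c u t)).
  apply: measurable_maxr => //; rewrite /netput.
  by apply: measurable_funD => //; exact: measurable_funM.
by apply/funext => w; rewrite (queue_length_max fbmW).
Qed.

Local Notation O1 := (\int[P]_w (C (x + M2 w))%:E)%E.
Local Notation O2 := (\int[P]_w (C (x + M2 w) * (x + M2 w))%:E)%E.

Lemma mean_queue_cost_lb t : 0 <= t ->
  (\int[P]_w (C (reflected W c u t w))%:E <= \int[P]_w (C (queue t w))%:E)%E.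
Proof.
move=> t0; have [mr _ _] := reflected_eq_law H_ge fbmW c u t0.
have mq := measurable_queue t0.
have q0 w : 0 <= queue t w by exact: (queue_length_ge0 fbmW).
have r0 w : 0 <= reflected W c u t w by exact: (reflected_ge0 fbmW).
apply: ge0_le_integral => //.
- by move=> w _; rewrite lee_fin C_ge0.
- exact: mC.
- exact: mC.
- by move=> w _; rewrite lee_fin; exact: queue_cost_lb.
Qed.

Lemma mean_queue_cost_ub t : 0 <= t ->
  (\int[P]_w (C (queue t w))%:E <= G + O1)%E /\
  (t%:E * \int[P]_w (C (queue t w))%:E <= t%:E * G + (2 / u)%:E * O2)%E.
Proof.
move=> t0; have [mr _ _] := reflected_eq_law H_ge fbmW c u t0.
have mq := measurable_queue t0.
have q0 w : 0 <= queue t w by exact: (queue_length_ge0 fbmW).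
have r0 w : 0 <= reflected W c u t w by exact: (reflected_ge0 fbmW).
have mCq := mC mq q0; have mCr := mC mr r0.
have mO1 := measurable_int _ overshoot_integrable.
have mO2 := measurable_int _ weighted_overshoot_integrable.
have Gr := reflected_cost_le t0.
have u20 : 0 <= 2 / u by rewrite divr_ge0// ltW.
split.
  apply: (@le_trans _ _ (\int[P]_w ((C (reflected W c u t w))%:E + (C (x + M2 w))%:E))%E).
    apply: ae_ge0_le_integral => //.
    - by move=> w _; rewrite lee_fin C_ge0.
    - by move=> w _; rewrite adde_ge0// lee_fin C_ge0.
    - exact: emeasurable_funD.
    - apply: filterS M2_bounded => w ub _; rewrite -EFinD lee_fin.
      by have [] := queue_cost_ub t0 ub.
  have C0 w : (0 <= (C (reflected W c u t w))%:E)%E by rewrite lee_fin C_ge0.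
  have O0 w : (0 <= (C (x + M2 w))%:E)%E by rewrite lee_fin C_ge0.
  by rewrite (ge0_integralD _ measurableT (fun w _ => C0 w) mCr (fun w _ => O0 w) mO1) leeD2r.
have tC0 w : (0 <= t%:E * (C (reflected W c u t w))%:E)%E.
  by rewrite mule_ge0// lee_fin C_ge0.
have uO0 w : (0 <= (2 / u)%:E * (C (x + M2 w) * (x + M2 w))%:E)%E.
  by apply: mule_ge0; rewrite lee_fin// mulr_ge0// C_ge0.
apply: (@le_trans _ _ (\int[P]_w (t%:E * (C (reflected W c u t w))%:E +
    (2 / u)%:E * (C (x + M2 w) * (x + M2 w))%:E))%E).
  rewrite -(@ge0_integralZl_EFin _ _ _ P _ measurableT (fun w => (C (queue t w))%:E) _ _ _ t0)//; last first.
    by move=> w _; rewrite lee_fin C_ge0.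
  apply: ae_ge0_le_integral => //.
  - by move=> w _; rewrite mule_ge0 ?lee_fin ?C_ge0.
  - exact: measurable_funeM.
  - by move=> w _; apply: adde_ge0; [exact: tC0|exact: uO0].
  - by apply: emeasurable_funD; exact: measurable_funeM.
  - apply: filterS M2_bounded => w ub _; rewrite -!EFinM -EFinD lee_fin.
    by have [] := queue_cost_ub t0 ub.
rewrite (ge0_integralD _ measurableT (fun w _ => tC0 w) (measurable_funeM _ mCr)
  (fun w _ => uO0 w) (measurable_funeM _ mO2)).
rewrite (@ge0_integralZl_EFin _ _ _ P _ measurableT (fun w => (C (reflected W c u t w))%:E) _ _ _ t0)//; last first.
  by move=> w _; rewrite lee_fin C_ge0.
rewrite (@ge0_integralZl_EFin _ _ _ P _ measurableT (fun w => (C (x + M2 w) * (x + M2 w))%:E) _ _ _ u20)//; last first.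
  by move=> w _; rewrite lee_fin mulr_ge0// C_ge0.
by rewrite leeD2r// lee_wpmul2l.
Qed.

Lemma mean_queue_cost_bounded : exists2 B, 0 <= B & forall t, 0 <= t ->
  (\int[P]_w (C (queue t w))%:E <= B%:E)%E.
Proof.
have Gfin : G \is a fin_num.
  by apply: integrable_fin_num => //; exact: stationary_cost_integrable.
have Ofin : O1 \is a fin_num.
  by apply: integrable_fin_num => //; exact: overshoot_integrable.
exists (fine (G + O1)%E).
  by rewrite fine_ge0// adde_ge0//; apply: integral_ge0 => w _; rewrite lee_fin C_ge0.
have GO : (G + O1)%E \is a fin_num by rewrite fin_numD Gfin Ofin.
move=> t t0; rewrite (fineK GO).
by have [] := mean_queue_cost_ub t0.
Qed.

(** The expected cost of the queue is squeezed between that of the queue started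
    empty and the same plus a term of order 1 / t. *)
Lemma mean_queue_cost_cvg e : 0 < e -> exists A, forall t, A <= t ->
  ((fine G - e)%:E <= \int[P]_w (C (queue t w))%:E <= (fine G + e)%:E)%E.
Proof.
move=> e0; have Gfin : G \is a fin_num.
  by apply: integrable_fin_num => //; exact: stationary_cost_integrable.
have Ofin : O2 \is a fin_num.
  apply: integrable_fin_num => //.
  exact: weighted_overshoot_integrable.
have [A hA] := reflected_cost_cvg e0.
exists (Num.max A (Num.max 1 (2 / u * fine O2 / e))) => t.
rewrite !ge_max => /and3P[At t1 Ot]; have t0 : 0 < t by apply: lt_le_trans t1.
apply/andP; split.
  rewrite EFinB fineK// (le_trans (hA _ At))//; exact/mean_queue_cost_lb/ltW.
have [_ h] := mean_queue_cost_ub (ltW t0).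
rewrite -(@lee_pmul2l _ t%:E)// ?lte_fin// (le_trans h)//.
rewrite -{1}(fineK Gfin) -(fineK Ofin) -!EFinM -EFinD lee_fin mulrDr lerD2l.
by rewrite -ler_pdivrMr.
Qed.

End long_run_cost.

(** * Time-integrated cost and long-run average *)

Section joint_measurability.
Context d (T : measurableType d) (R : realType) (P : probability T R).
Variables (H : R) (W : R -> {RV P >-> R}).
Hypotheses (fbmW : fractional_brownian_motion H W).
Variables (sigma : R -> R) (x u : R).

Local Notation c := (sigma u).
Local Notation queue := (queue_length W sigma x u).
Local Notation TT := (measurableTypeR R * T)%type.

Let measurable_time : measurable_fun [set: TT] (fun z => Num.max z.1 0).
Proof. by apply: measurable_maxr; [exact: measurable_fst|exact: measurable_cst]. Qed.

Lemma measurable_joint_fbm : measurable_fun [set: TT] (fun z => W (Num.max z.1 0) z.2).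
Proof.
apply: (@measurable_continuous_process _ _ _ (fun t w => W t w)) => // w.
exact: (fbm_continuous fbmW).
Qed.

Lemma measurable_joint_reflected :
  measurable_fun [set: TT] (fun z => reflected W c u (Num.max z.1 0) z.2).
Proof.
pose X n (z : TT) := reflected_seq W c u (Num.max z.1 0) n z.2.
rewrite (_ : (fun z : TT => _) = sup_seq X); last first.
  apply/funext => z; have z0 : 0 <= Num.max z.1 0 by rewrite le_max lexx orbT.
  by have [_ ->] := reflected_dense fbmW c u z.2 z0.
apply: measurable_sup_seq => n.
have mt : measurable_fun [set: TT] (fun z => Num.max z.1 0 * unit_seq R n).
  exact: measurable_funM.
pose g (z : TT) : TT := (Num.max z.1 0 - Num.max z.1 0 * unit_seq R n, z.2).
have mg : measurable_fun setT g.
  apply: measurable_fun_pair; last exact: measurable_snd.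
  exact: measurable_funB.
have mWg : measurable_fun [set: TT]
    (fun z => W (Num.max z.1 0 - Num.max z.1 0 * unit_seq R n) z.2).
  rewrite (_ : (fun z : TT => _) = (fun z : TT => W (Num.max z.1 0) z.2) \o g).
    exact: measurableT_comp measurable_joint_fbm mg.
  apply/funext => z /=; congr (W _ _); rewrite [RHS]max_l// subr_ge0 ler_piMr//.
    by rewrite le_max lexx orbT.
  by have /andP[] := unit_seq_itv R n.
rewrite /X /reflected_seq; apply: measurable_funB; apply: measurable_funM => //.
by apply: measurable_funB => //; exact: measurable_joint_fbm.
Qed.

Lemma measurable_joint_queue :
  measurable_fun [set: TT] (fun z => queue (Num.max z.1 0) z.2).
Proof.
rewrite (_ : (fun z : TT => _) = (fun z : TT =>
  Num.max (netput W sigma x u (Num.max z.1 0) z.2) (reflected W c u (Num.max z.1 0) z.2))).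
  apply: measurable_maxr; last exact: measurable_joint_reflected.
  rewrite /netput; apply: measurable_funD; last first.
    by apply: measurable_funM => //; exact: measurable_joint_fbm.
  by apply: measurable_funB => //; exact: measurable_funM.
apply/funext => z; by rewrite (queue_length_max fbmW)// le_max lexx orbT.
Qed.

(** Paths are bounded on compact intervals, so the integrated cost is finite for
    every outcome and not only almost surely. *)
Lemma queue_bounded tau w : 0 <= tau -> exists2 B, 0 <= B &
  forall t, 0 <= t <= tau -> queue t w <= B.
Proof.
move=> tau0; have [B hB] := drifted_bounded fbmW c u w tau0.
have B0 : 0 <= B by rewrite (le_trans _ (hB 0 _))// lexx.
exists (`|x| + (B + B)) => [|t /andP[t0 tt]]; first by rewrite !addr_ge0.
rewrite (queue_length_max fbmW)// ge_max; have h1 := ler_norm x.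
have /ler_normlP[h2 h3] := hB t (introT andP (conj t0 tt)).
apply/andP; split; first by rewrite /netput; lra.
rewrite (@le_trans _ _ (B + B)) ?lerDr//; apply: ge_sup.
  by exists (c * (W t w - W 0 w) - u * (t - 0)), 0; rewrite //= in_itv/= lexx.
move=> y [s /=]; rewrite in_itv/= => /andP[s0 st] <-.
have := hB s; rewrite s0 (le_trans st)// => /(_ isT)/ler_normlP[h4 h5].
have -> : c * (W t w - W s w) - u * (t - s) = (c * W t w - u * t) - (c * W s w - u * s) by ring.
lra.
Qed.

End joint_measurability.

Section integrated_cost.
Context d (T : measurableType d) (R : realType) (P : probability T R).
Variables (H : R) (W : R -> {RV P >-> R}).
Hypotheses (fbmW : fractional_brownian_motion H W).
Variables (sigma C : R -> R).
Hypotheses (C_ge0 : forall y : R, 0 <= y -> 0 <= C y)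
  (C_cont : {within `[0, +oo[, continuous C})
  (C_nd : {in `[0, +oo[ &, {homo C : x y / x <= y}}).
Variables (x u : R).

Local Notation queue := (queue_length W sigma x u).
Local Notation TT := (measurableTypeR R * T)%type.
Local Notation mu := (@lebesgue_measure R).

Let q0 (z : TT) : 0 <= queue (Num.max z.1 0) z.2.
Proof. by apply: (queue_length_ge0 fbmW); rewrite le_max lexx orbT. Qed.

Let cost (z : TT) : \bar R := (C (queue (Num.max z.1 0) z.2))%:E.

Let cost_ge0 z : (0 <= cost z)%E. Proof. by rewrite lee_fin C_ge0. Qed.

Let mcost : measurable_fun setT cost.
Proof.
apply/measurable_EFinP; apply: measurable_cost => //.
exact: (measurable_joint_queue fbmW).
Qed.

Let killed tau (z : TT) : \bar R := (cost z * (\1_(`[0%R, tau]%classic) z.1)%:E)%E.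

Let killed_ge0 tau z : (0 <= killed tau z)%E.
Proof. by rewrite mule_ge0// lee_fin. Qed.

Let mkilled tau : measurable_fun setT (killed tau).
Proof.
apply: emeasurable_funM => //; apply/measurable_EFinP.
by apply: (@measurableT_comp _ _ _ _ _ _ (\1_(`[0%R, tau]%classic) : measurableTypeR R -> R)).
Qed.

Let killedE tau (F : R -> \bar R) :
  (\int[mu]_t (F t * (\1_(`[0%R, tau]%classic) t)%:E) = \int[mu]_(t in `[0%R, tau]) F t)%E.
Proof.
rewrite [RHS]integral_mkcond; apply: eq_integral => t _.
by rewrite patchE indicE; case: ifPn => _; rewrite ?mule1 ?mule0.
Qed.

Let path_cost tau w : \bar R := (\int[mu]_(t in `[0%R, tau]) (C (queue t w))%:E)%E.

Let path_costE tau w : path_cost tau w = (\int[mu]_t killed tau (t, w))%E.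
Proof.
rewrite killedE /path_cost; apply: eq_integral => t; rewrite inE/= in_itv/= => /andP[t0 _].
by rewrite /cost/= max_l.
Qed.

Lemma measurable_mean_cost : measurable_fun [set: R]
  (fun t : R => \int[P]_w (C (queue (Num.max t 0) w))%:E)%E.
Proof.
have := @measurable_fun_fubini_tonelli_F _ _ (measurableTypeR R) T R P cost mcost cost_ge0.
rewrite /fubini_F /cost/=.
exact.
Qed.

Lemma path_cost_fin tau w : 0 <= tau -> path_cost tau w \is a fin_num.
Proof.
move=> tau0; rewrite ge0_fin_numE; last first.
  by rewrite path_costE; apply: integral_ge0 => t _; exact: killed_ge0.
have [B B0 hB] := queue_bounded fbmW sigma x u w tau0.
apply: (@le_lt_trans _ _ (\int[mu]_(t in `[0%R, tau]) (C B)%:E)%E).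
  apply: ge0_le_integral => //.
  - move=> t; rewrite /= in_itv/= => /andP[t0 _].
    by rewrite lee_fin C_ge0// (queue_length_ge0 fbmW).
  - apply: (@eq_measurable_fun _ _ _ _ _ (fun t => cost (t, w))).
      by move=> t; rewrite inE/= in_itv/= => /andP[t0 _]; rewrite /cost/= max_l.
    apply: measurable_funTS; exact: (measurableT_comp mcost (measurable_pair2 w)).
  - move=> t; rewrite /= in_itv/= => t0t; have /andP[t0 _] := t0t.
    rewrite lee_fin (cost_le C_nd) ?hB//.
    by rewrite (queue_length_ge0 fbmW).
rewrite integral_cst//= lebesgue_measure_itv/= lte_fin.
by case: ifPn => _; rewrite -?EFinD -?EFinM ?mule0 ltry.
Qed.

(** Tonelli's theorem, after multiplication by the indicator of [0, tau] so that
    both integrals run over whole spaces. *)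
Lemma integrated_costE tau : 0 <= tau ->
  measurable_fun setT (fun w => \int[mu]_(t in `[0, tau]) C (queue t w))%R /\
  (\int[P]_w ((\int[mu]_(t in `[0%R, tau]) C (queue t w))%R)%:E =
   \int[mu]_(t in `[0%R, tau]) \int[P]_w (C (queue (Num.max t 0) w))%:E)%E.
Proof.
move=> tau0; split.
  rewrite /Rintegral -/(path_cost tau _).
  apply: (measurableT_comp (fine_measurable measurableT)).
  rewrite (_ : (fun w => _) = fun w => (\int[mu]_t killed tau (t, w))%E); last first.
    by apply/funext => w; rewrite -path_costE.
  have := @measurable_fun_fubini_tonelli_G _ _ (measurableTypeR R) T R mu _
    (mkilled tau) (killed_ge0 tau).
  rewrite /fubini_G; exact.
transitivity (\int[P]_w \int[mu]_t killed tau (t, w))%E.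
  by apply: eq_integral => w _; rewrite -path_costE -(fineK (path_cost_fin w tau0)).
rewrite -(@fubini_tonelli _ _ (measurableTypeR R) _ R mu P _ (mkilled tau) (killed_ge0 tau)).
rewrite -killedE; apply: eq_integral => t _.
rewrite muleC.
rewrite -(@ge0_integralZl_EFin _ _ _ P _ measurableT (fun w => (C (queue (Num.max t 0) w))%:E)).
- by apply: eq_integral => w _; rewrite /killed muleC.
- by move=> w _; exact: (cost_ge0 (t, w)).
- exact: (measurableT_comp mcost (measurable_pair1 t)).
- by [].
Qed.

End integrated_cost.

Section long_run_average.
Context d (T : measurableType d) (R : realType) (P : probability T R).
Variables (H : R) (W : R -> {RV P >-> R}).
Hypotheses (H_ge : 2^-1 <= H) (H_lt : H < 1) (fbmW : fractional_brownian_motion H W).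
Variables (sigma h C : R -> R) (p K' : R) (q : nat).
Hypotheses (p_ge0 : 0 <= p)
  (C_ge0 : forall y : R, 0 <= y -> 0 <= C y)
  (C_cont : {within `[0, +oo[, continuous C})
  (C_nd : {in `[0, +oo[ &, {homo C : x y / x <= y}})
  (C_bound : forall y, 0 <= y -> C y <= K' * (1 + y ^+ q)).
Variables (x u : R).
Hypotheses (x_ge0 : 0 <= x) (u_gt0 : 0 < u) (sigma_gt0 : 0 < sigma u).

Local Notation c := (sigma u).
Local Notation M := (drifted_sup W c u `[0, +oo[).
Local Notation queue := (queue_length W sigma x u).
Local Notation mu := (@lebesgue_measure R).

Let H_gt0 : 0 < H. Proof. by apply: lt_le_trans H_ge; rewrite invr_gt0. Qed.

Let id_ge0 (y : R) : 0 <= y -> 0 <= id y. Proof. by []. Qed.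
Let id_cont : {within `[0, +oo[, continuous (@id R)}.
Proof. exact: (continuous_subspaceT (fun x : R => @cvg_id _ (nbhs x))). Qed.
Let id_nd : {in `[0, +oo[ &, {homo (@id R) : x y / x <= y}}.
Proof. by []. Qed.
Let id_bound (y : R) : 0 <= y -> id y <= 1 * (1 + y ^+ 1).
Proof. by rewrite expr1 mul1r /= lerDr. Qed.

(** The expected queue length is the expected cost for the cost function y |-> y. *)
Lemma mean_queue_bounded : exists2 B, 0 <= B & forall t, 0 <= t ->
  (\int[P]_w (queue t w)%:E <= B%:E)%E.
Proof. exact: (mean_queue_cost_bounded H_ge H_lt fbmW id_ge0 id_cont id_nd id_bound). Qed.

Lemma queue_integrable t : 0 <= t -> P.-integrable setT (fun w => (queue t w)%:E).
Proof.
move=> t0; have [B _ hB] := mean_queue_bounded.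
apply/integrableP; split.
  by apply/measurable_EFinP; exact: (measurable_queue H_ge fbmW).
under eq_integral do rewrite gee0_abs ?lee_fin ?(queue_length_ge0 fbmW)//.
by rewrite (le_lt_trans (hB _ t0))// ltry.
Qed.

Lemma netput_integrable t : 0 <= t ->
  P.-integrable setT (fun w => (netput W sigma x u t w)%:E) /\
  (\int[P]_w (netput W sigma x u t w)%:E = (x - u * t)%:E)%E.
Proof.
move=> t0; have iW : P.-integrable setT (fun w => (W t w)%:E).
  by apply: square_integrable_integrable => //; exact: (fbm_square_integrable fbmW).
have iZ := integrableZl measurableT c iW.
have ic : P.-integrable setT (fun=> (x - u * t)%:E) by exact: finite_measure_integrable_cst.
rewrite (_ : (fun w => _) = (fun w => (x - u * t)%:E + c%:E * (W t w)%:E)%E)//.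
split; first exact: (integrableD measurableT ic iZ).
rewrite integralD// integral_cst//= probability_setT mule1.
by rewrite integralZl// (fbm_integral fbmW)// mule0 adde0.
Qed.

(** The regulator is the queue minus the netput, and W has mean zero; since the
    expected queue length stays bounded, the expected regulator is u t up to a
    bounded error. *)
Lemma regulator_integrable t : 0 <= t ->
  P.-integrable setT (fun w => (regulator W sigma x u t w)%:E) /\
  (\int[P]_w (regulator W sigma x u t w)%:E =
    \int[P]_w (queue t w)%:E - (x - u * t)%:E)%E.
Proof.
move=> t0; have iq := queue_integrable t0; have [iN NE] := netput_integrable t0.
rewrite (_ : (fun w => _) = (fun w => (queue t w)%:E - (netput W sigma x u t w)%:E)%E).
  by split; [exact: integrableB|rewrite integralB// NE].
by apply/funext => w; rewrite -EFinB /queue_length addrAC subrr add0r.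
Qed.

(** The time average of the expected holding cost converges by the Cesaro
    argument, and the regulator contributes p u in the limit. *)
Lemma long_run_average_limit :
  long_run_average_cost W sigma h C p x u =
    ((h u + p * u)%:E + \int[P]_w (C (M w))%:E)%E.
Proof.
have iM := stationary_cost_integrable H_ge H_lt fbmW C_ge0 C_cont C_bound u_gt0 sigma_gt0.
have Gfin := integrable_fin_num measurableT iM.
set G := (\int[P]_w (C (M w))%:E)%E in Gfin *.
have [B B0 hB] := mean_queue_bounded.
have [B' B'0 hB'] := mean_queue_cost_bounded H_ge H_lt fbmW C_ge0 C_cont C_nd C_bound
  x_ge0 u_gt0 sigma_gt0.
pose g (t : R) := (\int[P]_w (C (queue (Num.max t 0) w))%:E)%E.
have g0 t : (0 <= g t)%E.
  apply: integral_ge0 => w _; rewrite lee_fin C_ge0// (queue_length_ge0 fbmW)//.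
  by rewrite le_max lexx orbT.
have G0 : 0 <= fine G by rewrite fine_ge0// integral_ge0// => w _; rewrite lee_fin C_ge0//
  (drifted_sup_ge0 fbmW)//= in_itv/= lexx.
have gB t : 0 <= t -> (g t <= B'%:E)%E by move=> t0; rewrite /g max_l//; exact: hB'.
have gG e : 0 < e -> exists A, forall t, A <= t -> ((fine G - e)%:E <= g t <= (fine G + e)%:E)%E.
  move=> e0; have [A hA] := mean_queue_cost_cvg H_ge H_lt fbmW C_ge0 C_cont C_nd C_bound
    x_ge0 u_gt0 sigma_gt0 e0.
  exists (Num.max A 0) => t; rewrite ge_max => /andP[At t0].
  by rewrite /g max_l//; exact: hA.
have mg : measurable_fun [set: R] g by exact: (measurable_mean_cost fbmW).
have ces := cesaro_mean mg g0 G0 B'0 gB gG.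
have valueE tau : 0 <= tau -> ('E_P[(fun w => \int[mu]_(t in `[0%R, tau]) C (queue t w)
                     + p * regulator W sigma x u tau w)%R] =
    \int[mu]_(t in `[0%R, tau]) g t + p%:E * (\int[P]_w (queue tau w)%:E - (x - u * tau)%:E))%E.
  move=> tau0; have [mS SE] := integrated_costE fbmW sigma C_ge0 C_cont C_nd x u tau0.
  have [iL LE] := regulator_integrable tau0.
  have Jfin : (\int[mu]_(t in `[0%R, tau]) g t < +oo)%E.
    apply: (@le_lt_trans _ _ (\int[mu]_(t in `[0%R, tau]) B'%:E)%E).
      apply: ge0_le_integral => //; first exact: measurable_funTS.
      by move=> t; rewrite /= in_itv/= => /andP[t0 _]; exact: gB.
    rewrite integral_cst//= lebesgue_measure_itv/= lte_fin.
    by case: ifPn => _; rewrite -?EFinD -?EFinM ?mule0 ltry.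
  have S0 w : 0 <= (\int[mu]_(t in `[0%R, tau]) C (queue t w))%R.
    apply: fine_ge0; apply: integral_ge0 => t; rewrite /= in_itv/= => /andP[t0 _].
    by rewrite lee_fin C_ge0// (queue_length_ge0 fbmW).
  have iS : P.-integrable setT (fun w => ((\int[mu]_(t in `[0%R, tau]) C (queue t w))%R)%:E).
    apply/integrableP; split; first exact/measurable_EFinP.
    by under eq_integral do rewrite gee0_abs ?lee_fin ?S0//; rewrite SE.
  rewrite unlock.
  under eq_integral do rewrite EFinD EFinM.
  rewrite (integralD measurableT iS (integrableZl measurableT p iL)).
  by rewrite SE integralZl// LE.
rewrite /long_run_average_cost (_ : (h u + p * u)%:E + G = (h u)%:E + (fine G + p * u)%:E)%E; last first.
  by rewrite -[in LHS](fineK Gfin) -!EFinD addrAC addrA.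
congr (_ + _)%E; apply: limf_esup_pinfty => e e0.
have e20 : 0 < e / 2 by rewrite divr_gt0.
have [A hA] := ces _ e20.
exists (Num.max A (Num.max 1 (p * (B + x) / (e / 2)))) => tau.
rewrite !ge_max => /and3P[At t1 Bt]; have t0 : 0 < tau by apply: lt_le_trans t1.
rewrite valueE ?(ltW t0)//.
have /andP[J1 J2] := hA _ At.
set J := (\int[mu]_(t in _) _)%E in J1 J2 *.
have Jf : J \is a fin_num by rewrite fin_numElt (lt_le_trans (ltNyr _) J1) (le_lt_trans J2 (ltry _)).
have iq := integrable_fin_num measurableT (queue_integrable (ltW t0)).
have Q1 := hB _ (ltW t0).
have Q0 : (0 <= \int[P]_w (queue tau w)%:E)%E.
  by apply: integral_ge0 => w _; rewrite lee_fin (queue_length_ge0 fbmW)// ltW.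
rewrite -(fineK Jf) in J1 J2 *; rewrite -(fineK iq) in Q0 Q1 *.
move: J1 J2 Q0 Q1; rewrite !lee_fin.
set j := fine J; set s := fine (\int[P]_w (queue tau w)%:E)%E => J1 J2 Q0 Q1.
rewrite [tau^-1 * _]mulrC ler_pdivlMr// ler_pdivrMr//.
move: Bt; rewrite ler_pdivrMr// => Bt.
have ps : 0 <= p * s by rewrite mulr_ge0.
have px : 0 <= p * x by rewrite mulr_ge0.
have psB : p * s <= p * B by rewrite ler_wpM2l.
apply/andP; split; lra.
Qed.

End long_run_average.

(** * Midpoint convexity and existence of a minimum *)

Section midpoint_convexity.
Variable R : realType.

(** Convex combinations with real weights instead of elements of the interval
    type. *)
Lemma convex_functionE (D : set R) (f : R -> R) (a b t : R) :
  convex_function (D : set (convex_lmodType R^o)) f -> D a -> D b -> 0 <= t -> t <= 1 ->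
  f (t * a + (1 - t) * b) <= t * f a + (1 - t) * f b.
Proof.
move=> cf Da Db t0 t1; have := cf (Itv01 t0 t1) a b (mem_set Da) (mem_set Db).
by rewrite !convRE.
Qed.

Let half0 : 0 <= 2^-1 :> R. Proof. by rewrite invr_ge0. Qed.
Let half1 : 2^-1 <= 1 :> R. Proof. by rewrite invf_le1// ler1n. Qed.
Let halfC : 1 - 2^-1 = 2^-1 :> R. Proof. by field. Qed.
Let midE (a b : R) : 2^-1 * a + 2^-1 * b = (a + b) / 2. Proof. by field. Qed.

Lemma convex_midpoint (D : set R) (f : R -> R) (a b : R) :
  convex_function (D : set (convex_lmodType R^o)) f -> D a -> D b ->
  f ((a + b) / 2) <= (f a + f b) / 2.
Proof.
by move=> cf Da Db; have := convex_functionE cf Da Db half0 half1; rewrite halfC !midE.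
Qed.

Lemma strictly_convex_midpoint (D : set R) (f : R -> R) (a b : R) :
  strictly_convex_function D f -> D a -> D b -> a != b ->
  f ((a + b) / 2) < (f a + f b) / 2.
Proof.
move=> cf Da Db ab.
have := cf (Itv01 half0 half1) _ _ a b (mem_set Da) (mem_set Db) ab.
rewrite !convRE /unstable.onem/= halfC !midE; apply; first by rewrite invr_gt0.
by rewrite invf_lt1// ltr1n.
Qed.

Lemma concave_midpoint (D : set R) (f : R -> R) (a b : R) :
  concave_function D f -> D a -> D b -> (f a + f b) / 2 <= f ((a + b) / 2).
Proof.
move=> cf Da Db; have := cf (Itv01 half0 half1) a b (mem_set Da) (mem_set Db).
by rewrite !convRE /unstable.onem/= halfC !midE.
Qed.

(** A point y >= y2 is a convex combination of 0 and y' > y with C 0 < C y, so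
    C y >= C y' is impossible. *)
Lemma convex_strictly_increasing (C : R -> R) (y2 : R) :
  {in `[0, +oo[ &, {homo C : x y / x <= y}} ->
  convex_function (`[0, +oo[%classic : set (convex_lmodType R^o)) C ->
  0 <= y2 -> C 0 < C y2 ->
  forall y y', 0 <= y -> 0 <= y' -> y2 <= y -> y < y' -> C y < C y'.
Proof.
move=> C_nd cC y20 C02 y y' y0 y'0 y2y yy'.
have y'p : 0 < y' by apply: le_lt_trans yy'.
pose t := 1 - y / y'.
have t1 : t <= 1 by rewrite gerBl divr_ge0.
have yy1 : y / y' < 1 by rewrite ltr_pdivrMr// mul1r.
have t0 : 0 < t by rewrite subr_gt0.
have I0 z : 0 <= z -> (`[0, +oo[%classic : set R) z by rewrite /= in_itv/= andbT.
have := convex_functionE cC (I0 0 (lexx 0)) (I0 _ y'0) (ltW t0) t1.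
have -> : t * 0 + (1 - t) * y' = y by rewrite /t; field; rewrite gt_eqF.
have : C y2 <= C y by apply: C_nd => //; rewrite in_itv/= andbT.
have t1' : 1 - t = y / y' by rewrite /t; ring.
have [y_gt0|] := ltP 0 y; last first.
  move=> yle; have y2E : y2 = 0 by apply/eqP; rewrite eq_le y20 (le_trans y2y).
  by move: C02; rewrite y2E ltxx.
have : 0 < 1 - t by rewrite t1' divr_gt0.
nra.
Qed.

(** Strict convexity from the arithmetic-geometric inequality used twice: first
    x y < ((x + y) / 2) ^ 2, then a b <= (a ^ 2 + b ^ 2) / 2 for the square roots
    a and b of x ^ (- k) and y ^ (- k). *)
Lemma powR_neg_midpoint (k x y : R) : 0 < k -> 0 < x -> 0 < y -> x != y ->
  ((x + y) / 2) `^ (- k) < (x `^ (- k) + y `^ (- k)) / 2.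
Proof.
move=> k0 x0 y0 xy; have k20 : 0 < k / 2 by rewrite divr_gt0.
have sq z : 0 < z -> z `^ (- k) = (z `^ (- (k / 2))) ^+ 2.
  move=> z0; rewrite -powR_mulrn ?powR_ge0// -powRrM; congr (_ `^ _).
  by rewrite mulNr; congr (- _); field.
have m0 : 0 < (x + y) / 2 by rewrite divr_gt0// addr_gt0.
set a := x `^ (- (k / 2)); set b := y `^ (- (k / 2)).
apply: (@lt_le_trans _ _ (a * b)); last first.
  by rewrite !sq// -/a -/b; have := sqr_ge0 (a - b); nra.
rewrite /a /b -powRM ?(ltW x0) ?(ltW y0)// !powRN.
have -> : ((x + y) / 2) `^ k = (((x + y) / 2) ^+ 2) `^ (k / 2).
  by rewrite -powR_mulrn ?(ltW m0)// -powRrM; congr (_ `^ _); field.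
have xy0 : 0 < x * y by rewrite mulr_gt0.
rewrite ltf_pV2 ?posrE ?powR_gt0 ?exprn_gt0//.
apply: gt0_ltr_powR => //; rewrite ?nnegrE ?(ltW xy0) ?sqr_ge0//.
have : 0 < (x - y) ^+ 2 by rewrite lt_neqAle sqr_ge0 eq_sym sqrf_eq0 subr_eq0 xy.
by rewrite !expr2; lra.
Qed.

Lemma powR_neg_le (k x y : R) : 0 <= k -> 0 < x -> x <= y -> y `^ (- k) <= x `^ (- k).
Proof.
move=> k0 x0 xy; have y0 := lt_le_trans x0 xy.
rewrite !powRN lef_pV2 ?posrE ?powR_gt0//.
by apply: ge0_ler_powR => //; rewrite nnegrE ltW.
Qed.

End midpoint_convexity.

Section optimal_drift.
Variable R : realType.

(** Near 0 and near infinity J is at least J 1, so the minimum over a compact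
    interval containing 1 is global. *)
Lemma minimum_pos (J : R -> R) :
  (forall u, 0 < u -> {for u, continuous J}) ->
  (\forall u \near 0^'+, J 1 <= J u) -> (\forall u \near +oo, J 1 <= J u) ->
  exists2 u, 0 < u & forall v, 0 < v -> J u <= J v.
Proof.
move=> cJ [dl /= dl0 near0] [M [_ hM]].
pose a := Num.min 1 (dl / 2); pose b := Num.max 1 (M + 1).
have a0 : 0 < a by rewrite lt_min ltr01 divr_gt0.
have a1 : a <= 1 by rewrite ge_min lexx.
have b1 : 1 <= b by rewrite le_max lexx.
have cab : {within `[a, b], continuous J}.
  apply: continuous_in_subspaceT => u; rewrite inE/= in_itv/= => /andP[au _].
  exact/cJ/(lt_le_trans a0).
have [u] := EVT_min (le_trans a1 b1) cab; rewrite in_itv/= => /andP[au _] min.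
have u1 : J u <= J 1 by apply: min; rewrite in_itv/= a1.
exists u => [|v v0]; first exact: lt_le_trans au.
have [va|av] := ltP v a.
  apply: (le_trans u1); apply: near0 => //=; rewrite sub0r normrN gtr0_norm//.
  have : v < dl / 2 by rewrite (lt_le_trans va)// ge_min lexx orbT.
  by lra.
have [vb|bv] := leP v b; first by apply: min; rewrite in_itv/= av.
apply: (le_trans u1); apply: hM; apply: le_lt_trans bv.
by rewrite le_max lerDl ler01 orbT.
Qed.

Variables (f S : R -> R) (kappa : R).
Hypotheses (kappa_gt0 : 0 < kappa) (f_gt0 : forall u, 0 < u -> 0 < f u)
  (f_concave : concave_function (`]0, +oo[%classic : set R) f)
  (S_le : forall b b', 0 <= b -> b <= b' -> S b <= S b')
  (S_mid : forall b b', 0 <= b -> 0 <= b' -> S ((b + b') / 2) <= (S b + S b') / 2).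

Local Notation G u := (S (f u `^ (- kappa))).

Let f_mid u v : 0 < u -> 0 < v -> (f u + f v) / 2 <= f ((u + v) / 2).
Proof. by move=> u0 v0; apply: (concave_midpoint f_concave); rewrite /= in_itv/= andbT. Qed.

(** A decreasing convex power of a concave function is convex, and S preserves
    this because it is convex and nondecreasing. *)
Lemma concave_drift_midpoint u v : 0 < u -> 0 < v -> f u != f v ->
  G ((u + v) / 2) <= (G u + G v) / 2.
Proof.
move=> u0 v0 uv; apply: le_trans (S_mid (powR_ge0 _ _) (powR_ge0 _ _)).
apply: S_le; first exact: powR_ge0.
apply: le_trans (ltW (powR_neg_midpoint kappa_gt0 (f_gt0 u0) (f_gt0 v0) uv)).
apply: powR_neg_le (f_mid u0 v0); first exact: ltW.
by rewrite divr_gt0// addr_gt0// f_gt0.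
Qed.

Lemma concave_drift_midpoint_lt u v :
  (forall b b', 0 < b -> b < b' -> S b < S b') -> 0 < u -> 0 < v -> f u != f v ->
  G ((u + v) / 2) < (G u + G v) / 2.
Proof.
move=> S_lt u0 v0 uv; apply: lt_le_trans (S_mid (powR_ge0 _ _) (powR_ge0 _ _)).
have m0 : 0 < (u + v) / 2 by rewrite divr_gt0// addr_gt0.
apply: S_lt; first by rewrite powR_gt0// f_gt0.
apply: le_lt_trans (powR_neg_midpoint kappa_gt0 (f_gt0 u0) (f_gt0 v0) uv).
apply: powR_neg_le (f_mid u0 v0); first exact: ltW.
by rewrite divr_gt0// addr_gt0// f_gt0.
Qed.

End optimal_drift.

(** * The drift cost as a real function *)

Section drift_cost.
Context d (T : measurableType d) (R : realType) (P : probability T R).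
Variables (H : R) (W : R -> {RV P >-> R}).
Hypotheses (H_ge : 2^-1 <= H) (H_lt : H < 1) (fbmW : fractional_brownian_motion H W).
Variables (sigma h C : R -> R) (p K' : R) (q : nat).
Hypotheses (sigma_gt0 : forall u : R, 0 <= u -> 0 < sigma u)
  (p_ge0 : 0 <= p)
  (h_ge0 : forall u : R, 0 <= u -> 0 <= h u)
  (h_cont : {within `[0, +oo[, continuous h})
  (h_nd : {in `[0, +oo[ &, {homo h : x y / x <= y}})
  (h_oo : h u @[u --> +oo] --> +oo)
  (C_ge0 : forall y : R, 0 <= y -> 0 <= C y)
  (C_cont : {within `[0, +oo[, continuous C})
  (C_nd : {in `[0, +oo[ &, {homo C : x y / x <= y}})
  (C_bound : forall y, 0 <= y -> C y <= K' * (1 + y ^+ q)).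

Local Notation f := (effective_drift sigma H).
Local Notation I := (drift_cost W sigma h C p H).
Local Notation Z := (max_drifted W 1).
Local Notation kappa := (hurst_exponent H).

(** The stationary cost as a real number, a function of the scale alone. *)
Definition mean_scaled_cost (b : R) : R := fine (scaled_cost P C Z b).
Local Notation S := mean_scaled_cost.

Definition real_drift_cost (u : R) : R := h u + p * u + S (f u `^ (- kappa)).
Local Notation J := real_drift_cost.

Let Z_ge0 := max_drifted1_ge0 fbmW.
Let mZ := measurable_max_drifted1 H_ge H_lt fbmW.
Let Z_mom := max_drifted1_moment H_ge H_lt fbmW.
Let kappa_gt0 := hurst_exponent_gt0 H_ge H_lt.

Lemma effective_drift_gt0 u : 0 < u -> 0 < f u.
Proof.
by move=> u0; have [] := drift_scale_effective H_ge H_lt (sigma_gt0 (ltW u0)) u0.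
Qed.

Lemma drift_costE u : 0 < u -> I u = (J u)%:E.
Proof.
move=> u0; rewrite /drift_cost (mean_costE H_ge H_lt fbmW C_ge0 C_cont (effective_drift_gt0 u0)).
rewrite [in RHS]/real_drift_cost [in RHS]EFinD /mean_scaled_cost fineK// (scaled_cost_fin C_ge0 C_cont C_bound mZ Z_ge0 Z_mom)//.
exact: powR_ge0.
Qed.

Lemma long_run_average_costE x u : 0 <= x -> 0 < u ->
  long_run_average_cost W sigma h C p x u = I u.
Proof.
move=> x0 u0; have s0 := sigma_gt0 (ltW u0).
rewrite (long_run_average_limit H_ge H_lt fbmW h p_ge0 C_ge0 C_cont C_nd C_bound x0 u0 s0).
rewrite (cost_drifted_sup H_ge H_lt fbmW C_ge0 C_cont s0 u0).
have [f0 ->] := drift_scale_effective H_ge H_lt s0 u0.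
by rewrite -(mean_costE H_ge H_lt fbmW C_ge0 C_cont f0).
Qed.

Lemma mean_scaled_cost_ge0 b : 0 <= b -> 0 <= S b.
Proof. by move=> b0; apply: fine_ge0; exact: (scaled_cost_ge0 P C_ge0 Z_ge0). Qed.

Lemma mean_scaled_cost_le b b' : 0 <= b -> b <= b' -> S b <= S b'.
Proof.
move=> b0 bb'; apply: fine_le; rewrite ?(scaled_cost_fin C_ge0 C_cont C_bound mZ Z_ge0 Z_mom)//.
  exact: le_trans bb'.
exact: (scaled_cost_le C_ge0 C_cont C_nd C_bound mZ Z_ge0 Z_mom).
Qed.

Lemma real_drift_cost_continuous : {in `]0, +oo[, continuous f} ->
  forall u, 0 < u -> {for u, continuous J}.
Proof.
move=> cf u u0; have f0 := effective_drift_gt0 u0.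
apply: cvgD; first apply: cvgD.
- have := continuous_extension h_cont (x := u); rewrite /continuous_at max_l ?(ltW u0)//.
  apply: cvg_trans; apply: near_eq_cvg; near=> v.
  by rewrite max_l//; near: v; exact: (cvgr_ge u).
- by apply: cvgM; [exact: cvg_cst|exact: cvg_id].
- apply: (cvg_comp (fun v => f v `^ (- kappa)) S); last first.
    apply: (scaled_cost_continuous C_ge0 C_cont C_nd C_bound mZ Z_ge0 Z_mom).
    exact: powR_gt0.
  apply: (cvg_comp f (fun y => y `^ (- kappa))).
    by apply: cf; rewrite in_itv/= andbT.
  have : derivable (fun y : R => y `^ (- kappa)) (f u) 1.
    by apply: derivable_powR; rewrite in_itv/= andbT.
  by move/derivable1_diffP/differentiable_continuous; exact.
Unshelve. all: by end_near. Qed.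

Lemma drift_cost_continuous : {in `]0, +oo[, continuous f} -> {in `]0, +oo[, continuous I}.
Proof.
move=> cf u; rewrite in_itv/= andbT => u0; rewrite /continuous_at drift_costE//.
have cJ : (J v)%:E @[v --> u] --> (J u)%:E.
  by apply: cvg_EFin; [exact: nearW|exact: real_drift_cost_continuous].
apply: cvg_trans cJ; apply: near_eq_cvg; near=> v.
by rewrite drift_costE//; near: v; exact: (cvgr_gt u).
Unshelve. all: by end_near. Qed.

(** As the effective drift tends to 0 the scale tends to infinity, and so does the
    stationary cost. *)
Lemma real_drift_cost_cvg0 : f u @[u --> 0^'+] --> 0 -> C y @[y --> +oo] --> +oo ->
  forall A, \forall u \near 0^'+, A <= J u.
Proof.
move=> f_0 C_oo A.
have [B B0 hB] := scaled_cost_cvgy C_ge0 C_cont C_nd C_bound mZ Z_ge0 Z_mom C_oo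
  (max_drifted1_tail H_ge H_lt fbmW 1) A.
have k0 : kappa != 0 by rewrite gt_eqF.
have B'0 : 0 < B `^ (- kappa^-1) by rewrite powR_gt0.
near=> u.
have u0 : 0 < u by near: u; exact: nbhs_right_gt.
have f0 := effective_drift_gt0 u0.
have fB : f u <= B `^ (- kappa^-1) by near: u; exact: (cvgr_le 0).
have Bf : B <= f u `^ (- kappa).
  have <- : (B `^ (- kappa^-1)) `^ (- kappa) = B.
    by rewrite -powRrM mulrNN mulVf// powRr1// ltW.
  by apply: powR_neg_le => //; exact: ltW.
have SA : A <= S (f u `^ (- kappa)).
  rewrite -lee_fin /mean_scaled_cost fineK ?hB//.
  by rewrite (scaled_cost_fin C_ge0 C_cont C_bound mZ Z_ge0 Z_mom)// powR_ge0.
have hu := h_ge0 (ltW u0); have pu : 0 <= p * u by rewrite mulr_ge0// ltW.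
by rewrite /real_drift_cost; lra.
Unshelve. all: by end_near. Qed.

Lemma real_drift_cost_cvgy A : \forall u \near +oo, A <= J u.
Proof.
have /cvgryPge/(_ A) h_ge := h_oo; near=> u.
have u0 : 0 < u by near: u; exact: nbhs_pinfty_gt.
have hA : A <= h u by near: u; exact: h_ge.
have Su := mean_scaled_cost_ge0 (powR_ge0 (f u) (- kappa)).
have pu : 0 <= p * u by rewrite mulr_ge0// ltW.
by rewrite /real_drift_cost; lra.
Unshelve. all: by end_near. Qed.

Lemma minimizer_posE u : minimizer_pos I u <-> 0 < u /\ forall v, 0 < v -> J u <= J v.
Proof.
split=> -[u0 min]; (split; first exact: u0) => v v0; have := min v v0.
  by rewrite (drift_costE u0) (drift_costE v0) lee_fin.
by rewrite (drift_costE u0) (drift_costE v0) lee_fin.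
Qed.

(** Any strictly better competitor for a pair of distinct points excludes that
    both are minimizers. *)
Lemma minimizer_unique :
  (forall u v, 0 < u -> u < v -> exists2 m, 0 < m & J m < Num.max (J u) (J v)) ->
  forall u1 u2, minimizer_pos I u1 -> minimizer_pos I u2 -> u1 = u2.
Proof.
move=> strict.
suff lt_absurd u1 u2 : u1 < u2 -> minimizer_pos I u1 -> minimizer_pos I u2 -> False.
  move=> u1 u2 m1 m2; apply/eqP; case: ltgtP => // u12; exfalso.
    exact: lt_absurd m1 m2.
  exact: lt_absurd m2 m1.
move=> u12 /minimizer_posE[u10 m1] /minimizer_posE[u20 m2].
have [m m0 Jm] := strict _ _ u10 u12.
have le_m : Num.max (J u1) (J u2) <= J m.
  by rewrite ge_max; apply/andP; split; [exact: m1|exact: m2].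
by have := lt_le_trans Jm le_m; rewrite ltxx.
Qed.

Let mid_le_max (a b : R) : (a + b) / 2 <= Num.max a b.
Proof.
have : a <= Num.max a b by rewrite le_max lexx.
have : b <= Num.max a b by rewrite le_max lexx orbT.
lra.
Qed.

Let midpoint_lt u v : 0 < u -> u < v -> J ((u + v) / 2) < (J u + J v) / 2 ->
  exists2 m, 0 < m & J m < Num.max (J u) (J v).
Proof.
move=> u0 uv lt; have v0 := lt_trans u0 uv.
exists ((u + v) / 2); first by rewrite divr_gt0// addr_gt0.
exact: lt_le_trans lt (mid_le_max _ _).
Qed.

Let affine_midpoint (u v m m' a b a' b' : R) : m + m' < (a + b) / 2 + (a' + b') / 2 ->
  m + p * ((u + v) / 2) + m' < ((a + p * u + a') + (b + p * v + b')) / 2.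
Proof. lra. Qed.

Let midpoint_sum_lt u v :
  h ((u + v) / 2) + S (f ((u + v) / 2) `^ (- kappa)) <
    (h u + h v) / 2 + (S (f u `^ (- kappa)) + S (f v `^ (- kappa))) / 2 ->
  J ((u + v) / 2) < (J u + J v) / 2.
Proof. exact: affine_midpoint. Qed.

Hypotheses (f_incr : {in `]0, +oo[ &, {homo f : x y / x < y}})
  (f_concave : concave_function (`]0, +oo[%classic : set R) f)
  (C_convex : convex_function (`[0, +oo[%classic : set R) C).

Let f_lt u v : 0 < u -> u < v -> f u < f v.
Proof. by move=> u0 uv; apply: f_incr; rewrite ?in_itv/= ?andbT// (lt_trans u0). Qed.

Let inI (z : R) : 0 <= z -> (`[0, +oo[%classic : set R) z.
Proof. by move=> z0; rewrite /= in_itv/= andbT. Qed.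

Let S_mid b b' : 0 <= b -> 0 <= b' -> S ((b + b') / 2) <= (S b + S b') / 2.
Proof.
apply: (scaled_cost_midpoint C_ge0 C_cont C_bound mZ Z_ge0 Z_mom) => x y x0 y0.
by apply: (convex_midpoint C_convex); exact: inI.
Qed.

(** If C is not constant, convexity makes it strictly increasing from some point
    on; then S is strictly increasing, and strict convexity of the negative power
    makes J strictly midpoint convex. If C is constant, the linear term p u makes
    J strictly increasing, and there is no minimizer at all. *)
Lemma minimizer_unique_linear : 0 < p -> convex_function (`[0, +oo[%classic : set R) h ->
  forall u1 u2, minimizer_pos I u1 -> minimizer_pos I u2 -> u1 = u2.
Proof.
move=> p0 h_convex; apply: minimizer_unique => u v u0 uv.
have v0 := lt_trans u0 uv.
have [[y y0 Cy]|Cc] := pselect (exists2 y, 0 <= y & C 0 < C y).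
  apply: midpoint_lt => //.
  have S_lt b b' : 0 < b -> b < b' -> S b < S b'.
    move=> b0 bb'; apply: (scaled_cost_lt C_ge0 C_cont C_nd C_bound mZ Z_ge0 Z_mom (y2 := y)) => //.
      by move=> a a' a0 a'0; exact: (convex_strictly_increasing C_nd C_convex).
    exact: (max_drifted1_tail H_ge H_lt fbmW).
  apply: midpoint_sum_lt; apply: ler_ltD; last first.
    exact: (concave_drift_midpoint_lt kappa_gt0 effective_drift_gt0 f_concave S_mid
      S_lt u0 v0 (negbT (lt_eqF (f_lt u0 uv)))).
  exact: (convex_midpoint h_convex (inI (ltW u0)) (inI (ltW v0))).
exists u => //; rewrite lt_max; apply/orP; right.
have CE y : 0 <= y -> C y = C 0.
  move=> y0; apply/eqP; rewrite eq_le (cost_le C_nd (lexx 0) y0) andbT leNgt.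
  by apply/negP => Cy; apply: Cc; exists y.
have S_cst b b' : 0 <= b -> 0 <= b' -> S b <= S b'.
  move=> b0 b'0; rewrite le_eqVlt; apply/orP; left; apply/eqP.
  by congr fine; apply: eq_integral => w _; rewrite !CE// mulr_ge0.
apply: ltr_leD; last exact: (S_cst _ _ (powR_ge0 (f u) (- kappa)) (powR_ge0 (f v) (- kappa))).
apply: ler_ltD; last by rewrite ltr_pM2l.
by apply: h_nd; rewrite ?in_itv/= ?andbT ltW.
Qed.

Lemma minimizer_unique_strictly_convex : strictly_convex_function (`[0, +oo[%classic : set R) h ->
  forall u1 u2, minimizer_pos I u1 -> minimizer_pos I u2 -> u1 = u2.
Proof.
move=> h_convex; apply: minimizer_unique => u v u0 uv; have v0 := lt_trans u0 uv.
apply: midpoint_lt => //.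
apply: midpoint_sum_lt; apply: ltr_leD.
  exact: (strictly_convex_midpoint h_convex (inI (ltW u0)) (inI (ltW v0)) (negbT (lt_eqF uv))).
exact: (concave_drift_midpoint kappa_gt0 effective_drift_gt0 f_concave
  mean_scaled_cost_le S_mid u0 v0 (negbT (lt_eqF (f_lt u0 uv)))).
Qed.

End drift_cost.

Unset Implicit Arguments.
Set Strict Implicit.
Set Printing Implicit Defensive.

Theorem theorem3p7 (d : measure_display) (T : measurableType d) (R : realType)
    (P : probability T R) (H : R) (W : R -> {RV P >-> R})
    (sigma h C : R -> R) (p K gamma : R)
    (H_ge : 2^-1 <= H) (H_lt : H < 1)
    (fbmW : fractional_brownian_motion H W)
    (sigma_cont : {within `[0, +oo[, continuous sigma})
    (sigma_gt0 : forall u : R, 0 <= u -> 0 < sigma u)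
    (p_ge0 : 0 <= p)
    (h_ge0 : forall u : R, 0 <= u -> 0 <= h u)
    (h_cont : {within `[0, +oo[, continuous h})
    (h_nd : {in `[0, +oo[ &, {homo h : x y / x <= y}})
    (h_oo : h u @[u --> +oo] --> +oo)
    (C_ge0 : forall y : R, 0 <= y -> 0 <= C y)
    (C_cont : {within `[0, +oo[, continuous C})
    (C_nd : {in `[0, +oo[ &, {homo C : x y / x <= y}})
    (K_gt0 : 0 < K) (gamma_gt0 : 0 < gamma)
    (C_bound : forall y : R, 0 <= y -> C y <= K * (1 + y `^ gamma)) :
  let f := effective_drift sigma H in
  let I := drift_cost W sigma h C p H in
  forall (f_cont : {in `]0, +oo[, continuous f})
    (f_0 : f u @[u --> 0^'+] --> 0),
  (forall x u : R, 0 <= x -> 0 < u ->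
     long_run_average_cost W sigma h C p x u = I u) /\
  [/\ C y @[y --> +oo] --> +oo -> I u @[u --> 0^'+] --> +oo%E,
      I u @[u --> +oo] --> +oo%E,
      forall u : R, 0 < u -> I u \is a fin_num,
      {in `]0, +oo[, continuous I} &
      C y @[y --> +oo] --> +oo -> exists ustar : R, minimizer_pos I ustar] /\
  ({in `]0, +oo[ &, {homo f : x y / x < y}} -> concave_function (`]0, +oo[%classic : set R) f ->
     (0 < p -> convex_function (`[0, +oo[%classic : set R) h -> convex_function (`[0, +oo[%classic : set R) C ->
       forall u1 u2 : R, minimizer_pos I u1 -> minimizer_pos I u2 -> u1 = u2) /\
     (p = 0 -> strictly_convex_function (`[0, +oo[%classic : set R) h ->
       convex_function (`[0, +oo[%classic : set R) C ->
       forall u1 u2 : R, minimizer_pos I u1 -> minimizer_pos I u2 -> u1 = u2)).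
Proof.
move=> f I f_cont f_0.
have [q C_poly] := powR_le_exprn K_gt0 gamma_gt0 C_bound.
pose J := real_drift_cost H W sigma h C p.
have IE u : 0 < u -> I u = (J u)%:E.
  by move=> u0; exact: (drift_costE H_ge H_lt fbmW h p sigma_gt0 C_ge0 C_cont C_poly u0).
have J_0 : C y @[y --> +oo] --> +oo -> forall A, \forall u \near 0^'+, A <= J u.
  exact: (real_drift_cost_cvg0 H_ge H_lt fbmW sigma_gt0 p_ge0 h_ge0 C_ge0 C_cont C_nd C_poly f_0).
have J_oo A : \forall u \near +oo, A <= J u.
  exact: (real_drift_cost_cvgy fbmW sigma p_ge0 h_oo C_ge0).
split; last split.
- move=> x u x0 u0.
  exact: (long_run_average_costE H_ge H_lt fbmW h sigma_gt0 p_ge0 C_ge0 C_cont C_nd C_poly x0 u0).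
- split.
  + move=> C_oo; apply/cvgeyPge => A; near=> u.
    rewrite IE ?lee_fin; last by near: u; exact: nbhs_right_gt.
    by near: u; exact: J_0.
  + apply/cvgeyPge => A; near=> u.
    rewrite IE ?lee_fin; last by near: u; exact: nbhs_pinfty_gt.
    by near: u; exact: J_oo.
  + by move=> u u0; rewrite IE.
  + move=> u; apply: (drift_cost_continuous H_ge H_lt fbmW sigma_gt0 h_cont C_ge0 C_cont
      C_nd C_poly f_cont).
  + move=> C_oo.
    have cJ u : 0 < u -> {for u, continuous J}.
      apply: (real_drift_cost_continuous H_ge H_lt fbmW sigma_gt0 h_cont C_ge0 C_cont
        C_nd C_poly f_cont).
    have [u u0 min] := minimum_pos cJ (J_0 C_oo (J 1)) (J_oo (J 1)).
    exists u; split; first exact: u0.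
    by move=> v v0; rewrite (IE _ u0) (IE _ v0) lee_fin; exact: min.
- move=> f_incr f_concave; split=> [p_gt0 h_convex C_convex|_ h_convex C_convex].
  + exact: (minimizer_unique_linear H_ge H_lt fbmW sigma_gt0 h_nd C_ge0 C_cont C_nd C_poly
      f_incr f_concave C_convex p_gt0 h_convex).
  + exact: (minimizer_unique_strictly_convex H_ge H_lt fbmW sigma_gt0 C_ge0 C_cont C_nd C_poly
      f_incr f_concave C_convex h_convex).
Unshelve. all: by end_near. Qed.
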